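(* Let $d\ge2$. Let $\tilde\mu$ and $\tilde\nu$ be nonnegative sequences in $\ell_1(\mathbb{N}_0)$, and let $\tilde\Lambda=\{\tilde\lambda_k\}_{k\ge0}=\tilde\mu*\tilde\mu+\tilde\nu*\tilde\nu$. Assume $\sum_\ell\tilde\lambda_\ell>0$. Then for every $n\in\mathbb{N}$, $$e_n(\mathrm{H}_{\tilde\Lambda})^2\ge\tilde\lambda_0\Big(1-\frac{n\tilde\lambda_0}{\sum_{\ell\ge0}\tilde\lambda_\ell}\Big).$$
   Context: Let $\mathbb{S}^d$ be the unit sphere in $\mathbb{R}^{d+1}$ with normalized surface measure $\sigma_d$. Let $w_0(t)=c_0(1-t^2)^{(d-2)/2}$ be the probability weight on $[-1,1]$, and write $\langle f\rangle=\int_{-1}^1fw_0$. Let $G_\ell$ be the Gegenbauer polynomials of index $(d-1)/2$ normalized by $G_\ell(1)=1$, let $h_k^2=\langle G_k^2\rangle$, and let $C^{\ell,s}_k=\langle G_\ell G_sG_k\rangle/h_k^2$. For nonnegative $\tilde\mu,\tilde\nu\in\ell_1(\mathbb{N}_0)$ define the convolution $(\tilde\mu*\tilde\nu)_k=\sum_{\ell\ge0}\sum_{s\ge0}C^{\ell,s}_k\tilde\mu_\ell\tilde\nu_s$. For a nonnegative $\tilde\Lambda\in\ell_1(\mathbb{N}_0)$, let $\mathrm{H}_{\tilde\Lambda}$ be the reproducing kernel Hilbert space on $\mathbb{S}^d$ with kernel $K_{\tilde\Lambda}(x,y)=\sum_{\ell\ge0}\tilde\lambda_\ell G_\ell(x\cdot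 y)$. When all $\tilde\lambda_\ell>0$, it consists of $f\in L_2$ with $\sum_\ell N(d,\ell)\tilde\lambda_\ell^{-1}\|H_\ell(f)\|^2_{L_2}<\infty$, where $N(d,\ell)$ is the dimension of the space of spherical harmonics of degree $\ell$ and $H_\ell$ is the projection onto it. The optimal quadrature error is $$e_n(H)=\inf_{c\in\mathbb{R}^n,\ x_j\in\mathbb{S}^d}\sup_{\|f\|_H\le1}\Big|\int f\,d\sigma_d-\sum_{j=1}^nc_jf(x_j)\Big|.$$ *)

(* Defs.v *)
From HB Require Import structures.
From mathcomp Require Import all_boot all_order all_algebra.
From mathcomp Require Import all_classical all_reals all_analysis.
Set Implicit Arguments. Unset Strict Implicit. Unset Printing Implicit Defensive.
Import Order.TTheory GRing.Theory Num.Theory.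
Import numFieldNormedType.Exports.
Local Open Scope classical_set_scope.
Local Open Scope ring_scope.

Section Defs.
Variable R : realType.

Definition rsum (a : nat -> R) : R := limn (fun n => \sum_(i < n) a i).

Definition nonneg_l1 (a : nat -> R) : Prop :=
  (forall i, 0 <= a i) /\ cvgn (fun n => \sum_(i < n) a i).

(** Gegenbauer polynomials C_n^lam (standard normalization, DLMF 18.9.1):
    C_0 = 1, C_1 = 2 lam x, n C_n = 2x(n+lam-1) C_{n-1} - (n+2lam-2) C_{n-2}.
    gegpair lam x n = (C_n(x), C_{n+1}(x)). *)
Fixpoint gegpair (lam x : R) (n : nat) : R * R :=
  match n with
  | 0 => (1, 2 * lam * x)
  | n'.+1 =>
    let p := gegpair lam x n' in
    (p.2, (2 * x * (n'.+2%:R + lam - 1) * p.2 - (n'.+2%:R + 2 * lam - 2) * p.1)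
            / n'.+2%:R)
  end.
Definition gegenbauer (lam : R) (n : nat) (x : R) : R := (gegpair lam x n).1.

Definition Gnorm (d : nat) (l : nat) (t : R) : R :=
  gegenbauer ((d%:R - 1) / 2) l t / gegenbauer ((d%:R - 1) / 2) l 1.

Definition w_un (d : nat) (t : R) : R := powR (1 - t ^+ 2) ((d%:R - 2) / 2).
Definition c0 (d : nat) : R :=
  (\int[lebesgue_measure]_(t in `[-1, 1]) w_un d t)^-1.
Definition w0 (d : nat) (t : R) : R := c0 d * w_un d t.
Definition wavg (d : nat) (f : R -> R) : R :=
  \int[lebesgue_measure]_(t in `[-1, 1]) (f t * w0 d t).

Definition h2 (d k : nat) : R := wavg d (fun t => Gnorm d k t ^+ 2).
Definition Ccoef (d l s k : nat) : R :=
  wavg d (fun t => Gnorm d l t * Gnorm d s t * Gnorm d k t) / h2 d k.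

Definition seqconv (d : nat) (mu nu : nat -> R) (k : nat) : R :=
  rsum (fun l => rsum (fun s => Ccoef d l s k * mu l * nu s)).

Definition pt (d : nat) := 'rV[R]_d.+1.
Definition rdot (d : nat) (x y : pt d) : R := \sum_(i < d.+1) x ord0 i * y ord0 i.
Definition sphereS (d : nat) : set (pt d) := [set x | rdot x x = 1].

Definition zkernel (d : nat) (lam : nat -> R) (x y : pt d) : R :=
  rsum (fun l => lam l * Gnorm d l (rdot x y)).

Fixpoint itint (n : nat) (g : seq R -> R) : R :=
  match n with
  | 0 => g [::]
  | n'.+1 => \int[lebesgue_measure]_(t in [set: R]) itint n' (fun s => g (t :: s))
  end.
Definition rvec (d : nat) (s : seq R) : pt d := \row_(i < d.+1) nth 0 s i.

(** integral over S^d w.r.t. the normalized surface measure sigma_d,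
    realized as the cone measure: (1/|B|) int_{B} f(x/|x|) dx, B the unit ball *)
Definition sph_int (d : nat) (f : pt d -> R) : R :=
  itint d.+1 (fun s => let x := rvec d s in
     if (rdot x x <= 1) && (x != 0) then f ((Num.sqrt (rdot x x))^-1 *: x) else 0)
  / itint d.+1 (fun s => let x := rvec d s in if rdot x x <= 1 then 1 else 0).

(** RKHS of a kernel on S^d as the completion of span{K(.,y)}:
    finite combinations sum_i a_i K(., y_i) with y_i on the sphereS *)
Definition kcomb (d : nat) (lam : nat -> R) (c : seq (R * pt d)) (x : pt d) : R :=
  \sum_(p <- c) p.1 * zkernel lam p.2 x.
Definition knorm2 (d : nat) (lam : nat -> R) (c : seq (R * pt d)) : R :=
  \sum_(p <- c) \sum_(q <- c) p.1 * q.1 * zkernel lam p.2 q.2.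
Definition csub (d : nat) (c c' : seq (R * pt d)) : seq (R * pt d) :=
  c ++ [seq (- p.1, p.2) | p <- c'].

Definition rkhs_ball (d : nat) (lam : nat -> R) (f : pt d -> R) : Prop :=
  exists g : nat -> seq (R * pt d),
    (forall n p, p \in g n -> @sphereS d p.2) /\
    (forall x, @sphereS d x -> (fun n => kcomb lam (g n) x) @ \oo --> f x) /\
    (forall e : R, 0 < e -> exists N, forall m n, (N <= m)%N -> (N <= n)%N ->
        knorm2 lam (csub (g m) (g n)) < e) /\
    limn (fun n => knorm2 lam (g n)) <= 1.

Definition wce (d n : nat) (lam : nat -> R) (c : 'I_n -> R) (x : 'I_n -> pt d)
  : \bar R :=
  ereal_sup [set (`| sph_int f - \sum_(j < n) c j * f (x j) |)%:E
            | f in rkhs_ball lam].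

Definition e_opt (d n : nat) (lam : nat -> R) : \bar R :=
  ereal_inf [set wce lam c x | c in [set: 'I_n -> R] &
             x in [set x : 'I_n -> pt d | forall j, @sphereS d (x j)]].
End Defs.

(* Main.v *)
Require Import Defs.
From HB Require Import structures.
From mathcomp Require Import all_boot all_order all_algebra.
From mathcomp Require Import all_classical all_reals all_analysis.
From mathcomp Require Import measurable_realfun ring lra.
From mathcomp Require Import -(notations) ssrcomplements.
From mathcomp Require Import -(notations) mpoly.

(** For a positive semidefinite matrix M of size n with constant diagonal A,
    Vybiral's inequality gives sum_ij c_i c_j M_ij^2 >= A^2 (sum_i c_i)^2 / n: factor
    M = W W^T with W of size n, write the left-hand side as the squared Frobenius
    norm of W^T diag(c) W, and compare with its trace.  The linearization formula
    for Gegenbauer polynomials makes the kernel K of the convolution mu * mu + nu * nu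
    equal to K_mu^2 + K_nu^2, so that sum_ij c_i c_j K(x_i, x_j) >= L s^2 / n with
    s = sum_i c_i and L the sum of the coefficients of K.  The squared
    worst-case error l0 - 2 l0 s + sum_ij c_i c_j K(x_i, x_j) is then minimal at
    s = n l0 / L.

    Three facts carry the argument.
    - G_l(x . y) is positive definite: the zonal harmonics are reproducing, up to
      a positive factor, for the Fischer product on harmonic polynomials.
    - The spherical mean of p(y . x) does not depend on the unit vector y and equals
      <p>: iterated Lebesgue integrals of functions of (|x|^2, y . x) are invariant under
      plane rotations (three shears), which forces a two-term recurrence on the
      moments, the same as the one given on [-1, 1] by integration by parts.
    - The representer of the integral is a limit of equal-weight rules: kernel
      herding chooses each new node where the sum of the previous kernel sections is
      not above its mean.  Herding also shows that a positive definite zonal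
      polynomial has nonnegative mean, whence the linearization coefficients are
      nonnegative. *)

Set Implicit Arguments. Unset Strict Implicit. Unset Printing Implicit Defensive.
Import Order.TTheory GRing.Theory Num.Theory.
Local Open Scope ring_scope.

(** * The Fischer product and positive definiteness of Gegenbauer kernels *)

(** The linearization coefficients are integrals against a weight on [-1, 1], while kernels are
    integrated over a sphere that is only given through iterated one-dimensional Lebesgue integrals.
    Passing through moments replaces polar coordinates: the invariance needed is obtained from
    translations and Tonelli alone. Iterated real integrals are additive only for integrable
    integrands, hence every integrand carries a bound and a joint measurability condition. For a
    lower bound it is enough to test the rule on finite kernel combinations of norm at most 1, so
    the exact representer of the error is never built. Its constant part is removed first: for a
    kernel of mean zero, the double sum over N herded points is O(N), so their equal-weight average
    has squared norm O(1/N) and Cauchy-Schwarz controls every cross term. With a negative mean m the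
    same double sum would be about m N^2, against positive definiteness; thus the sign of a mean
    follows from finite quadratic forms, without double integrals over the sphere. *)

Section Fischer.
Variables (n : nat) (R : realType).
Local Notation P := (mpoly n R).
Implicit Types (p q : P) (i : 'I_n).

Definition mvar i : P := mpolyX R (mnm1 i).

Definition mfact (m : multinom n) : R := \prod_i ((m i)`!)%:R.

Lemma mfact_ge0 m : 0 <= mfact m.
Proof. by apply: prodr_ge0 => i _; rewrite ler0n. Qed.

Lemma mfact_addU m i : mfact (mnm_add m (mnm1 i)) = (m i).+1%:R * mfact m.
Proof.
rewrite /mfact (bigD1 i) //= [in RHS](bigD1 i) //= mnmDE mnm1E eqxx addn1.
rewrite factS natrM -!mulrA; congr (_ * (_ * _)).
apply: eq_bigr => j ji; rewrite mnmDE mnm1E eq_sym (negbTE ji) addn0 //.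
Qed.

Definition fischer p q : R :=
  \sum_(m <- msupp p) mcoeff m p * mcoeff m q * mfact m.

Lemma fischerwE p q k : (msize p <= k)%N ->
  fischer p q = \sum_(m : bmultinom n k) mcoeff m p * mcoeff m q * mfact m.
Proof.
move=> lek; rewrite /fischer (big_mksub (bmultinom n k)) //=; first last.
- by move=> x /msize_mdeg_lt /leq_trans; apply.
- exact: msupp_uniq.
by rewrite big_rmcond //= => m /memN_msupp_eq0 ->; rewrite !mul0r.
Qed.

Lemma fischerC p q : fischer p q = fischer q p.
Proof.
rewrite (@fischerwE p q (maxn (msize p) (msize q))) ?leq_maxl //.
rewrite (@fischerwE q p (maxn (msize p) (msize q))) ?leq_maxr //.
by apply: eq_bigr => m _; rewrite [X in X * _]mulrC.
Qed.

Lemma fischer_ge0 p : 0 <= fischer p p.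
Proof.
by apply: sumr_ge0 => m _; rewrite mulr_ge0 ?mfact_ge0 // -expr2 sqr_ge0.
Qed.

Lemma fischer0r p : fischer p 0 = 0.
Proof. by rewrite /fischer big1 // => m _; rewrite mcoeff0 mulr0 mul0r. Qed.

Lemma fischerDr p q1 q2 : fischer p (q1 + q2) = fischer p q1 + fischer p q2.
Proof.
by rewrite /fischer -big_split /=; apply: eq_bigr => m _; rewrite mcoeffD; ring.
Qed.

Lemma fischerZr p c q : fischer p (c *: q) = c * fischer p q.
Proof.
by rewrite /fischer mulr_sumr; apply: eq_bigr => m _; rewrite mcoeffZ; ring.
Qed.

Lemma fischerDl p1 p2 q : fischer (p1 + p2) q = fischer p1 q + fischer p2 q.
Proof. by rewrite ![fischer _ q]fischerC fischerDr. Qed.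

Lemma fischerZl c p q : fischer (c *: p) q = c * fischer p q.
Proof. by rewrite ![fischer _ q]fischerC fischerZr. Qed.

Lemma fischer_suml I (r : seq I) (F : I -> P) q :
  fischer (\sum_(i <- r) F i) q = \sum_(i <- r) fischer (F i) q.
Proof.
elim: r => [|a r IH]; first by rewrite !big_nil fischerC fischer0r.
by rewrite !big_cons fischerDl IH.
Qed.

Lemma fischer_sumr I (r : seq I) (F : I -> P) p :
  fischer p (\sum_(i <- r) F i) = \sum_(i <- r) fischer p (F i).
Proof.
by rewrite fischerC fischer_suml; apply: eq_bigr => i _; rewrite fischerC.
Qed.

Lemma fischerXl m q : fischer (mpolyX R m) q = mcoeff m q * mfact m.
Proof. by rewrite /fischer msuppX big_seq1 mcoeffX eqxx mul1r. Qed.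

(** The weight [mfact] is chosen for this adjunction: differentiating X^(m + e_i) produces the
    factor m_i + 1 by which the two factorials differ. *)
Lemma fischer_mulX i p q : fischer (mvar i * p) q = fischer p (mderiv i q).
Proof.
rewrite [p]mpolyE mulr_sumr !fischer_suml; apply: eq_bigr => m _.
rewrite -scalerAr !fischerZl /mvar -mpolyXD !fischerXl; congr (_ * _).
rewrite mcoeff_mderiv addmC mfact_addU -mulr_natr; ring.
Qed.

Lemma mderiv_var i j : mderiv i (mvar j) = (i == j)%:R.
Proof.
rewrite /mvar mderivX mnm1E eq_sym; case: eqP => [->|_]; last by rewrite scale0r.
rewrite scale1r; have -> : mnm_sub (mnm1 j) (mnm1 j) = mnm0.
  by apply/mnmP => k; rewrite mnmBE subnn mnm0E.
by rewrite mpolyX0.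
Qed.

Definition linform (y : 'I_n -> R) : P := \sum_i y i *: mvar i.
Definition sqform : P := \sum_i mvar i * mvar i.
Definition dirder (y : 'I_n -> R) p : P := \sum_i y i *: mderiv i p.
Definition euler p : P := \sum_i mvar i * mderiv i p.
Definition laplace p : P := \sum_i mderiv i (mderiv i p).
Definition vdot (x y : 'I_n -> R) : R := \sum_i x i * y i.

Lemma fischer_linform y p q : fischer (linform y * p) q = fischer p (dirder y q).
Proof.
rewrite /linform /dirder mulr_suml fischer_suml fischer_sumr.
by apply: eq_bigr => i _; rewrite -scalerAl fischerZl fischer_mulX fischerZr.
Qed.

Lemma fischer_sqform p q : fischer (sqform * p) q = fischer p (laplace q).
Proof.
rewrite /sqform /laplace mulr_suml fischer_suml fischer_sumr.
by apply: eq_bigr => i _; rewrite -mulrA !fischer_mulX.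
Qed.

Lemma mderiv_linform i y : mderiv i (linform y) = y i *: 1.
Proof.
rewrite /linform raddf_sum /= (bigD1 i) //= mderivZ mderiv_var eqxx.
rewrite big1 ?addr0 // => j ji.
by rewrite mderivZ mderiv_var eq_sym (negbTE ji) scaler0.
Qed.

Lemma mderiv_sqform i : mderiv i sqform = mvar i *+ 2.
Proof.
rewrite /sqform raddf_sum /= (bigD1 i) //= mderivM mderiv_var eqxx.
rewrite big1 ?addr0 => [|j ji]; first by rewrite mul1r mulr1.
by rewrite mderivM mderiv_var eq_sym (negbTE ji) mul0r mulr0 addr0.
Qed.

Lemma dirderM y p q : dirder y (p * q) = dirder y p * q + p * dirder y q.
Proof.
rewrite /dirder mulr_suml mulr_sumr -big_split /=; apply: eq_bigr => i _.
by rewrite mderivM scalerDr scalerAl scalerAr.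
Qed.

Lemma dirderD y p q : dirder y (p + q) = dirder y p + dirder y q.
Proof.
rewrite /dirder -big_split /=; apply: eq_bigr => i _.
by rewrite mderivD scalerDr.
Qed.

Lemma dirderZ y c p : dirder y (c *: p) = c *: dirder y p.
Proof.
rewrite /dirder scaler_sumr; apply: eq_bigr => i _.
by rewrite mderivZ !scalerA mulrC.
Qed.

Lemma dirder1 y : dirder y 1 = 0.
Proof.
by rewrite /dirder big1 // => i _; rewrite -mpolyC1 mderivC scaler0.
Qed.

Lemma dirder_linform y x : dirder y (linform x) = vdot y x *: 1.
Proof.
rewrite /dirder /vdot scaler_suml; apply: eq_bigr => i _.
by rewrite mderiv_linform scalerA.
Qed.

Lemma dirder_sqform y : dirder y sqform = 2 *: linform y.
Proof.
rewrite /dirder /linform scaler_sumr; apply: eq_bigr => i _.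
by rewrite mderiv_sqform -scaler_nat !scalerA mulrC.
Qed.

Lemma eulerM p q : euler (p * q) = euler p * q + p * euler q.
Proof.
rewrite /euler mulr_suml mulr_sumr -big_split /=; apply: eq_bigr => i _.
by rewrite mderivM; ring.
Qed.

Lemma eulerD p q : euler (p + q) = euler p + euler q.
Proof.
rewrite /euler -big_split /=; apply: eq_bigr => i _.
by rewrite mderivD mulrDr.
Qed.

Lemma eulerZ c p : euler (c *: p) = c *: euler p.
Proof.
rewrite /euler scaler_sumr; apply: eq_bigr => i _.
by rewrite mderivZ scalerAr.
Qed.

Lemma euler1 : euler 1 = 0.
Proof. by rewrite /euler big1 // => i _; rewrite -mpolyC1 mderivC mulr0. Qed.

Lemma euler_linform x : euler (linform x) = linform x.
Proof.
rewrite /euler /linform; apply: eq_bigr => i _.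
by rewrite mderiv_linform -scalerAr mulr1.
Qed.

Lemma euler_sqform : euler sqform = 2 *: sqform.
Proof.
rewrite /euler /sqform scaler_sumr; apply: eq_bigr => i _.
by rewrite mderiv_sqform mulrnAr scaler_nat.
Qed.

Lemma laplaceD p q : laplace (p + q) = laplace p + laplace q.
Proof.
rewrite /laplace -big_split /=; apply: eq_bigr => i _; by rewrite !mderivD.
Qed.

Lemma laplaceZ c p : laplace (c *: p) = c *: laplace p.
Proof.
rewrite /laplace scaler_sumr; apply: eq_bigr => i _; by rewrite !mderivZ.
Qed.

Lemma laplace1 : laplace 1 = 0.
Proof.
by rewrite /laplace big1 // => i _; rewrite -mpolyC1 mderivC mderiv0.
Qed.

Lemma laplace_linformM x p :
  laplace (linform x * p) = 2 *: dirder x p + linform x * laplace p.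
Proof.
rewrite /laplace /dirder mulr_sumr scaler_sumr -big_split /=.
apply: eq_bigr => i _.
rewrite mderivM mderiv_linform mderivD !mderivM mderiv_linform mderivZ.
rewrite -mpolyC1 mderivC scaler0 mul0r add0r mpolyC1 -!scalerAl !mul1r addrA.
by congr (_ + _); rewrite -mulr2n scaler_nat.
Qed.

Lemma laplace_sqformM p : laplace (sqform * p) =
  (2 * n%:R) *: p + 4 *: euler p + sqform * laplace p.
Proof.
rewrite /laplace /euler mulr_sumr scaler_sumr.
have -> : (2 * n%:R) *: p = \sum_(i < n) (2 *: p).
  by rewrite sumr_const card_ord mulrC -scalerA scaler_nat.
rewrite -!big_split /=; apply: eq_bigr => i _.
rewrite mderivM mderiv_sqform mderivD !mderivM mderiv_sqform mderivMn.
rewrite mderiv_var eqxx mulr1n !scaler_nat; ring.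
Qed.

End Fischer.

(** * Zonal harmonics as homogenised Gegenbauer polynomials *)

Section Zonal.
Variables (n : nat) (R : realType) (lam : R).
Local Notation P := (mpoly n R).
Hypothesis lam_gt0 : 0 < lam.
Implicit Types (x y : 'I_n -> R) (l : nat).

(* Homogenised Gegenbauer polynomials
   |X|^l C_l^lam (y . X / |X|), as pairs of consecutive terms. *)
Fixpoint zonalpair (y : 'I_n -> R) (l : nat) : P * P :=
  match l with
  | 0 => (1, (2 * lam) *: linform y)
  | l'.+1 => let p := zonalpair y l' in
    (p.2, (l'.+2%:R)^-1 *: ((2 * (l'.+2%:R + lam - 1)) *: (linform y * p.2)
      - (l'.+2%:R + 2 * lam - 2) *: (sqform n R * p.1)))
  end.
Definition zonal y l := (zonalpair y l).1.

Lemma zonal0 y : zonal y 0 = 1. Proof. by []. Qed.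
Lemma zonal1 y : zonal y 1 = (2 * lam) *: linform y. Proof. by []. Qed.
Lemma zonalSS y l : zonal y l.+2 = 
  (l.+2%:R)^-1 *: ((2 * (l.+2%:R + lam - 1)) *: (linform y * zonal y l.+1)
      - (l.+2%:R + 2 * lam - 2) *: (sqform n R * zonal y l)).
Proof. by []. Qed.

Lemma nat2ind (Q : nat -> Prop) :
  Q 0 -> Q 1 -> (forall l, Q l -> Q l.+1 -> Q l.+2) -> forall l, Q l.
Proof.
move=> Q0 Q1 QS l; suff [] : Q l /\ Q l.+1 by [].
by elim: l => [//|l [? ?]]; split => //; apply: QS.
Qed.

Lemma euler_zonal y l : euler (zonal y l) = l%:R *: zonal y l.
Proof.
elim/nat2ind: l => [|| l IH0 IH1].
- by rewrite zonal0 euler1 scale0r.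
- by rewrite zonal1 eulerZ euler_linform scale1r.
- rewrite zonalSS eulerZ eulerD -scaleNr !eulerZ !eulerM IH0 IH1.
  rewrite euler_linform euler_sqform.
  by rewrite -!mul_mpolyC; ring.
Qed.

Lemma nS_neq0 k : k.+1%:R != 0 :> R.
Proof. by rewrite pnatr_eq0. Qed.

Lemma zonal_rec y l : l.+2%:R *: zonal y l.+2 =
  (2 * (l.+2%:R + lam - 1)) *: (linform y * zonal y l.+1)
   - (l.+2%:R + 2 * lam - 2) *: (sqform n R * zonal y l).
Proof. by rewrite zonalSS scalerA mulfV ?nS_neq0 // scale1r. Qed.

(** Supplies the cross term 2 d_y in the Laplacian of [linform y * zonal y l.+1]. *)
Lemma dirder_zonal y l : vdot y y = 1 ->
  dirder y (zonal y l.+1) = (l%:R + 2 * lam) *: zonal y l.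
Proof.
move=> y1; elim/nat2ind: l => [|| l IH0 IH1].
- by rewrite zonal1 dirderZ dirder_linform y1 scale1r zonal0 add0r.
- apply: (scalerI (nS_neq0 1)); rewrite -dirderZ zonal_rec zonal1 zonal0.
  rewrite dirderD -scaleNr !dirderZ !dirderM.
  rewrite dirder1 dirderZ dirder_linform dirder_sqform y1 scale1r.
  by rewrite -!mul_mpolyC; ring.
- apply: (scalerI (nS_neq0 l.+2)); rewrite -dirderZ zonal_rec.
  rewrite dirderD -scaleNr !dirderZ !dirderM IH0 IH1.
  rewrite dirder_linform dirder_sqform y1 scale1r.
  apply/eqP; rewrite -subr_eq0; have := zonal_rec y l.
  set a := (X in X = _); set b := (X in _ = X) => ab.
  set X := (X in X == 0).
  (* After both induction hypotheses the defect is a multiple of the recurrence at [l]. *)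
  suff -> : X = - (l%:R + 2 * lam + 1) *: (a - b) by rewrite ab subrr scaler0.
  rewrite /X /a /b -!mul_mpolyC; ring.
Qed.

(** In the recurrence the first product contributes 4 (l + 1 + lam)(l + 2 lam) times [zonal y l],
    the second (l + 2 lam)(2 n + 4 l) times it; they cancel exactly when n = 2 lam + 2. *)
Lemma laplace_zonal y l : vdot y y = 1 -> n%:R = 2 * lam + 2 ->
  laplace (zonal y l) = 0.
Proof.
move=> y1 nE; elim/nat2ind: l => [|| l IH0 IH1].
- by rewrite zonal0 laplace1.
- rewrite zonal1 -[linform y]mulr1 laplaceZ laplace_linformM dirder1 laplace1.
  by rewrite mulr0 scaler0 addr0 scaler0.
- apply: (scalerI (nS_neq0 l.+1)); rewrite -laplaceZ zonal_rec scaler0.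
  rewrite laplaceD -scaleNr !laplaceZ laplace_linformM laplace_sqformM IH0 IH1.
  rewrite dirder_zonal // euler_zonal nE -!mul_mpolyC; ring.
Qed.

Lemma gegenbauer_rec (x : R) l : l.+2%:R * gegenbauer lam l.+2 x =
  2 * x * (l.+2%:R + lam - 1) * gegenbauer lam l.+1 x
  - (l.+2%:R + 2 * lam - 2) * gegenbauer lam l x.
Proof. by rewrite /gegenbauer /= mulrC divfK ?nS_neq0. Qed.

Lemma dirder_linformX y x l :
  dirder y (linform x ^+ l) = (l%:R * vdot y x) *: linform x ^+ l.-1.
Proof.
elim: l => [|l IH]; first by rewrite expr0 dirder1 mul0r scale0r.
rewrite exprS dirderM IH dirder_linform /=.
case: l {IH} => [|l]; first by rewrite !mul0r scale0r mulr0 !addr0 mul1r mulr1.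
by rewrite /= exprS -!mul_mpolyC; ring.
Qed.

Lemma vdotC (x y : 'I_n -> R) : vdot x y = vdot y x.
Proof. by apply: eq_bigr => i _; rewrite mulrC. Qed.

Lemma laplace_linformX x l : vdot x x = 1 ->
  laplace (linform x ^+ l) = (l%:R * (l%:R - 1)) *: linform x ^+ l.-2.
Proof.
move=> x1; elim: l => [|l IH]; first by rewrite expr0 laplace1 mul0r scale0r.
rewrite exprS laplace_linformM IH dirder_linformX x1.
case: l {IH} => [|[|l]] /=.
- by rewrite !(mul0r, scale0r, mulr0, subrr, scaler0, add0r).
- by rewrite !expr0 subrr mulr0 scale0r -!mul_mpolyC; ring.
- by rewrite /= exprS -!mul_mpolyC; ring.
Qed.

(** Pairing a form of degree l with (y . X)^l evaluates it at y, up to l!. Here the adjoints of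
    [linform] and [sqform] lower the power of y . X, and the result obeys the Gegenbauer
    recurrence. *)
Lemma fischer_linform_zonal y x l : vdot y y = 1 ->
  fischer (linform y ^+ l) (zonal x l) = l`!%:R * gegenbauer lam l (vdot x y).
Proof.
move=> y1; elim/nat2ind: l => [|| l IH0 IH1].
- rewrite zonal0 expr0 /gegenbauer /= mulr1 fact0.
  by rewrite -mpolyX0 fischerXl mcoeffX eqxx mul1r /mfact big1 // => i _; rewrite mnm0E.
- rewrite zonal1 expr1 fischerZr -[linform y]mulr1 fischer_linform.
  rewrite dirder_linform fischerZr /gegenbauer /= mul1r vdotC.
  rewrite -mpolyX0 fischerXl mcoeffX eqxx mul1r /mfact big1; first by rewrite mulr1.
  by move=> i _; rewrite mnm0E.
- apply: (mulfI (nS_neq0 l.+1)); rewrite -fischerZr zonal_rec mulrCA gegenbauer_rec.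
  rewrite fischerDr -scaleNr !fischerZr.
  rewrite (fischerC _ (linform _ * _)) (fischerC _ (sqform _ _ * _)).
  rewrite fischer_linform fischer_sqform.
  rewrite dirder_linformX laplace_linformX //= !fischerZr.
  rewrite (fischerC (zonal x l)) (fischerC (zonal x l.+1)).
  rewrite IH1 IH0 !factS !natrM; ring.
Qed.

(** Leading coefficient of the Gegenbauer polynomial of degree l. *)
Fixpoint zlead l : R :=
  if l is l'.+1 then 2 * (l'%:R + lam) / l'.+1%:R * zlead l' else 1.

Lemma zlead_gt0 l : 0 < zlead l.
Proof.
elim: l => [|l IH] //=; rewrite !mulr_gt0 ?invr_gt0 ?ltr0Sn //.
by rewrite ltr_wpDl.
Qed.

(** Multiples of [sqform] are Fischer-orthogonal to harmonic polynomials, so against another zonal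
    harmonic only the power of y . X survives. *)
Lemma zonal_decomp y l :
  exists q, zonal y l = zlead l *: linform y ^+ l + sqform n R * q.
Proof.
elim/nat2ind: l => [|| l [q0 IH0] [q1 IH1]].
- by exists 0; rewrite zonal0 expr0 scale1r mulr0 addr0.
- by exists 0; rewrite zonal1 /= expr1 mulr0 addr0 add0r mulr1 divr1.
- exists ((l.+2%:R)^-1 *: ((2 * (l.+2%:R + lam - 1)) *: (linform y * q1)
    - (l.+2%:R + 2 * lam - 2) *: zonal y l)).
  rewrite zonalSS {1}IH1 [zlead l.+2]/= -/(zlead l.+1).
  set z := zlead l.+1; rewrite !exprS -!mul_mpolyC. 
 ring.
Qed.

(* The zonal harmonics are, up to a positive factor, reproducing for the
   Fischer product on harmonic polynomials, which exhibits the Gegenbauer kernel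
   as a Gram matrix. *)
Lemma fischer_zonal y x l : vdot y y = 1 -> vdot x x = 1 -> n%:R = 2 * lam + 2 ->
  fischer (zonal y l) (zonal x l) =
    zlead l * l`!%:R * gegenbauer lam l (vdot y x).
Proof.
move=> y1 x1 nE; have [q ->] := zonal_decomp y l.
rewrite fischerDl fischer_sqform laplace_zonal // fischer0r addr0.
by rewrite fischerZl fischer_linform_zonal // mulrA vdotC.
Qed.

Lemma gegenbauer_psd l (s : seq (R * ('I_n -> R))) : n%:R = 2 * lam + 2 ->
  (forall p, p \in s -> vdot p.2 p.2 = 1) ->
  0 <= \sum_(p <- s) \sum_(q <- s) p.1 * q.1 * gegenbauer lam l (vdot p.2 q.2).
Proof.
move=> nE s1.
have := fischer_ge0 (\sum_(p <- s) p.1 *: zonal p.2 l).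
have c0 : 0 < zlead l * l`!%:R by rewrite mulr_gt0 ?zlead_gt0 // ltr0n fact_gt0.
suff -> : fischer (\sum_(p <- s) p.1 *: zonal p.2 l)
    (\sum_(p <- s) p.1 *: zonal p.2 l) = (zlead l * l`!%:R) *
    (\sum_(p <- s) \sum_(q <- s) p.1 * q.1 * gegenbauer lam l (vdot p.2 q.2)).
  by rewrite pmulr_rge0.
rewrite fischer_suml mulr_sumr; apply: eq_big_seq => p ps.
rewrite fischer_sumr mulr_sumr; apply: eq_big_seq => q qs.
by rewrite fischerZl fischerZr fischer_zonal ?s1 //; ring.
Qed.

End Zonal.

(** * Gegenbauer polynomials and their moment functional *)

Section GegenbauerPoly.
Variables (R : realType) (lam : R).
Hypothesis lam_gt0 : 0 < lam.
Implicit Types (p q : {poly R}) (l k m : nat).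

(** Formal polynomials, so that derivation and abstract linear functionals can be applied. *)
Fixpoint gegppair l : {poly R} * {poly R} :=
  match l with
  | 0 => (1, (2 * lam) *: 'X)
  | l'.+1 => let p := gegppair l' in
    (p.2, (l'.+2%:R)^-1 *: ((2 * (l'.+2%:R + lam - 1)) *: ('X * p.2)
      - (l'.+2%:R + 2 * lam - 2) *: p.1))
  end.
Definition gegp l := (gegppair l).1.

Lemma gegp0 : gegp 0 = 1. Proof. by []. Qed.
Lemma gegp1 : gegp 1 = (2 * lam) *: 'X. Proof. by []. Qed.
Lemma gegpSS l : gegp l.+2 =
  (l.+2%:R)^-1 *: ((2 * (l.+2%:R + lam - 1)) *: ('X * gegp l.+1)
      - (l.+2%:R + 2 * lam - 2) *: gegp l).
Proof. by []. Qed.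

Lemma gegp_rec l : l.+2%:R *: gegp l.+2 =
  (2 * (l.+2%:R + lam - 1)) *: ('X * gegp l.+1)
   - (l.+2%:R + 2 * lam - 2) *: gegp l.
Proof. by rewrite gegpSS scalerA mulfV ?nS_neq0 // scale1r. Qed.

Lemma horner_gegp l x : (gegp l).[x] = gegenbauer lam l x.
Proof.
elim/nat2ind: l => [|| l IH0 IH1].
- by rewrite gegp0 hornerC.
- by rewrite gegp1 !hornerE.
- apply: (mulfI (nS_neq0 R l.+1)); rewrite -hornerZ gegp_rec gegenbauer_rec.
  rewrite !hornerE /= IH0 IH1.
  ring.
Qed.

Lemma gegenbauer1_rec l : l.+1%:R * gegenbauer lam l.+1 1 =
  (l%:R + 2 * lam) * gegenbauer lam l 1.
Proof.
elim: l => [|l IH]; first by rewrite /gegenbauer /=; ring.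
rewrite gegenbauer_rec; apply/eqP; rewrite -subr_eq0.
set X := (X in X == 0).
have -> : X = l.+1%:R * gegenbauer lam l.+1 1
   - (l%:R + 2 * lam) * gegenbauer lam l 1 by rewrite /X; ring.
by rewrite IH subrr.
Qed.

Lemma gegenbauer1_gt0 l : 0 < gegenbauer lam l 1.
Proof.
elim: l => [|l IH]; first by rewrite /gegenbauer /=.
rewrite -(pmulr_rgt0 _ (ltr0Sn R l)) gegenbauer1_rec mulr_gt0 //.
by rewrite ltr_wpDl // mulr_gt0.
Qed.

(** The identities support each other: the second at l + 1 is the differentiated recurrence
    corrected by the first at l; the first at l + 1 then follows with (X^2 - 1) C', obtained at l by
    eliminating the derivative of [gegp l]. *)
Lemma gegp_deriv_rec l :
  ('X * (gegp l.+1)^`() - (gegp l)^`() = l.+1%:R *: gegp l.+1) /\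
  ((gegp l.+1)^`() - 'X * (gegp l)^`() = (l%:R + 2 * lam) *: gegp l).
Proof.
elim: l => [|l [IHa IHb]].
  rewrite gegp1 gegp0 !(derivZ, derivX, derivC) mulr0 !subr0 -!mul_polyC.
  by split; ring.
have bS : (gegp l.+2)^`() - 'X * (gegp l.+1)^`() = (l.+1%:R + 2 * lam) *: gegp l.+1.
  apply: (scalerI (nS_neq0 R l.+1)); rewrite scalerBr -derivZ gegp_rec.
  rewrite derivB !derivZ derivM derivX.
  apply/eqP; rewrite -subr_eq0; move: IHa.
  set a := (X in X = _); set b := (X in _ = X) => ab.
  set X := (X in X == 0).
  suff -> : X = (l.+2%:R + 2 * lam - 2) *: (a - b) by rewrite ab subrr scaler0.
  rewrite /X /a /b -!mul_polyC; ring.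
split=> //.
have c : ('X ^+ 2 - 1) * (gegp l.+1)^`() =
    l.+1%:R *: ('X * gegp l.+1) - (l%:R + 2 * lam) *: gegp l.
  apply/eqP; rewrite -subr_eq0; set X := (X in X == 0).
  have {1}-> : X = 'X * ('X * (gegp l.+1)^`() - (gegp l)^`()
       - l.+1%:R *: gegp l.+1) - ((gegp l.+1)^`() - 'X * (gegp l)^`()
        - (l%:R + 2 * lam) *: gegp l) by rewrite /X -!mul_polyC; ring.
  by rewrite IHa IHb !subrr mulr0 subr0.
apply/eqP; rewrite -subr_eq0; set X := (X in X == 0).
rewrite gegp_rec in @X *.
have -> : X = 'X * ((gegp l.+2)^`() - 'X * (gegp l.+1)^`() -
   (l.+1%:R + 2 * lam) *: gegp l.+1) + 
    (('X ^+ 2 - 1) * (gegp l.+1)^`() - 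
    (l.+1%:R *: ('X * gegp l.+1) - (l%:R + 2 * lam) *: gegp l)).
  rewrite /X -!mul_polyC; ring.
by rewrite bS c !subrr mulr0 addr0.
Qed.

Lemma gegp_deriv l : ('X ^+ 2 - 1) * (gegp l.+1)^`() =
    l.+1%:R *: ('X * gegp l.+1) - (l%:R + 2 * lam) *: gegp l.
Proof.
have [IHa IHb] := gegp_deriv_rec l.
apply/eqP; rewrite -subr_eq0; set X := (X in X == 0).
have {1}-> : X = 'X * ('X * (gegp l.+1)^`() - (gegp l)^`()
     - l.+1%:R *: gegp l.+1) - ((gegp l.+1)^`() - 'X * (gegp l)^`()
      - (l%:R + 2 * lam) *: gegp l) by rewrite /X -!mul_polyC; ring.
by rewrite IHa IHb !subrr mulr0 subr0.
Qed.

(** Differentiate [gegp_deriv] and eliminate the derivative of the lower polynomial by the first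
    identity of [gegp_deriv_rec]. *)
Lemma gegp_ode l : (1 - 'X ^+ 2) * (gegp l)^`()^`()
    - (2 * lam + 1) *: ('X * (gegp l)^`()) =
  - (l%:R * (l%:R + 2 * lam)) *: gegp l.
Proof.
case: l => [|l].
  by rewrite gegp0 derivC deriv0 !mulr0 scaler0 subr0 mul0r oppr0 scale0r.
have [IHa _] := gegp_deriv_rec l.
have := congr1 (@deriv R) (gegp_deriv l).
rewrite !(derivM, derivB, derivZ, derivX, derivXn, derivC) => h.
apply/eqP; rewrite -subr_eq0; set X := (X in X == 0).
move: h; set a := (X in X = _); set b := (X in _ = X) => ab.
have -> : X = - (l%:R + 2 * lam) *: ('X * (gegp l.+1)^`() - (gegp l)^`()
     - l.+1%:R *: gegp l.+1) - (a - b).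
  rewrite /X /a /b /= -!mul_polyC; ring.
by rewrite ab IHa !subrr scaler0 subr0.
Qed.

Lemma size_gegp l : size (gegp l) = l.+1.
Proof.
elim/nat2ind: l => [|| l IH0 IH1].
- by rewrite gegp0 size_poly1.
- by rewrite gegp1 size_scale ?size_polyX // mulf_neq0 ?pnatr_eq0 // gt_eqF.
- have c0 : 2 * (l.+2%:R + lam - 1) != 0 :> R.
    rewrite mulf_neq0 ?pnatr_eq0 // gt_eqF // -natr1 addrAC addrK.
    by rewrite ltr_wpDl.
  rewrite gegpSS size_scale ?invr_eq0 ?nS_neq0 //.
  have s1 : size ((2 * (l.+2%:R + lam - 1)) *: ('X * gegp l.+1)) = l.+3.
    rewrite size_scale // mulrC size_mulX ?IH1 //.
    by rewrite -size_poly_gt0 IH1.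
  rewrite size_polyDl ?s1 // size_polyN (leq_ltn_trans (size_scale_leq _ _)) //.
  by rewrite IH0 ltnS.
Qed.

End GegenbauerPoly.

(** * Linear functionals determined by a two-term moment recurrence *)

Section Moments.
Variables (R : realType) (dd : R).
Implicit Types (p q : {poly R}).

(* The functionals p |-> <p> of the weight (1 - t^2)^((dd - 2)/2) on [-1, 1],
   and p |-> average over the sphere of p (y . x), are both of this kind. *)
Record moment_functional (J : {poly R} -> R) : Prop := MomentFunctional {
  moment_linear : forall a p q, J (a *: p + q) = a * J p + J q;
  moment1 : J 1 = 1;
  moment_rec : forall m : nat,
    (m%:R + dd) * J ('X^(m.+1)) = m%:R * J ('X^(m.-1)) }.

Section OneFunctional.
Variable J : {poly R} -> R.
Hypothesis HJ : moment_functional J.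

Lemma momentD p q : J (p + q) = J p + J q.
Proof. by have := moment_linear HJ 1 p q; rewrite scale1r mul1r. Qed.

Lemma moment0 : J 0 = 0.
Proof. by have := momentD 0 0; rewrite addr0 => /eqP; rewrite eq_sym -subr_eq0 addrK => /eqP. Qed.

Lemma momentZ a p : J (a *: p) = a * J p.
Proof. by have := moment_linear HJ a p 0; rewrite moment0 !addr0. Qed.

Lemma momentN p : J (- p) = - J p.
Proof. by rewrite -scaleN1r momentZ mulN1r. Qed.

Lemma moment_sum I (r : seq I) (F : I -> {poly R}) :
  J (\sum_(i <- r) F i) = \sum_(i <- r) J (F i).
Proof.
elim: r => [|a r IH]; first by rewrite !big_nil moment0.
by rewrite !big_cons momentD IH.
Qed.

(** For the weight (1 - t^2)^((dd - 2)/2) this says that the derivative of (1 - t^2)^(dd/2) p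
    integrates to zero; abstractly it is [moment_rec] extended by linearity. *)
Lemma moment_ibp p : J ((1 - 'X ^+ 2) * p^`() - dd *: ('X * p)) = 0.
Proof.
pose F p := (1 - 'X ^+ 2) * p^`() - dd *: ('X * p).
rewrite -/(F p) -[p]coefK poly_def.
have -> : F (\sum_(i < size p) p`_i *: 'X^i) = \sum_(i < size p) p`_i *: F 'X^i.
  rewrite /F raddf_sum /= !mulr_sumr scaler_sumr -sumrB; apply: eq_bigr => i _.
  by rewrite derivZ -!mul_polyC; ring.
rewrite moment_sum big1 // => i _; rewrite momentZ.
have -> : F ('X ^+ i) = i%:R *: 'X ^+ (i.-1) - (i%:R + dd) *: 'X ^+ (i.+1).
  rewrite /F derivXn; case: (nat_of_ord i) => [|k] /=.
    by rewrite mulr0n mulr0 scale0r !add0r expr0 mulr1 expr1.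
  by rewrite -!mul_polyC !exprS; ring.
by rewrite momentD momentN !momentZ (moment_rec HJ) subrr mulr0.
Qed.

End OneFunctional.

(** The recurrence links degrees differing by two; its instance m = 0 reads dd * J(X) = 0 and starts
    the odd degrees. *)
Lemma moment_unique J1 J2 : 0 < dd -> moment_functional J1 ->
  moment_functional J2 -> J1 =1 J2.
Proof.
move=> d0 H1 H2 p; rewrite -[p]coefK poly_def !moment_sum //.
apply: eq_bigr => i _; rewrite !momentZ //; congr (_ * _).
elim/nat2ind: (nat_of_ord i) => [|| k IH0 IH1].
- by rewrite expr0 !moment1.
- have h J : moment_functional J -> J 'X^1 = 0.
    move=> HJ; have := moment_rec HJ 0; rewrite add0r mul0r => /eqP.
    by rewrite mulf_eq0 (gt_eqF d0) => /eqP.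
  by rewrite !h.
- have nz : k.+1%:R + dd != 0 by rewrite gt_eqF // ltr_wpDl.
  by apply: (mulfI nz); rewrite !moment_rec //= IH0.
Qed.

End Moments.

(** * Orthogonality and expansion of Gegenbauer polynomials *)

Section Orthogonality.
Variables (R : realType) (lam : R).
Hypothesis lam_gt0 : 0 < lam.
Local Notation C := (gegp lam).
Implicit Types (p q : {poly R}) (l k m : nat).
Variable J : {poly R} -> R.
Hypothesis HJ : moment_functional (2 * lam + 1) J.

Let L p : {poly R} := (1 - 'X ^+ 2) * p^`()^`() - (2 * lam + 1) *: ('X * p^`()).

(** The difference is [moment_ibp] applied to the Wronskian p' q - q' p. *)
Lemma moment_selfadjoint p q : J (q * L p) = J (p * L q).
Proof.
apply/eqP; rewrite -subr_eq0 -(momentN HJ) -(momentD HJ).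
rewrite -[X in _ == X](moment_ibp HJ (p^`() * q - q^`() * p)); apply/eqP; congr J.
by rewrite /L derivB !derivM -!mul_polyC; ring.
Qed.

(** Eigenvectors of the self-adjoint [L] with eigenvalues - l (l + 2 lam), distinct because lam is
    positive. *)
Lemma gegp_orth l k : l != k -> J (C l * C k) = 0.
Proof.
move=> lk; have := moment_selfadjoint (C l) (C k).
rewrite /L !gegp_ode // -!scalerAr !(momentZ HJ) [C k * C l]mulrC => /eqP.
rewrite -subr_eq0 -mulrBl mulf_eq0 => /orP[|/eqP //].
have -> : - (l%:R * (l%:R + 2 * lam)) - - (k%:R * (k%:R + 2 * lam)) =
  (k%:R - l%:R) * (k%:R + l%:R + 2 * lam) :> R by ring.
rewrite mulf_eq0 subr_eq0 eqr_nat eq_sym (negbTE lk) /= gt_eqF //.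
by rewrite ltr_wpDl ?addr_ge0 // mulr_gt0.
Qed.

(** A [moment_functional] carries no positivity, so signs are propagated: J(X C_l C_(l+1)) is a
    positive multiple of J(C_l^2) by the recurrence for C_(l+2) paired with C_l, and J(C_(l+1)^2) a
    positive multiple of J(X C_l C_(l+1)) by the recurrence for C_(l+1). *)
Lemma gegp_norm_gt0 l : 0 < J (C l * C l).
Proof.
elim: l => [|l IH]; first by rewrite gegp0 mulr1 (moment1 HJ).
have a : J ('X * C l * C l.+1) = (l%:R + 2 * lam) / (2 * (l.+1%:R + lam)) * J (C l * C l).
  have := congr1 (fun p => J (p * C l)) (gegp_rec lam l).
  rewrite -scalerAl (momentZ HJ) (@gegp_orth l.+2 l) ?mulr0; last by rewrite neq_ltn !leqnSn ?orbT.
  rewrite mulrBl -!scalerAl (momentD HJ) (momentN HJ) !(momentZ HJ).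
  rewrite [_ * C l.+1 * _]mulrAC => e.
  have nz : (2 * (l.+1%:R + lam)) != 0 by rewrite mulf_neq0 // gt_eqF // ltr_wpDl.
  apply: (mulfI nz); rewrite mulrA mulrCA mulfV // mulr1.
  apply/eqP; rewrite -subr_eq0; apply/eqP; rewrite [RHS]e.
  by ring.
suff [c [c0 ->]] : exists c, 0 < c /\ J (C l.+1 * C l.+1) = c * J ('X * C l * C l.+1).
  rewrite a !mulr_gt0 ?invr_gt0 // ?mulr_gt0 //; first by rewrite ltr_wpDl ?mulr_gt0.
  by rewrite ltr_wpDl.
case: l {IH a} => [|l].
  exists (2 * lam); rewrite mulr_gt0 //; split=> //.
  by rewrite {1}gegp1 -scalerAl (momentZ HJ) gegp0 mulr1.
exists ((2 * (l.+2%:R + lam - 1)) / l.+2%:R); split.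
  rewrite divr_gt0 ?mulr_gt0 // -[l.+2%:R]natr1 addrAC addrK ltr_wpDl //.
apply: (mulfI (nS_neq0 R l.+1)); rewrite -(momentZ HJ) scalerAl gegp_rec.
rewrite mulrBl -!scalerAl (momentD HJ) (momentN HJ) !(momentZ HJ).
rewrite (@gegp_orth l l.+2) ?mulr0 ?subr0; last by rewrite neq_ltn !leqnSn ?orbT.
by rewrite mulrA [l.+2%:R * _]mulrC divfK ?nS_neq0.
Qed.

Definition gnp l : {poly R} := (gegenbauer lam l 1)^-1 *: C l.

Lemma gnp1 l : (gnp l).[1] = 1.
Proof. by rewrite hornerZ horner_gegp mulVf // gt_eqF // gegenbauer1_gt0. Qed.

Lemma gnp0 : gnp 0 = 1.
Proof. by rewrite /gnp gegp0 /gegenbauer /= invr1 scale1r. Qed.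

Lemma size_gnp l : size (gnp l) = l.+1.
Proof. by rewrite size_scale ?size_gegp // invr_eq0 gt_eqF // gegenbauer1_gt0. Qed.

Lemma gnp_orth l k : l != k -> J (gnp l * gnp k) = 0.
Proof.
by move=> lk; rewrite -scalerAl -scalerAr !(momentZ HJ) gegp_orth ?mulr0.
Qed.

Lemma gnp_norm_gt0 l : 0 < J (gnp l ^+ 2).
Proof.
rewrite expr2 -scalerAl -scalerAr !(momentZ HJ) !mulr_gt0 ?gegp_norm_gt0 //.
all: by rewrite invr_gt0 gegenbauer1_gt0.
Qed.

Lemma moment_gnp l : J (gnp l) = (l == 0%N)%:R.
Proof.
case: l => [|l]; first by rewrite gnp0 (moment1 HJ).
by have := @gnp_orth l.+1 0 isT; rewrite gnp0 mulr1.
Qed.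

Lemma gnp_span N p : (size p <= N)%N ->
  exists a : nat -> R, p = \sum_(k < N) a k *: gnp k.
Proof.
elim: N p => [|N IH] p sp.
  by exists (fun=> 0); rewrite big_ord0; apply/eqP; rewrite -size_poly_eq0 -leqn0.
have lc : lead_coef (gnp N) != 0 by rewrite lead_coef_eq0 -size_poly_gt0 size_gnp.
have [|a ha] := IH (p - (p`_N / lead_coef (gnp N)) *: gnp N).
  apply/leq_sizeP => j; rewrite leq_eqVlt => /orP[/eqP <-|Nj].
    rewrite coefB coefZ; have -> : (gnp N)`_N = lead_coef (gnp N).
      by rewrite lead_coefE size_gnp.
    by rewrite divfK // subrr.
  rewrite coefB coefZ (nth_default _ (leq_trans sp Nj)).
  by rewrite [(gnp N)`_j]nth_default ?mulr0 ?subrr // size_gnp.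
exists (fun k => if k == N then p`_N / lead_coef (gnp N) else a k).
rewrite big_ord_recr /= eqxx; apply/eqP; rewrite -subr_eq ha; apply/eqP.
by apply: eq_bigr => k _; rewrite ltn_eqF.
Qed.

Lemma gnp_expansion N p : (size p <= N)%N ->
  p = \sum_(k < N) (J (p * gnp k) / J (gnp k ^+ 2)) *: gnp k.
Proof.
move=> sp; have [a ha] := gnp_span sp; rewrite {1}ha; apply: eq_bigr => k _.
congr (_ *: _); rewrite ha mulr_suml (moment_sum HJ) (bigD1 k) //= big1 => [|j jk].
  by rewrite addr0 -scalerAl (momentZ HJ) -expr2 mulfK // gt_eqF // gnp_norm_gt0.
by rewrite -scalerAl (momentZ HJ) gnp_orth ?mulr0.
Qed.

End Orthogonality.

(** * The ultraspherical weight on [-1, 1] *)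

Import numFieldNormedType.Exports.

Section Weight.
Variables (R : realType).
Local Notation mu := (@lebesgue_measure R).
Local Open Scope classical_set_scope.

Definition semicirc (t : R) : R := Num.sqrt (1 - t ^+ 2).

Lemma continuous_semicirc : continuous semicirc.
Proof.
move=> x; apply: (@continuous_comp _ _ _ (fun t : R => 1 - t ^+ 2) (@Num.sqrt R)).
  apply: continuousB; first exact: cst_continuous.
  exact: exprn_continuous.
exact: sqrt_continuous.
Qed.

(** Trades a real power for a natural power of a continuous function; integrability on the segment
    is then automatic. *)
Lemma w_unE d t : (2 <= d)%N -> `[-1, 1] t -> w_un d t = semicirc t ^+ (d - 2).
Proof.
move=> d2 /=; rewrite in_itv /= => /andP[t1 t2]; rewrite /w_un /semicirc.
have h : 0 <= 1 - t ^+ 2 by nra.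
have -> : (d%:R - 2) / 2 = 2^-1 * (d - 2)%:R :> R by rewrite natrB // mulrC.
by rewrite powRrM powR12_sqrt // powR_mulrn // sqrtr_ge0.
Qed.

Lemma continuous_poly_semicirc (p : {poly R}) k :
  continuous (fun t => p.[t] * semicirc t ^+ k).
Proof.
move=> x; apply: continuousM; first exact: continuous_horner.
exact: (continuous_comp (@continuous_semicirc x) (@exprn_continuous _ k _)).
Qed.

Lemma integrable_poly_semicirc (p : {poly R}) k :
  mu.-integrable `[-1, 1] (EFin \o (fun t => p.[t] * semicirc t ^+ k)).
Proof.
apply: continuous_compact_integrable; first exact: segment_compact.
exact/continuous_subspaceT/continuous_poly_semicirc.
Qed.

Lemma integral_semicirc_gt0 k : 0 < \int[mu]_(t in `[-1, 1]) (semicirc t ^+ k).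
Proof.
have ms : measurable_fun (`[(-1)%R, 1%R] : set R) (fun t : R => semicirc t ^+ k).
  apply: measurable_funTS; apply: continuous_measurable_fun => x.
  exact: (continuous_comp (@continuous_semicirc x) (@exprn_continuous _ k _)).
(* On [0, 1/2], of length 1/2, the function [semicirc] is at least 1/2. *)
have lb : (((2^-1) ^+ k * 2^-1)%:E <=
    \int[mu]_(t in `[(-1)%R, 1%R]) (semicirc t ^+ k)%:E)%E.
  apply: (@le_trans _ _ (\int[mu]_(t in `[0%R, 2^-1%R]) ((2^-1) ^+ k)%:E)%E).
    rewrite integral_cst //= lebesgue_measure_itv /= lte_fin invr_gt0 ltr0n /=.
    by rewrite sube0 -EFinM lee_fin.
  have sub : (`[0%R, 2^-1%R] : set R) `<=` (`[(-1)%R, 1%R] : set R).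
    by move=> x /=; rewrite !in_itv /= => /andP[? ?]; apply/andP; split; lra.
  apply: (@le_trans _ _ (\int[mu]_(t in `[0%R, 2^-1%R]) (semicirc t ^+ k)%:E)%E).
    apply: ge0_le_integral => //.
    - apply/measurable_EFinP; apply: (@measurable_funS _ _ _ _ (`[(-1)%R, 1%R] : set R)) => //.
    - move=> x /=; rewrite in_itv /= => /andP[x0 x1].
      rewrite lee_fin lerXn2r ?nnegrE ?sqrtr_ge0 ?invr_ge0 //.
      rewrite -(@ler_pXn2r _ 2) ?nnegrE ?sqrtr_ge0 ?invr_ge0 //.
      rewrite sqr_sqrtr; nra.
  apply: ge0_subset_integral => //; first exact/measurable_EFinP.
  by move=> x _; rewrite lee_fin exprn_ge0 // sqrtr_ge0.
have := integrable_fin_num _ (integrable_poly_semicirc 1 k).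
rewrite /Rintegral => /(_ (measurable_itv _)).
under eq_integral do rewrite /= hornerC mul1r.
move=> /fineK e; rewrite -lte_fin e (lt_le_trans _ lb) //.
by rewrite lte_fin mulr_gt0 ?exprn_gt0 // invr_gt0.
Qed.

Lemma is_derive_semicirc (x : R) : -1 < x < 1 ->
  is_derive x 1 semicirc (- x / semicirc x).
Proof.
move=> /andP[x1 x2].
have h : 0 < 1 - x ^+ 2 by nra.
have ds : is_derive (1 - x ^+ 2) 1 (@Num.sqrt R) (2 * semicirc x)^-1.
  exact: is_derive1_sqrt.
have dg : is_derive x 1 (fun t : R => 1 - t ^+ 2) (- (x *+ 2)).
  apply: is_derive_eq; rewrite add0r.
  by rewrite mul1r -mulr2n; congr (- (_ *+ 2)); exact: mulr1.
have s0 : semicirc x != 0 by rewrite gt_eqF // sqrtr_gt0.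
have -> : - x / semicirc x = (2 * semicirc x)^-1 * - (x *+ 2).
  by rewrite invfM -mulr_natl; field.
exact (@is_derive1_comp _ (@Num.sqrt R) (fun t : R => 1 - t ^+ 2) x _ _ ds dg).
Qed.

(** The integrand is the derivative of t^m (1 - t^2)^((k + 2)/2), which vanishes at both endpoints.
    The root is differentiated only on the open interval; continuity covers the ends. *)
Lemma integral_semicirc_rec k m :
  \int[mu]_(t in `[-1, 1])
    ((m%:R *: 'X^(m.-1) - (m + k + 2)%:R *: 'X^(m.+1) : {poly R}).[t] * semicirc t ^+ k) = 0.
Proof.
pose F (t : R) := ('X^m : {poly R}).[t] * semicirc t ^+ k.+2.
have cF : continuous F by exact: continuous_poly_semicirc.
have e0 (t : R) : t ^+ 2 = 1 -> F t = 0.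
  by move=> t1; rewrite /F /semicirc t1 subrr sqrtr0 expr0n mulr0.
have dF (x : R) : -1 < x < 1 -> is_derive x 1 F
  ((m%:R *: 'X^(m.-1) - (m + k + 2)%:R *: 'X^(m.+1) : {poly R}).[x] * semicirc x ^+ k).
  move=> xI; have ds := is_derive_semicirc xI.
  have -> : F = (horner ('X^m : {poly R})) * (semicirc ^+ k.+2).
    by apply/funext => t; rewrite /F /GRing.mul /= exprfctE.
  apply: is_derive_eq; rewrite /= !exprfctE.
  have s0 : semicirc x != 0.
    by case/andP: xI => ? ?; rewrite gt_eqF // sqrtr_gt0; nra.
  have s2 : semicirc x ^+ 2 = 1 - x ^+ 2.
    by case/andP: xI => ? ?; rewrite /semicirc sqr_sqrtr //; nra.
  have e1 : semicirc x ^+ k.+1 * (- x / semicirc x) = - x * semicirc x ^+ k.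
    by rewrite exprSr; field.
  have e2 : semicirc x ^+ k.+2 = semicirc x ^+ k * (1 - x ^+ 2).
    by rewrite -s2 -exprD addn2.
  rewrite derivXn hornerMn /GRing.scale /= -mulrA e1 e2.
  rewrite hornerD hornerN !hornerZ !hornerXn.
  rewrite -addnA addn2 natrD.
  case: m {F cF e0} => [|m] /=; rewrite ?exprS; ring.
have dLR : derivable_oo_LRcontinuous F (-1) 1.
  split.
  - by move=> x; rewrite in_itv /= => xI; have [] := dF x xI.
  - exact/cvg_at_right_filter/cF.
  - exact/cvg_at_left_filter/cF.
have dE : {in `](-1)%R, 1%R[%R, F^`()%classic =1
    fun t => (m%:R *: 'X^(m.-1) - (m + k + 2)%:R *: 'X^(m.+1) : {poly R}).[t]
       * semicirc t ^+ k}.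
  by move=> x; rewrite in_itv /= derive1E => xI; have [_ ->] := dF x xI.
have N11 : (-1 : R) < 1 by lra.
rewrite /Rintegral (continuous_FTC2 N11 _ dLR dE) /=.
  by rewrite !e0 ?sqrrN ?expr1n // subrr.
exact/continuous_subspaceT/continuous_poly_semicirc.
Qed.

Lemma wavgE d (p : {poly R}) : (2 <= d)%N -> wavg d (fun t => p.[t]) =
  (\int[mu]_(t in `[-1, 1]) (semicirc t ^+ (d - 2)))^-1 *
  \int[mu]_(t in `[-1, 1]) (p.[t] * semicirc t ^+ (d - 2)).
Proof.
move=> d2; rewrite /wavg /w0.
under eq_Rintegral => t tI.
  rewrite mulrCA w_unE //; last by rewrite inE in tI.
  over.
rewrite RintegralZl //; last exact: integrable_poly_semicirc.
congr (_ * _); rewrite /c0; congr (_^-1).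
by apply: eq_Rintegral => t tI; rewrite w_unE // -inE.
Qed.

Lemma integral_poly_linear k a (p q : {poly R}) :
  \int[mu]_(t in `[-1, 1]) ((a *: p + q).[t] * semicirc t ^+ k) =
  a * \int[mu]_(t in `[-1, 1]) (p.[t] * semicirc t ^+ k)
    + \int[mu]_(t in `[-1, 1]) (q.[t] * semicirc t ^+ k).
Proof.
rewrite -RintegralZl //; last exact: integrable_poly_semicirc.
have ia : mu.-integrable `[-1, 1]
    (EFin \o (fun t : R => a * (p.[t] * semicirc t ^+ k))).
  have := integrable_poly_semicirc (a *: p) k.
  suff -> : (fun t : R => (a *: p).[t] * semicirc t ^+ k) =
    (fun t : R => a * (p.[t] * semicirc t ^+ k)) by [].
  by apply/funext => t; rewrite hornerZ mulrA.
rewrite -(RintegralD _ ia (integrable_poly_semicirc q k)) //.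
by apply: eq_Rintegral => t _; rewrite hornerD hornerZ mulrDl mulrA.
Qed.

Lemma wavg_moment d : (2 <= d)%N ->
  moment_functional d%:R (fun p : {poly R} => wavg d (fun t => p.[t])).
Proof.
move=> d2; split.
- by move=> a p q; rewrite !wavgE // integral_poly_linear mulrDr mulrCA.
- rewrite wavgE //; under [X in _ * X]eq_Rintegral do rewrite hornerC mul1r.
  by rewrite mulVf // gt_eqF // integral_semicirc_gt0.
- move=> m; rewrite !wavgE // !(mulrCA _ _^-1); congr (_ * _).
  have := integral_semicirc_rec (d - 2) m; rewrite -addnA subnK // natrD => h.
  move: h; rewrite -scaleNr addrC integral_poly_linear.
  rewrite -[_ *: _]addr0 integral_poly_linear.
  rewrite [X in _ + (_ + X)](_ : _ = 0); last first.
    by under eq_Rintegral do rewrite horner0 mul0r; rewrite Rintegral_cst // mul0r.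
  by move=> /eqP; rewrite addr0 mulNr addrC subr_eq0 => /eqP ->.
Qed.

End Weight.

(** * Iterated Lebesgue integrals of bounded Borel functions supported in a box *)

Section IteratedIntegral.
Variable R : realType.
Local Notation mu := (@lebesgue_measure R).
Local Open Scope classical_set_scope.

Lemma bounded_integrable (H : R -> R) (C r : R) :
  measurable_fun setT H -> (forall x, `|H x| <= C * (`|x| <= r)%R%:R) ->
  mu.-integrable setT (EFin \o H).
Proof.
move=> mH bH.
have iI := @integrable_indic_itv R (- r) r true false.
apply: le_integrable (integrableZl measurableT C iI) => //.
- exact/measurable_EFinP.
- move=> x _; rewrite /= lee_fin (le_trans (bH x)) // (le_trans (ler_norm _)) //.
  by rewrite indicE mem_setE in_itv /= [(`|x| <= r)%R]ler_norml.
Qed.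

Lemma bounded_Rintegral (H : R -> R) (C r : R) : 0 <= r ->
  measurable_fun setT H -> (forall x, `|H x| <= C * (`|x| <= r)%R%:R) ->
  `|\int[mu]_x H x| <= C * (2 * r).
Proof.
move=> r0 mH bH; have iH := bounded_integrable mH bH.
apply: le_trans (le_normr_Rintegral _ iH) _ => //.
have iI := @integrable_indic_itv R (- r) r true false.
apply: (@le_trans _ _ (\int[mu]_x (C * \1_(`[- r, r]) x))).
  apply: le_Rintegral => //.
  - exact: integrable_abse iH.
  - exact: (integrableZl measurableT C iI).
  - by move=> x _; rewrite (le_trans (bH x)) // indicE ler_norml mem_setE in_itv.
rewrite RintegralZl //.
rewrite /Rintegral integral_indic // setIT.
rewrite [X in fine X](@lebesgue_measure_itv R `[- r, r]%R) /= lte_fin; case: ifPn => [|_] /=.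
  by rewrite opprK -mulr2n mulr_natl.
rewrite mulr0 mulr_ge0 // ?mulr_ge0 //.
by have := le_trans (normr_ge0 _) (bH 0); rewrite normr0 r0 mulr1.
Qed.

Lemma measurable_Rintegral d (T : measurableType d) (H : T * R -> R) :
  measurable_fun setT H -> measurable_fun setT (fun t => \int[mu]_x H (t, x)).
Proof.
move=> mH; rewrite /Rintegral; apply: measurableT_comp => //.
have mE : measurable_fun setT (EFin \o H) by exact/measurable_EFinP.
under eq_fun do rewrite integralE.
apply: emeasurable_funB.
- apply: (eq_measurable_fun (fubini_F mu (EFin \o H)^\+%E)).
    by move=> x _; apply: eq_integral => y _; rewrite /= !funeposE.
  apply: measurable_fun_fubini_tonelli_F; first exact: measurable_funepos.
  by move=> x; exact: funepos_ge0.
- apply: (eq_measurable_fun (fubini_F mu (EFin \o H)^\-%E)).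
    by move=> x _; apply: eq_integral => y _; rewrite /= !funenegE.
  apply: measurable_fun_fubini_tonelli_F; first exact: measurable_funeneg.
  by move=> x; exact: funeneg_ge0.
Qed.

Definition in_box (s : seq R) := all (fun x => `|x| <= 1) s.

(* [h t] is, jointly in [t] and in its first [n] coordinates, a bounded Borel
   function supported in the box.  Testing against all measurable maps into the
   arguments stands for measurability on a power of [R]. *)
Record box_family d (T : measurableType d) (n : nat) (C : R)
    (h : T -> seq R -> R) : Prop := BoxFamily {
  box_family_meas : forall d' (T' : measurableType d') (phi : T' -> T)
      (f : nat -> T' -> R), measurable_fun setT phi ->
    (forall i, measurable_fun setT (f i)) ->
    measurable_fun setT (fun t => h (phi t) (mkseq (f ^~ t) n));
  box_family_bound : forall t s, size s = n -> `|h t s| <= C * (in_box s)%:R }.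

Lemma box_family_comp d d' (T : measurableType d) (T' : measurableType d') n C
    (h : T -> seq R -> R) (phi : T' -> T) :
  measurable_fun setT phi -> box_family n C h -> box_family n C (h \o phi).
Proof.
move=> mphi [mh bh]; split; last by move=> t s; exact: bh.
by move=> d2 T2 psi f mpsi mf; apply: mh => //; exact: measurableT_comp.
Qed.

Lemma box_bound_ge0 d (T : measurableType d) n C (h : T -> seq R -> R) (t : T) :
  (forall t s, size s = n -> `|h t s| <= C * (in_box s)%:R) -> 0 <= C.
Proof.
move=> /(_ t (nseq n 0) (size_nseq _ _)); rewrite /in_box all_nseq normr0 ler01 orbT.
by rewrite mulr1; apply: le_trans.
Qed.

(** The first variable of integration joins the parameter; this is why parameters range over
    arbitrary measurable types. *)
Lemma box_family_cons d (T : measurableType d) n C (h : T -> seq R -> R) :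
  box_family n.+1 C h ->
  box_family n C (fun (p : T * R) s => h p.1 (p.2 :: s)).
Proof.
move=> [mh bh]; split.
- move=> d' T' phi f mphi mf.
  have [m1 m2] := (measurable_fun_pairP phi).1 mphi.
  have := mh d' T' (fst \o phi) (fun i => if i is j.+1 then f j else snd \o phi) m1.
  rewrite /mkseq /= => /(_ _) H.
  have {}H := H (fun i => match i with 0 => m2 | j.+1 => mf j end).
  apply: eq_measurable_fun H => t _ /=; congr (h _ (_ :: _)).
  by rewrite -[1%N]/(1 + 0)%N iotaDl -map_comp; apply: eq_map.
- move=> [t x] s sn /=; have := bh t (x :: s); rewrite /= sn => /(_ erefl) /le_trans; apply.
  rewrite ler_wpM2l ?(box_bound_ge0 t bh) // ler_nat.
  by case: (`|x| <= 1)%R.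
Qed.

Lemma itint_box_family n d (T : measurableType d) C (h : T -> seq R -> R) :
  box_family n C h -> 
  measurable_fun setT (fun t => itint n (h t)) /\
  forall t, `|itint n (h t)| <= C * 2 ^+ n.
Proof.
elim: n d T C h => [|n IH] d T C h hh /=.
  split.
    have := @box_family_meas _ _ _ _ _ hh _ _ id (fun=> cst 0) (@measurable_id _ _ setT).
    by move=> H; apply: H => i; exact: measurable_cst.
  by move=> t; rewrite (le_trans (box_family_bound hh t _)) //= expr0.
have [mc bc] := IH _ _ _ _ (box_family_cons hh).
have mI := measurable_Rintegral mc.
split=> // t.
(* The induction hypothesis is used again with [x] frozen and a bound that vanishes for |x| > 1, so
   the support in the first coordinate is not lost; integrating over [-1, 1] then costs a factor
   2. *)
have bx x : `|itint n (fun s => h t (x :: s))| <= C * 2 ^+ n * (`|x| <= 1)%R%:R.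
  have hx : box_family n (C * (`|x| <= 1)%R%:R)
      (fun (_ : T) (s : seq R) => h t (x :: s)).
    split.
      move=> d' T' phi f mphi mf.
      have := box_family_meas (box_family_cons hh) (phi := cst (t, x)) (f := f).
      by apply => //; exact: measurable_cst.
    move=> _ s sn; have := box_family_bound hh t (s := x :: s).
    rewrite /= sn => /(_ erefl) /le_trans; apply.
    by case: (`|x| <= 1)%R; rewrite ?mulr1 ?mulr0 ?mul0r.
  by have [_ /(_ t)] := IH _ _ _ _ hx; rewrite mulrAC.
have mx : measurable_fun setT (fun x => itint n (fun s => h t (x :: s))).
  have -> : (fun x => itint n (fun s => h t (x :: s))) =
     (fun p : T * R => itint n (fun s => h p.1 (p.2 :: s))) \o (pair t) by [].
  by apply: measurableT_comp => //; exact: measurable_pair1.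
have := bounded_Rintegral ler01 mx bx.
by rewrite mulr1 -mulrA -exprSr.
Qed.

End IteratedIntegral.

Section BoxFun.
Variable R : realType.
Local Notation mu := (@lebesgue_measure R).
Local Open Scope classical_set_scope.

Definition box_fun n (g : seq R -> R) := exists C, box_family n C (fun (_ : R) => g).

Lemma box_fun_cons n (g : seq R -> R) x :
  box_fun n.+1 g -> box_fun n (fun s => g (x :: s)).
Proof.
move=> [C /box_family_cons hg]; exists C.
have mp : measurable_fun setT (fun r : R => (r, x)) by exact: measurable_pair2.
exact: (box_family_comp mp hg).
Qed.

Lemma box_fun_integrable n (g : seq R -> R) : box_fun n.+1 g ->
  mu.-integrable setT (EFin \o (fun x => itint n (fun s => g (x :: s)))).
Proof.
move=> [C hg]; have [m _] := itint_box_family (box_family_cons hg).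
have mx : measurable_fun setT (fun x => itint n (fun s => g (x :: s))).
  have mp : measurable_fun setT (pair (0 : R) : R -> R * R) by exact: measurable_pair1.
  exact: (measurableT_comp m mp).
apply: (@bounded_integrable _ _ (C * 2 ^+ n) 1 mx) => x.
have hx : box_family n (C * (`|x| <= 1)%R%:R) (fun (_ : R) (s : seq R) => g (x :: s)).
  have [Hm Hb] := box_family_cons hg; split.
    move=> d' T' phi f mphi mf.
    by apply: (Hm _ _ (fun=> (0 : R, x)) f) => //; exact: measurable_cst.
  move=> _ s sn; have := box_family_bound hg 0 (s := x :: s).
  rewrite /= sn => /(_ erefl) /le_trans; apply.
  by case: (`|x| <= 1)%R; rewrite ?mulr1 ?mulr0 ?mul0r.
by have [_ /(_ 0)] := itint_box_family hx; rewrite mulrAC.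
Qed.

Lemma itint_ext n (g h : seq R -> R) :
  (forall s, size s = n -> g s = h s) -> itint n g = itint n h.
Proof.
elim: n g h => [|n IH] g h gh /=; first exact: gh.
by apply: eq_Rintegral => x _; apply: IH => s sn; apply: gh; rewrite /= sn.
Qed.

Lemma box_fun_ext n (g h : seq R -> R) :
  (forall s, size s = n -> g s = h s) -> box_fun n g -> box_fun n h.
Proof.
move=> gh [C [mg bg]]; exists C; split.
- move=> d' T' phi f mphi mf.
  apply: eq_measurable_fun (mg d' T' phi f mphi mf) => t _.
  by rewrite gh // size_mkseq.
- by move=> t s sn; rewrite -gh // (bg t s sn).
Qed.

Lemma box_fun_lin n (g h : seq R -> R) a :
  box_fun n g -> box_fun n h -> box_fun n (fun s => a * g s + h s).
Proof.
move=> [C [mg bg]] [D [mh bh]]; exists (`|a| * C + D); split.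
- move=> d' T' phi f mphi mf; apply: measurable_funD; last exact: (mh _ _ phi).
  by apply: measurable_funM; [exact: measurable_cst|exact: (mg _ _ phi)].
- move=> t s sn; apply: le_trans (ler_normD _ _) _; rewrite mulrDl.
  apply: lerD; last exact: (bh t s sn).
  by rewrite normrM -mulrA ler_wpM2l //; exact: (bg t s sn).
Qed.

Lemma itint_lin n (g h : seq R -> R) a : box_fun n g -> box_fun n h ->
  itint n (fun s => a * g s + h s) = a * itint n g + itint n h.
Proof.
elim: n g h => [//|n IH] g h bg bh /=.
have ig := box_fun_integrable bg; have ih := box_fun_integrable bh.
rewrite -RintegralZl // -RintegralD //; last exact: (integrableZl measurableT a ig).
by apply: eq_Rintegral => x _; rewrite IH //; exact: box_fun_cons.
Qed.

Lemma itint0 n : itint n (fun=> 0) = 0 :> R.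
Proof.
elim: n => [//|n IH] /=; under eq_Rintegral do rewrite IH.
by rewrite Rintegral_cst // mul0r.
Qed.

Lemma itint_le n (g h : seq R -> R) : box_fun n g -> box_fun n h ->
  (forall s, size s = n -> g s <= h s) -> itint n g <= itint n h.
Proof.
elim: n g h => [|n IH] g h bg bh gh /=; first exact: gh.
apply: le_Rintegral => //; try exact: box_fun_integrable.
move=> x _; apply: IH; try exact: box_fun_cons.
by move=> s sn; apply: gh; rewrite /= sn.
Qed.

End BoxFun.

(** * Rotation invariance *)

Section Rotation.
Variable R : realType.
Local Notation mu := (@lebesgue_measure R).
Local Open Scope classical_set_scope.
Local Open Scope ereal_scope.

Lemma measurable_addr (c : R) :
  measurable_fun setT ((fun x => x + c)%R : R -> measurableTypeR R).
Proof. by apply: measurable_funD => //; exact: measurable_cst. Qed.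

Lemma lebesgue_measure_translate (c : R) (A : set R) : measurable A ->
  pushforward mu ((fun x => x + c)%R : _ -> measurableTypeR R) A = mu A.
Proof.
move=> mA; apply/esym/lebesgue_measure_unique => //=; first exact: measurable_addr.
move=> _ _ [[a b]] _ <-; rewrite /pushforward.
have -> : (fun x : R => (x + c)%R) @^-1` `]a, b]%classic = `](a - c)%R, (b - c)%R]%classic.
  by apply/seteqP; split => x /=; rewrite !in_itv /= ltrBlDr lerBrDr.
rewrite !(@lebesgue_measure_itv R) /= !lte_fin ltrD2r.
by case: ifP => // _; rewrite -!EFinB; congr EFin; ring.
Qed.

Lemma integral_translate (f : R -> \bar R) (c : R) :
  measurable_fun setT f -> (forall x, 0 <= f x) ->
  \int[mu]_x f (x + c)%R = \int[mu]_x f x.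
Proof.
move=> mf f0.
transitivity (\int[pushforward mu ((fun x => x + c)%R : R -> measurableTypeR R)]_y f y).
  by rewrite ge0_integral_pushforward //; exact: measurable_addr.
apply: eq_measure_integral; first exact: measurable_addr.
by move=> mA A mA2 _; exact: lebesgue_measure_translate.
Qed.

Definition int2 (Q : R * R -> \bar R) := \int[mu]_u \int[mu]_v Q (u, v).

Lemma int2_shear_r (b : R) (Q : R * R -> \bar R) :
  measurable_fun setT Q -> (forall p, 0 <= Q p) ->
  int2 (fun p => Q (p.1, p.2 + b * p.1)%R) = int2 Q.
Proof.
move=> mQ Q0; apply: eq_integral => u _.
apply: (integral_translate (f := fun v => Q (u, v)) (b * u)%R) => //.
exact: measurableT_comp mQ (measurable_pair1 u).
Qed.

Lemma measurable_shear_l (a : R) :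
  measurable_fun setT (fun p : R * R => (p.1 + a * p.2, p.2)%R).
Proof.
apply: measurable_fun_pair => //; apply: measurable_funD => //.
by apply: measurable_funM => //; exact: measurable_cst.
Qed.

Lemma measurable_shear_r (b : R) :
  measurable_fun setT (fun p : R * R => (p.1, p.2 + b * p.1)%R).
Proof.
apply: measurable_fun_pair => //; apply: measurable_funD => //.
by apply: measurable_funM => //; exact: measurable_cst.
Qed.

Lemma int2_swap (Q : R * R -> \bar R) :
  measurable_fun setT Q -> (forall p, 0 <= Q p) ->
  int2 Q = int2 (fun p => Q (p.2, p.1)).
Proof. by move=> mQ Q0; exact: fubini_tonelli. Qed.

Lemma int2_shear_l (a : R) (Q : R * R -> \bar R) :
  measurable_fun setT Q -> (forall p, 0 <= Q p) ->
  int2 (fun p => Q (p.1 + a * p.2, p.2)%R) = int2 Q.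
Proof.
move=> mQ Q0.
have mQs := measurableT_comp mQ (measurable_shear_l a).
rewrite (int2_swap mQs (fun p => Q0 _)) [RHS](int2_swap mQ Q0).
have mQ' : measurable_fun setT (fun p : R * R => Q (p.2, p.1)).
  by apply: measurableT_comp mQ _; exact: measurable_fun_pair.
exact: (int2_shear_r a mQ' (fun p => Q0 _)).
Qed.

(* A rotation of angle [theta <> pi] is a product of three shears, with
   parameters [- tan (theta / 2)], [sin theta] and [- tan (theta / 2)]. *)
Lemma int2_rotate (c s : R) (Q : R * R -> \bar R) :
  (c ^+ 2 + s ^+ 2 = 1)%R -> c != (-1)%R ->
  measurable_fun setT Q -> (forall p, 0 <= Q p) ->
  int2 (fun p => Q (c * p.1 - s * p.2, s * p.1 + c * p.2)%R) = int2 Q.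
Proof.
move=> cs c1 mQ Q0; set a := (- (s / (1 + c)))%R.
have c0 : (1 + c != 0)%R by rewrite addrC -subr_eq0 opprK in c1 *.
have m1 : measurable_fun setT (Q \o (fun p : R * R => (p.1 + a * p.2, p.2)%R)).
  exact: measurableT_comp mQ (measurable_shear_l a).
have m2 := measurableT_comp m1 (measurable_shear_r s).
have Q1 p : 0 <= (Q \o (fun p : R * R => (p.1 + a * p.2, p.2)%R)) p by exact: Q0.
rewrite -[RHS](int2_shear_l a mQ Q0) -[RHS](int2_shear_r s m1 Q1).
rewrite -[RHS](int2_shear_l a m2); last by move=> p; exact: Q0.
have ca : (a * (1 + c) = - s)%R by rewrite /a mulNr divfK.
have sa : (s * a = c - 1)%R.
  apply: (mulfI c0); rewrite mulrCA [((1 + c) * a)%R]mulrC ca.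
  transitivity (c ^+ 2 - 1)%R; last by ring.
  by rewrite -cs; ring.
congr int2; apply/funext => -[u v] /=; congr (Q (_, _)).
  have -> : (u + a * v + a * (v + s * (u + a * v)) =
     u + s * a * u + a * (1 + (s * a + 1)) * v)%R by ring.
  by rewrite sa subrK ca; ring.
have -> : (v + s * (u + a * v) = v + s * u + s * a * v)%R by ring.
by rewrite sa; ring.
Qed.

Local Open Scope ring_scope.

Lemma int2_radial_rotate (c s al be : R) (W : R * R -> \bar R) :
  c ^+ 2 + s ^+ 2 = 1 -> c != -1 ->
  measurable_fun setT W -> (forall p, (0 <= W p)%E) ->
  int2 (fun p => W (p.1 ^+ 2 + p.2 ^+ 2, al * p.1 + be * p.2)) =
  int2 (fun p => W (p.1 ^+ 2 + p.2 ^+ 2,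
     (c * al + s * be) * p.1 + (c * be - s * al) * p.2)).
Proof.
move=> cs c1 mW W0.
have mF : measurable_fun setT
    (fun p : R * R => (p.1 ^+ 2 + p.2 ^+ 2, al * p.1 + be * p.2)).
  apply: measurable_fun_pair; apply: measurable_funD.
  - exact: measurable_funX.
  - exact: measurable_funX.
  - by apply: measurable_funM => //; exact: measurable_cst.
  - by apply: measurable_funM => //; exact: measurable_cst.
rewrite -(int2_rotate cs c1 (measurableT_comp mW mF)); last by move=> p; exact: W0.
congr int2; apply/funext => -[u v] /=; congr (W (_, _)); last by ring.
transitivity ((c ^+ 2 + s ^+ 2) * (u ^+ 2 + v ^+ 2)); first by ring.
by rewrite cs mul1r.
Qed.

Lemma int2_radial (al be : R) (W : R * R -> \bar R) :
  measurable_fun setT W -> (forall p, (0 <= W p)%E) ->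
  int2 (fun p => W (p.1 ^+ 2 + p.2 ^+ 2, al * p.1 + be * p.2)) =
  int2 (fun p => W (p.1 ^+ 2 + p.2 ^+ 2,
     Num.sqrt (al ^+ 2 + be ^+ 2) * p.1)).
Proof.
move=> mW W0; set r := Num.sqrt _.
have r2 : r ^+ 2 = al ^+ 2 + be ^+ 2 by rewrite sqr_sqrtr // addr_ge0 ?sqr_ge0.
have [r0|r0] := eqVneq r 0.
  move: r2; rewrite r0 expr0n /= => /esym/eqP.
  rewrite (paddr_eq0 (sqr_ge0 al) (sqr_ge0 be)) !sqrf_eq0 => /andP[/eqP -> /eqP ->].
  by congr int2; apply/funext => p; congr (W (_, _)); rewrite !mul0r addr0.
have N01 : (0 : R) != -1 by rewrite eq_sym oppr_eq0 oner_neq0.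
(* The half-turn is the one rotation without a three-shear factorization; it is made of two
   quarter-turns. *)
have [c1|c1] := eqVneq (al / r) (-1).
  have alr : al = - r by rewrite -[al](divfK r0) c1 mulN1r.
  have be0 : be = 0.
    by apply/eqP; rewrite -sqrf_eq0; move: r2; rewrite alr sqrrN -[LHS]addr0 => /addrI <-.
  have h : (0 : R) ^+ 2 + 1 ^+ 2 = 1 by rewrite expr0n expr1n add0r.
  rewrite (int2_radial_rotate _ _ h N01 mW W0) (int2_radial_rotate _ _ h N01 mW W0).
  rewrite alr be0; congr int2; apply/funext => p; congr (W (_, _)); ring.
have cs : (al / r) ^+ 2 + (be / r) ^+ 2 = 1.
  by rewrite !exprMn -mulrDl -r2 -exprMn divff // expr1n.
rewrite (int2_radial_rotate _ _ cs c1 mW W0); congr int2; apply/funext => p; congr (W (_, _)).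
have -> : al / r * be - be / r * al = 0 by rewrite mulrAC [be / r * al]mulrAC [be * al]mulrC subrr.
rewrite mul0r addr0; congr (_ * _); apply: (mulIf r0).
by rewrite mulrDl -!mulrA [r^-1 * (al * r)]mulrCA [r^-1 * (be * r)]mulrCA mulVf // !mulr1 -!expr2 r2.
Qed.

End Rotation.

(** * Integrands depending on the squared length and one linear form *)

Section RadialIntegrals.
Variable R : realType.
Local Notation mu := (@lebesgue_measure R).
Local Open Scope classical_set_scope.

Record radial_profile (C : R) (W : R * R -> R) : Prop := RadialProfile {
  profile_meas : measurable_fun setT W;
  profile_bound : forall p, `|W p| <= C;
  profile_supp : forall p, 1 < p.1 -> W p = 0 }.

Definition sqs n (s : seq R) := \sum_(i < n) s`_i ^+ 2.
Definition dots n (y : nat -> R) (s : seq R) := \sum_(i < n) y i * s`_i.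

Lemma sqs_ge0 n s : 0 <= sqs n s.
Proof. by apply: sumr_ge0 => i _; exact: sqr_ge0. Qed.

Lemma sqs_cons n x s : sqs n.+1 (x :: s) = x ^+ 2 + sqs n s.
Proof. by rewrite /sqs big_ord_recl. Qed.

Lemma dots_cons n y x s : dots n.+1 y (x :: s) = y 0%N * x + dots n (y \o S) s.
Proof. by rewrite /dots big_ord_recl. Qed.

Lemma sqs_in_box n s : size s = n -> sqs n s <= 1 -> in_box s.
Proof.
move=> sn h; apply/(all_nthP 0) => i; rewrite sn => i_n.
rewrite -(@ler_pXn2r _ 2) ?nnegrE // expr1n real_normK ?num_real //.
apply: le_trans h; rewrite /sqs (bigD1 (Ordinal i_n)) //= lerDl.
by apply: sumr_ge0 => j _; exact: sqr_ge0.
Qed.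

Lemma measurable_sqs d (T : measurableType d) n (f : nat -> T -> R) :
  (forall i, measurable_fun setT (f i)) ->
  measurable_fun setT (fun t => sqs n (mkseq (f ^~ t) n)).
Proof.
move=> mf; apply: measurable_sum => i; apply: measurable_funX.
by apply: eq_measurable_fun (mf i) => t _; rewrite nth_mkseq.
Qed.

Lemma measurable_dots d (T : measurableType d) n y (f : nat -> T -> R) :
  (forall i, measurable_fun setT (f i)) ->
  measurable_fun setT (fun t => dots n y (mkseq (f ^~ t) n)).
Proof.
move=> mf; apply: measurable_sum => i; apply: measurable_funM => //.
by apply: eq_measurable_fun (mf i) => t _; rewrite nth_mkseq.
Qed.

(** The maximum with 0 makes the support condition bound [sqs n s] for every real parameter; on
    squared lengths it changes nothing. *)
Lemma box_family_radial n y C W (r0 : R) : 0 <= r0 -> radial_profile C W ->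
  box_family n C (fun (p : R * R) s =>
    W (r0 + Num.max p.1 0 + sqs n s, p.2 + dots n y s)).
Proof.
move=> r00 [mW bW sW]; split.
- move=> d T phi f mphi mf; apply: (measurableT_comp mW).
  have [m1 m2] := (measurable_fun_pairP phi).1 mphi.
  apply: measurable_fun_pair; apply: measurable_funD.
  + apply: measurable_funD => //; apply: measurable_maxr => //.
  + exact: measurable_sqs.
  + exact: m2.
  + exact: measurable_dots.
- move=> p s sn; have [ib|ib] := boolP (in_box s); first by rewrite mulr1 bW.
  rewrite mulr0 sW ?normr0 //= ltNge; apply: contra ib => h.
  apply: (sqs_in_box sn); apply: le_trans h; rewrite lerDr addr_ge0 //.
  by rewrite le_max lexx orbT.
Qed.

Lemma box_fun_radial n y C W (r0 a0 : R) : 0 <= r0 -> radial_profile C W ->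
  box_fun n (fun s => W (r0 + sqs n s, a0 + dots n y s)).
Proof.
move=> r00 hW; exists C.
have mp : measurable_fun setT (fun _ : R => (0 : R, a0)) by exact: measurable_cst.
have := box_family_comp mp (box_family_radial n y r00 hW).
by rewrite /comp /= maxxx addr0.
Qed.

(** Integrating out the remaining coordinates leaves a profile in two variables, to which plane
    rotations apply. *)
Lemma radial_profile_itint n C W (r0 a0 : R) : 0 <= r0 -> radial_profile C W ->
  radial_profile (C * 2 ^+ n) (fun p =>
    itint n (fun s => W (r0 + Num.max p.1 0 + sqs n s, a0 + p.2))).
Proof.
move=> r00 hW.
have mp : measurable_fun setT (fun p : R * R => (p.1, a0 + p.2)).
  by apply: measurable_fun_pair => //; apply: measurable_funD.
have h := itint_box_family (box_family_comp mp (box_family_radial n (fun=> 0) r00 hW)).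
have e p : itint n (fun s => W (r0 + Num.max p.1 0 + sqs n s, a0 + p.2)) =
  itint n (((fun (p : R * R) s => W (r0 + Num.max p.1 0 + sqs n s, p.2 +
   dots n (fun=> 0) s)) \o (fun p : R * R => (p.1, a0 + p.2))) p).
  apply: itint_ext => s _ /=.
  by rewrite [dots _ _ _]big1 ?addr0 // => i _; rewrite mul0r.
split.
- by under eq_fun do rewrite e; case: h.
- by move=> p; rewrite e; case: h => _; exact.
- move=> p p1; rewrite -[RHS](itint0 R n); apply: itint_ext => s _.
  rewrite (profile_supp hW) //= (lt_le_trans p1) //.
  rewrite -addrA addrC -addrA -[X in X <= _]addr0 lerD ?le_max ?lexx // addr_ge0 //.
  exact: sqs_ge0.
Qed.

Lemma itintS n (g : seq R -> R) :
  itint n.+1 g = \int[mu]_x itint n (fun s => g (x :: s)).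
Proof. by []. Qed.

Let itint2_ge0 C W (al be : R) : radial_profile C W -> (forall p, 0 <= W p) ->
  (itint 2 (fun s => W (s`_0 ^+ 2 + s`_1 ^+ 2, al * s`_0 + be * s`_1)))%:E =
  int2 (fun p => (W (p.1 ^+ 2 + p.2 ^+ 2, al * p.1 + be * p.2))%:E).
Proof.
move=> hW W0.
pose y i : R := if i is 0 then al else be.
have e : (fun s => W (s`_0 ^+ 2 + s`_1 ^+ 2, al * s`_0 + be * s`_1)) =
  (fun s => W (0 + sqs 2 s, 0 + dots 2 y s)).
  apply/funext => s; rewrite /sqs /dots !big_ord_recr !big_ord0 /=.
  by rewrite !add0r.
have b2 : box_fun 2 (fun s => W (s`_0 ^+ 2 + s`_1 ^+ 2, al * s`_0 + be * s`_1)).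
  by rewrite e; exact: box_fun_radial hW.
have i1 := box_fun_integrable b2.
rewrite /= /Rintegral fineK; last exact: integrable_fin_num i1.
rewrite /int2; apply: eq_integral => u _.
have i2 := box_fun_integrable (box_fun_cons u b2).
by rewrite fineK //; exact: integrable_fin_num i2.
Qed.

Let itint2_radial_ge0 C W (al be : R) : radial_profile C W -> (forall p, 0 <= W p) ->
  itint 2 (fun s => W (s`_0 ^+ 2 + s`_1 ^+ 2, al * s`_0 + be * s`_1)) =
  itint 2 (fun s => W (s`_0 ^+ 2 + s`_1 ^+ 2,
     Num.sqrt (al ^+ 2 + be ^+ 2) * s`_0 + 0 * s`_1)).
Proof.
move=> hW W0; apply: EFin_inj; apply: (etrans (itint2_ge0 al be hW W0)).
apply: (etrans _ (esym (itint2_ge0 _ 0 hW W0))).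
have mW : measurable_fun setT (EFin \o W).
  by apply/measurable_EFinP; case: hW.
have W0' p : (0 <= (EFin \o W) p)%E by rewrite lee_fin.
rewrite (int2_radial al be mW W0').
by congr int2; apply/funext => p; rewrite mul0r addr0.
Qed.

(** Tonelli asks for a nonnegative profile: C times the indicator of the disc is added to [W], and
    its own invariant integral is cancelled by linearity. *)
Lemma itint2_radial C W (al be : R) : radial_profile C W ->
  itint 2 (fun s => W (s`_0 ^+ 2 + s`_1 ^+ 2, al * s`_0 + be * s`_1)) =
  itint 2 (fun s => W (s`_0 ^+ 2 + s`_1 ^+ 2,
     Num.sqrt (al ^+ 2 + be ^+ 2) * s`_0 + 0 * s`_1)).
Proof.
move=> hW; have [mW bW sW] := hW.
have C0 : 0 <= C := le_trans (normr_ge0 _) (bW (0, 0)).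
pose I (p : R * R) : R := (p.1 <= 1)%R%:R.
have hI : radial_profile 1 I.
  split.
  - rewrite /I; apply: (measurableT_comp (f := fun b : bool => (b%:R : R))) => //.
    by apply: measurable_fun_ler => //; exact: measurable_cst.
  - by move=> p; rewrite /I; case: (p.1 <= 1)%R; rewrite ?normr1 ?normr0.
  - by move=> p p1; rewrite /I leNgt p1.
have hWI : radial_profile (C + C) (fun p => C * I p + W p).
  split.
  - apply: measurable_funD => //; apply: measurable_funM; first exact: measurable_cst.
    exact: (profile_meas hI).
  - move=> p; rewrite (le_trans (ler_normD _ _)) // lerD // normrM ger0_norm //.
    by rewrite ler_piMr // (profile_bound hI).
  - by move=> p p1; rewrite (profile_supp hI) // sW // mulr0 addr0.
have WI0 p : 0 <= C * I p + W p.
  have := bW p; rewrite ler_norml => /andP[h _].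
  have [p1|p1] := leP p.1 1; last by rewrite (profile_supp hI) // sW // mulr0 addr0.
  by rewrite /I p1 mulr1 -lerBlDl sub0r.
have I0 p : 0 <= I p by rewrite /I ler0n.
have box V D : radial_profile D V -> forall a b, 
   box_fun 2 (fun s => V (s`_0 ^+ 2 + s`_1 ^+ 2, a * s`_0 + b * s`_1)).
  move=> hV a b; pose y i : R := if i is 0 then a else b.
  have e : (fun s => V (s`_0 ^+ 2 + s`_1 ^+ 2, a * s`_0 + b * s`_1)) =
    (fun s => V (0 + sqs 2 s, 0 + dots 2 y s)).
    apply/funext => s; rewrite /sqs /dots !big_ord_recr !big_ord0 /=.
    by rewrite !add0r.
  by rewrite e; exact: box_fun_radial hV.
have := itint2_radial_ge0 al be hWI WI0.
rewrite !(itint_lin C (box _ _ hI _ _) (box _ _ hW _ _)).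
by rewrite (itint2_radial_ge0 al be hI I0) => /addrI.
Qed.

Lemma itint_radial_fold n C W (r0 a0 al be : R) : 0 <= r0 -> radial_profile C W ->
  itint n.+2 (fun s => W (r0 + sqs n.+2 s, a0 + (al * s`_0 + be * s`_1))) =
  itint 2 (fun s => (fun p =>
    itint n (fun s => W (r0 + Num.max p.1 0 + sqs n s, a0 + p.2)))
      (s`_0 ^+ 2 + s`_1 ^+ 2, al * s`_0 + be * s`_1)).
Proof.
move=> r00 hW; rewrite /itint -!/(itint _ _); apply: eq_Rintegral => u _.
apply: eq_Rintegral => v _; apply: itint_ext => s _ /=.
by rewrite max_l ?addr_ge0 ?sqr_ge0 // !sqs_cons !addrA.
Qed.

(** [r0] and [a0] record the coordinates already fixed. Under the integral over the first
    coordinate, induction rotates the others so that the form uses one of them only; a rotation in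
    the plane of the first two coordinates finishes. *)
Lemma itint_radial n C W (r0 a0 : R) (y : nat -> R) :
  0 <= r0 -> radial_profile C W ->
  itint n.+2 (fun s => W (r0 + sqs n.+2 s, a0 + dots n.+2 y s)) =
  itint n.+2 (fun s => W (r0 + sqs n.+2 s,
    a0 + (Num.sqrt (\sum_(i < n.+2) y i ^+ 2) * s`_0 + 0 * s`_1))).
Proof.
elim: n r0 a0 y => [|n IH] r0 a0 y r00 hW.
  have := itint_radial_fold 0 a0 (y 0%N) (y 1%N) r00 hW.
  rewrite (itint2_radial _ _ (radial_profile_itint 0 a0 r00 hW)).
  rewrite -(itint_radial_fold _ _ _ _ r00 hW) big_ord_recl big_ord1 => <-.
  apply: itint_ext => s _; congr (W (_, _ + _)).
  by rewrite /dots big_ord_recl big_ord1.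
set r := Num.sqrt (\sum_(i < n.+2) y i.+1 ^+ 2).
have r2 : r ^+ 2 = \sum_(i < n.+2) y i.+1 ^+ 2.
  by rewrite sqr_sqrtr // sumr_ge0 // => i _; exact: sqr_ge0.
transitivity (itint n.+3 (fun s =>
   W (r0 + sqs n.+3 s, a0 + (y 0%N * s`_0 + r * s`_1)))).
  rewrite itintS [RHS]itintS; apply: eq_Rintegral => x _.
  have r0x : 0 <= r0 + x ^+ 2 by rewrite addr_ge0 // sqr_ge0.
  transitivity (itint n.+2 (fun s => W (r0 + x ^+ 2 + sqs n.+2 s,
      a0 + y 0%N * x + dots n.+2 (y \o S) s))).
    by apply: itint_ext => s _; rewrite sqs_cons dots_cons !addrA.
  rewrite (IH _ _ _ r0x hW); apply: itint_ext => s _.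
  by rewrite sqs_cons mul0r addr0 !addrA.
rewrite (itint_radial_fold _ _ _ _ r00 hW) (itint2_radial _ _ (radial_profile_itint _ _ r00 hW)).
rewrite -(itint_radial_fold _ _ _ _ r00 hW) r2; apply: itint_ext => s _.
by rewrite [in RHS]big_ord_recl.
Qed.

End RadialIntegrals.

(** * Integration over the sphere *)

Section SphereIntegral.
Variables (R : realType) (d : nat).
Local Notation mu := (@lebesgue_measure R).
Local Notation pt := (@pt R d).
Local Open Scope classical_set_scope.
Implicit Types (x y z : pt) (f g : pt -> R) (s : seq R).

Lemma rdotC x y : rdot x y = rdot y x.
Proof. by apply: eq_bigr => i _; rewrite mulrC. Qed.

Lemma rdotZl a x y : rdot (a *: x) y = a * rdot x y.
Proof. by rewrite /rdot mulr_sumr; apply: eq_bigr => i _; rewrite mxE mulrA. Qed.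

Lemma rdotZr a x y : rdot x (a *: y) = a * rdot x y.
Proof. by rewrite rdotC rdotZl rdotC. Qed.

Lemma rdotDl x y z : rdot (x + y) z = rdot x z + rdot y z.
Proof. by rewrite /rdot -big_split; apply: eq_bigr => i _; rewrite mxE mulrDl. Qed.

Lemma rdotDr x y z : rdot z (x + y) = rdot z x + rdot z y.
Proof. by rewrite !(rdotC z) rdotDl. Qed.

Lemma rdot_ge0 x : 0 <= rdot x x.
Proof. by apply: sumr_ge0 => i _; rewrite -expr2 sqr_ge0. Qed.

Lemma rdot_eq0 x : (rdot x x == 0) = (x == 0).
Proof.
apply/idP/eqP => [|->]; last first.
  by rewrite /rdot big1 // => i _; rewrite mxE mul0r.
rewrite psumr_eq0 => [/allP h|i _]; last by rewrite -expr2 sqr_ge0.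
apply/rowP => i; rewrite mxE; apply/eqP; rewrite -sqrf_eq0 expr2.
by have := h i (mem_index_enum i).
Qed.

Lemma rdot_sphere_le1 x y : sphereS x -> sphereS y -> `|rdot x y| <= 1.
Proof.
rewrite /sphereS /= => x1 y1; rewrite ler_norml.
have := rdot_ge0 (x + y); have := rdot_ge0 (x - y).
rewrite -scaleN1r !(rdotDl, rdotDr, rdotZl, rdotZr) x1 y1 (rdotC y x).
by move=> h1 h2; apply/andP; split; lra.
Qed.

Lemma normalize_sphere x : x != 0 ->
  sphereS ((Num.sqrt (rdot x x))^-1 *: x).
Proof.
move=> x0; rewrite /sphereS /= rdotZl rdotZr mulrA -expr2 exprVn.
by rewrite sqr_sqrtr ?rdot_ge0 // mulVf // rdot_eq0.
Qed.

Definition ei (i : 'I_d.+1) : pt := delta_mx ord0 i.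

Lemma rdot_ei i x : rdot (ei i) x = x ord0 i.
Proof.
rewrite /rdot (bigD1 i) //= mxE !eqxx mul1r big1 ?addr0 // => j ji.
by rewrite mxE (negbTE ji) andbF mul0r.
Qed.

Lemma ei_sphere i : sphereS (ei i).
Proof. by rewrite /sphereS /= rdot_ei mxE !eqxx. Qed.

Definition cone f (s : seq R) : R := let x := rvec d s in
  if (rdot x x <= 1) && (x != 0) then f ((Num.sqrt (rdot x x))^-1 *: x) else 0.

Definition ballvol : R :=
  itint d.+1 (fun s => let x := rvec d s in if rdot x x <= 1 then 1 else 0).

Lemma sph_intE f : sph_int f = itint d.+1 (cone f) / ballvol.
Proof. by []. Qed.

Definition coords y (i : nat) : R := if insub i is Some j then y ord0 j else 0.

Lemma coordsE y (i : 'I_d.+1) : coords y i = y ord0 i.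
Proof. by rewrite /coords valK. Qed.

Lemma rdot_rvec s : rdot (rvec d s) (rvec d s) = sqs d.+1 s.
Proof. by apply: eq_bigr => i _; rewrite mxE expr2. Qed.

Lemma rdot_rvecr y s : rdot y (rvec d s) = dots d.+1 (coords y) s.
Proof. by apply: eq_bigr => i _; rewrite mxE coordsE. Qed.

Lemma sqs_coords y : \sum_(i < d.+1) coords y i ^+ 2 = rdot y y.
Proof. by apply: eq_bigr => i _; rewrite coordsE expr2. Qed.

Definition sphf f := box_fun d.+1 (cone f).

Lemma cone_ext f g : (forall x, sphereS x -> f x = g x) -> cone f =1 cone g.
Proof.
move=> fg s; rewrite /cone /=; case: ifP => // /andP[_ s0].
by rewrite fg //; exact: normalize_sphere.
Qed.

Lemma sph_int_ext f g : (forall x, sphereS x -> f x = g x) -> sph_int f = sph_int g.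
Proof.
by move=> fg; rewrite !sph_intE; congr (_ / _); apply: itint_ext => s _; exact: cone_ext.
Qed.

Lemma sphf_ext f g : (forall x, sphereS x -> f x = g x) -> sphf f -> sphf g.
Proof. by move=> fg; apply: box_fun_ext => s _; exact: cone_ext. Qed.

Lemma cone_lin a f g s : cone (fun x => a * f x + g x) s = a * cone f s + cone g s.
Proof. by rewrite /cone /=; case: ifP => // _; rewrite mulr0 addr0. Qed.

Lemma sphf_lin a f g : sphf f -> sphf g -> sphf (fun x => a * f x + g x).
Proof.
move=> hf hg; apply: box_fun_ext (box_fun_lin a hf hg) => s _.
by rewrite cone_lin.
Qed.

Lemma sph_int_lin a f g : sphf f -> sphf g ->
  sph_int (fun x => a * f x + g x) = a * sph_int f + sph_int g.
Proof.
move=> hf hg; rewrite !sph_intE mulrA -mulrDl -itint_lin //; congr (_ / _).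
by apply: itint_ext => s _; rewrite cone_lin.
Qed.

(** Measurability tested on measurable coordinate maps, the form in which [box_family] asks for
    it. *)
Definition borel_pt f := forall d' (T : measurableType d') (g : 'I_d.+1 -> T -> R),
  (forall i, measurable_fun setT (g i)) ->
  measurable_fun setT (fun t => f (\row_i g i t)).

Lemma borel_rdot y (F : R -> R) : measurable_fun setT F ->
  borel_pt (fun x => F (rdot y x)).
Proof.
move=> mF d' T g mg; apply: (measurableT_comp mF); apply: measurable_sum => i.
apply: measurable_funM; first exact: measurable_cst.
by apply: eq_measurable_fun (mg i) => t _; rewrite mxE.
Qed.

Lemma borel_mul f g : borel_pt f -> borel_pt g -> borel_pt (fun x => f x * g x).
Proof. by move=> mf mg d' T h mh; apply: measurable_funM; [exact: mf|exact: mg]. Qed.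

Lemma borel_sphf f C : borel_pt f -> (forall x, sphereS x -> `|f x| <= C) -> sphf f.
Proof.
move=> mf bf; exists C; split.
- move=> d' T phi h _ mh.
  have mr : measurable_fun setT (fun t => sqs d.+1 (mkseq (h ^~ t) d.+1)).
    exact: measurable_sqs.
  have -> : (fun t => cone f (mkseq (h ^~ t) d.+1)) =
     (fun t => if (sqs d.+1 (mkseq (h ^~ t) d.+1) <= 1) &&
       ~~ (sqs d.+1 (mkseq (h ^~ t) d.+1) == 0)
      then f (\row_i (sqs d.+1 (mkseq (h ^~ t) d.+1) `^ (- 2^-1) * h i t)) else 0).
    apply/funext => t; rewrite /cone /= -rdot_eq0 !rdot_rvec; case: ifP => // _.
    congr f; apply/rowP => i; rewrite !mxE nth_mkseq //; congr (_ * _).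
    by rewrite powRN powR12_sqrt // sqs_ge0.
  apply: measurable_fun_ifT; last exact: measurable_cst.
  + apply: measurable_and; first by apply: measurable_fun_ler => //; exact: measurable_cst.
    apply: measurable_neg; apply: measurable_fun_eqr => //; exact: measurable_cst.
  + apply: mf => i; apply: measurable_funM => //.
    exact: (measurableT_comp (measurable_powR _) mr).
- move=> _ s sn; rewrite /cone /=; case: ifP => [/andP[h1 h2]|_]; last first.
    have C0 : 0 <= C := le_trans (normr_ge0 _) (bf _ (ei_sphere ord0)).
    by rewrite normr0 mulr_ge0.
  have -> : in_box s by apply: (sqs_in_box sn); rewrite -rdot_rvec.
  by rewrite mulr1 bf //; exact: normalize_sphere.
Qed.

End SphereIntegral.

(** * Volume of the ball and normalization of the spherical mean *)

Section BallVolume.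
Variable R : realType.
Local Notation mu := (@lebesgue_measure R).
Local Open Scope classical_set_scope.

Definition cube n (e : R) (s : seq R) : R := \prod_(i < n) (`|s`_i| <= e)%R%:R.

Lemma cube_cons n e x s : cube n.+1 e (x :: s) = (`|x| <= e)%R%:R * cube n e s.
Proof. by rewrite /cube big_ord_recl. Qed.

Lemma cube_ge0 n e s : 0 <= cube n e s.
Proof. by apply: prodr_ge0 => i _; rewrite ler0n. Qed.

Lemma cube_le1 n e s : cube n e s <= 1.
Proof.
by apply: prodr_ile1 => i _; rewrite ler0n lern1; case: (_ <= _)%R.
Qed.

Lemma box_fun_cube n e : e <= 1 -> box_fun n (cube n e).
Proof.
move=> e1; exists 1; split.
- move=> d' T phi f _ mf; apply: measurable_prod => i _.
  apply: (measurableT_comp (f := fun b : bool => (b%:R : R))) => //.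
  apply: measurable_fun_ler; last exact: measurable_cst.
  apply: (measurableT_comp (f := fun x : R => `|x|)) => //.
  by apply: eq_measurable_fun (mf i) => t _; rewrite nth_mkseq.
- move=> _ s sn; rewrite ger0_norm ?cube_ge0 // mul1r.
  case: (boolP (in_box s)) => [_|]; first exact: cube_le1.
  rewrite /in_box -has_predC => /(has_nthP 0)[i]; rewrite sn => i_n /= h.
  rewrite /cube (bigD1 (Ordinal i_n)) //= [(_ <= e)%R]leNgt.
  by rewrite (le_lt_trans e1) ?mul0r // ltNge.
Qed.

Lemma itint_cube n e : 0 <= e -> itint n (cube n e) = (2 * e) ^+ n.
Proof.
move=> e0; elim: n => [|n IH]; first by rewrite /= /cube big_ord0.
rewrite itintS.
have -> : (fun x => itint n (fun s => cube n.+1 e (x :: s))) =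
   (fun x => (2 * e) ^+ n * \1_(`[- e, e]) x).
  apply/funext => x; rewrite indicE mem_setE in_itv /= -ler_norml -IH.
  case: (boolP (`|x| <= e)) => xe.
    by rewrite mulr1; apply: itint_ext => s _; rewrite cube_cons xe mul1r.
  rewrite mulr0 -(itint0 R n); apply: itint_ext => s _.
  by rewrite cube_cons (negbTE xe) mul0r.
rewrite RintegralZl //; last exact: (@integrable_indic_itv R (- e) e true false).
rewrite exprSr; congr (_ * _).
rewrite /Rintegral integral_indic // setIT.
rewrite [X in fine X](@lebesgue_measure_itv R `[- e, e]%R) /= lte_fin; case: ifPn => [|h] /=.
  by rewrite opprK -mulr2n mulr_natl.
by move: h; rewrite -leNgt => h; have -> : e = 0 by [apply/eqP; rewrite eq_le e0 andbT; lra]; rewrite mulr0.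
Qed.

Lemma radial_profile_bool (P : R -> bool) : measurable_fun setT P ->
  (forall r, P r -> r <= 1) -> radial_profile 1 (fun p : R * R => (P p.1)%:R : R).
Proof.
move=> mP P1; split.
- apply: (measurableT_comp (f := fun b : bool => (b%:R : R))) => //.
  by apply: measurableT_comp mP _.
- by move=> p; case: (P _); rewrite ?normr1 ?normr0.
- by move=> p p1; case: (boolP (P p.1)) => // /P1; rewrite leNgt p1.
Qed.

Lemma box_fun_bool n (P : R -> bool) : measurable_fun setT P ->
  (forall r, P r -> r <= 1) -> box_fun n (fun s => (P (sqs n s))%:R : R).
Proof.
move=> mP P1.
have := box_fun_radial n (fun=> 0) 0 (lexx 0) (radial_profile_bool mP P1).
by apply: box_fun_ext => s _ /=; rewrite add0r.
Qed.

Lemma ballvolE d : ballvol R d = itint d.+1 (fun s => (sqs d.+1 s <= 1)%R%:R).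
Proof.
by apply: itint_ext => s _; rewrite /= rdot_rvec; case: (_ <= _)%R.
Qed.

Lemma ballvol_gt0 d : 0 < ballvol R d.
Proof.
(* The cube of half-side 1/(d + 1) lies in the ball: each squared coordinate is at most 1/(d + 1),
   so the d + 1 of them sum to at most 1. *)
have e0 : 0 < (d.+1%:R : R)^-1 by rewrite invr_gt0.
have e1 : (d.+1%:R : R)^-1 <= 1 by rewrite invf_le1 // ler1n.
have h : 0 < itint d.+1 (cube d.+1 (d.+1%:R : R)^-1).
  by rewrite itint_cube ?exprn_gt0 ?mulr_gt0 // ltW.
rewrite ballvolE (lt_le_trans h) //; apply: itint_le.
- exact: box_fun_cube.
- apply: (@box_fun_bool _ (fun r => r <= 1)) => //; apply: measurable_fun_ler => //.
move=> s _; case: (boolP (sqs d.+1 s <= 1)%R) => [_|]; first exact: cube_le1.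
rewrite -ltNge => hs; rewrite leNgt; apply/negP => hc.
have : sqs d.+1 s <= 1.
  have hi i : (i < d.+1)%N -> `|s`_i| <= (d.+1%:R)^-1.
    move=> id; move: hc; rewrite /cube (bigD1 (Ordinal id)) //=.
    by case: (_ <= _)%R => //; rewrite mul0r ltxx.
  apply: (@le_trans _ _ (\sum_(i < d.+1) (d.+1%:R : R)^-1)).
    apply: ler_sum => i _; rewrite -real_normK ?num_real // expr2.
    rewrite -[leRHS]mulr1 ler_pM // ?hi // (le_trans (hi _ _)) //.
  by rewrite sumr_const card_ord -[_ *+ _]mulr_natl mulfV.
by rewrite leNgt hs.
Qed.

(* The two integrands differ at the origin only. *)
Lemma itint_cone1 d : itint d.+1 (cone (fun _ : pt R d => 1)) = ballvol R d.
Proof.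
pose P1 (r : R) := (r <= 1) && (r != 0).
pose P2 (r : R) := r == 0.
have mP2 : measurable_fun setT P2 by exact: measurable_fun_eqr.
have mP1 : measurable_fun setT P1.
  apply: measurable_and; first exact: measurable_fun_ler.
  by apply: measurable_neg; exact: measurable_fun_eqr.
have b1 : box_fun d.+1 (fun s => (P1 (sqs d.+1 s))%:R : R).
  by apply: box_fun_bool => // r /andP[].
have b2 : box_fun d.+1 (fun s => (P2 (sqs d.+1 s))%:R : R).
  by apply: box_fun_bool => // r /eqP ->.
transitivity (itint d.+1 (fun s => (P1 (sqs d.+1 s))%:R : R)).
  apply: itint_ext => s _; rewrite /cone /= -rdot_eq0 rdot_rvec /P1.
  by case: ifP.
have z : itint d.+1 (fun s => (P2 (sqs d.+1 s))%:R) = 0 :> R.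
  have i2 := box_fun_integrable b2.
  have /measurable_EFinP mH := measurable_int _ i2.
  set H := (fun x : R => _) in i2 mH.
  (* A bounded function supported in an interval of radius 0 has integral 0. *)
  have bH x : `|H x| <= `|H 0| * (`|x| <= 0)%R%:R.
    have [->|x0] := eqVneq x 0; first by rewrite normr0 lexx mulr1.
    rewrite normr_le0 (negbTE x0) mulr0 normr_le0; apply/eqP.
    rewrite /H -(itint0 R d); apply: itint_ext => s _.
    by rewrite /P2 sqs_cons paddr_eq0 ?sqr_ge0 ?sqs_ge0 // sqrf_eq0 (negbTE x0).
  have := bounded_Rintegral (lexx 0) mH bH.
  by rewrite mulr0 mulr0 normr_le0 => /eqP.
have := itint_lin 1 b1 b2; rewrite z addr0 mul1r => <-.
rewrite ballvolE; apply: itint_ext => s _; rewrite /P1 /P2 mul1r.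
have := sqs_ge0 d.+1 s; case: eqP => [->|_] _; first by rewrite ler01 /= add0r.
by rewrite andbT addr0.
Qed.

End BallVolume.

Section SphereMean.
Variables (R : realType) (d : nat).
Local Notation pt := (@pt R d).
Local Open Scope classical_set_scope.
Implicit Types (x y z : pt) (f g : pt -> R) (s : seq R).

Lemma sph_int_cst c : sph_int (fun _ : pt => c) = c.
Proof.
have h1 : sphf (fun _ : pt => 1).
  apply: (@borel_sphf _ _ _ 1) => [d' T g _|x _]; first exact: measurable_cst.
  by rewrite normr1.
have h0 : sphf (fun _ : pt => 0).
  apply: (@borel_sphf _ _ _ 0) => [d' T g _|x _]; first exact: measurable_cst.
  by rewrite normr0.
have i1 : sph_int (fun _ : pt => 1) = 1.
  by rewrite sph_intE itint_cone1 divff // gt_eqF // ballvol_gt0.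
have i0 : sph_int (fun _ : pt => 0) = 0.
  rewrite sph_intE -[RHS](mul0r (ballvol R d)^-1); congr (_ / _).
  rewrite -[RHS](itint0 R d.+1); apply: itint_ext => s _.
  by rewrite /cone /=; case: ifP.
by have := sph_int_lin c h1 h0; rewrite i1 i0 mulr1 addr0 .
Qed.

Lemma sph_int_le f g : sphf f -> sphf g ->
  (forall x, sphereS x -> f x <= g x) -> sph_int f <= sph_int g.
Proof.
move=> hf hg fg; rewrite !sph_intE ler_pM2r ?invr_gt0 ?ballvol_gt0 //.
apply: itint_le => // s _; rewrite /cone /=; case: ifP => // /andP[_ s0].
exact/fg/normalize_sphere.
Qed.

End SphereMean.

Lemma sph_int_rotate (R : realType) (d : nat) (F : R -> R) (C : R) (y : pt R d) :
  (0 < d)%N -> measurable_fun setT F -> (forall t, `|t| <= 1 -> `|F t| <= C) ->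
  sphereS y ->
  sph_int (fun x : pt R d => F (rdot y x)) = sph_int (fun x : pt R d => F (x ord0 ord0)).
Proof.
case: d y => [//|d] y _ mF bF y1.
have C0 : 0 <= C by apply: le_trans (bF 0 _); rewrite ?normr0 ?ler01.
(* As |x|^2 and y . x determine the cosine, the cone integrand is a radial profile. [F] is bounded
   on [-1, 1] only, hence the last guard, which Cauchy-Schwarz makes true at points of the ball. *)
pose W (p : R * R) : R :=
  if [&& p.1 <= 1, ~~ (p.1 == 0) & `|p.1 `^ (- 2^-1) * p.2| <= 1]
  then F (p.1 `^ (- 2^-1) * p.2) else 0.
have mpow : measurable_fun setT (fun p : R * R => p.1 `^ (- 2^-1) * p.2).
  by apply: measurable_funM => //; exact: (measurableT_comp (measurable_powR _)).
have hW : radial_profile C W.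
  split.
  - apply: measurable_fun_ifT; last exact: measurable_cst.
      apply: measurable_and; first by apply: measurable_fun_ler => //; exact: measurable_cst.
      apply: measurable_and.
        by apply: measurable_neg; apply: measurable_fun_eqr => //; exact: measurable_cst.
      apply: measurable_fun_ler; last exact: measurable_cst.
      exact: (measurableT_comp (f := fun x : R => `|x|)).
    exact: (measurableT_comp mF mpow).
  - by move=> p; rewrite /W; case: ifP => [/and3P[_ _ h]|_]; [exact: bF|rewrite normr0].
  - by move=> p p1; rewrite /W leNgt p1.
have key (z : pt R d.+1) : sphereS z ->
    cone (fun x => F (rdot z x)) =1
    (fun s => W (0 + sqs d.+2 s, 0 + dots d.+2 (coords z) s)).
  move=> z1 s; rewrite /cone /W /= !add0r -rdot_eq0 !rdot_rvec -rdot_rvecr.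
  case: (boolP (sqs d.+2 s <= 1)) => //= s1; case: eqP => //= /eqP s0.
  have r0 : rvec d.+1 s != 0 by rewrite -rdot_eq0 rdot_rvec.
  rewrite powRN powR12_sqrt ?sqs_ge0 // -rdot_rvec -rdotZr.
  by rewrite rdot_sphere_le1 //; exact: normalize_sphere.
have key2 (z : pt R d.+1) : sphereS z -> sph_int (fun x => F (rdot z x)) =
  itint d.+2 (fun s => W (0 + sqs d.+2 s, 0 + (1 * s`_0 + 0 * s`_1))) / ballvol R d.+1.
  move=> z1; apply: (congr1 (fun v => v / ballvol R d.+1)).
  rewrite (itint_ext (fun s _ => key z z1 s)).
  by rewrite (itint_radial _ _ _ (lexx 0) hW) sqs_coords z1 sqrtr1.
apply: (etrans (key2 _ y1)).
apply: (etrans (esym (key2 _ (ei_sphere R (ord0 : 'I_d.+2))))).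
by apply: sph_int_ext => x _; rewrite rdot_ei.
Qed.

(** * Moments of a coordinate on the sphere *)

Section SphereMoments.
Variables (R : realType) (d : nat).
Hypothesis d_gt0 : (0 < d)%N.
Local Notation pt := (@pt R d).
Local Open Scope classical_set_scope.
Implicit Types (x y z : pt) (f g : pt -> R) (p q : {poly R}).

Lemma horner_bound p t : `|t| <= 1 -> `|p.[t]| <= \sum_(i < size p) `|p`_i|.
Proof.
move=> t1; rewrite horner_coef (le_trans (ler_norm_sum _ _ _)) // ler_sum // => i _.
by rewrite normrM normrX ler_piMr // exprn_ile1.
Qed.

Lemma measurable_horner p : measurable_fun setT (fun t : R => p.[t]).
Proof. by apply: continuous_measurable_fun; exact: continuous_horner. Qed.

Lemma borel_poly y p : borel_pt (fun x => p.[rdot y x]).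
Proof. by apply: borel_rdot; exact: measurable_horner. Qed.

Lemma sphf_poly y p : sphereS y -> sphf (fun x => p.[rdot y x]).
Proof.
move=> y1; apply: (borel_sphf (borel_poly y p)) => x x1.
by apply: horner_bound; exact: rdot_sphere_le1.
Qed.

Lemma sphf_poly2 y z p q : sphereS y -> sphereS z ->
  sphf (fun x => p.[rdot y x] * q.[rdot z x]).
Proof.
move=> y1 z1.
apply: (borel_sphf (C := (\sum_(i < size p) `|p`_i|) * (\sum_(i < size q) `|q`_i|))
  (borel_mul (borel_poly y p) (borel_poly z q))) => x x1.
by rewrite normrM ler_pM //; apply: horner_bound; exact: rdot_sphere_le1.
Qed.

Lemma sphf0 : sphf (fun _ : pt => 0).
Proof.
by have := @sphf_poly _ 0 (ei_sphere R ord0); apply: sphf_ext => x _; rewrite horner0.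
Qed.

Lemma sphf_cst c : sphf (fun _ : pt => c).
Proof.
by have := @sphf_poly _ c%:P (ei_sphere R ord0); apply: sphf_ext => x _; rewrite hornerC.
Qed.

Lemma sphf_sum I (r : seq I) (c : I -> R) (F : I -> pt -> R) :
  (forall i, sphf (F i)) -> sphf (fun x => \sum_(i <- r) c i * F i x).
Proof.
move=> hF; elim: r => [|a r IH].
  by apply: sphf_ext sphf0 => x _; rewrite big_nil.
by apply: sphf_ext (sphf_lin (c a) (hF a) IH) => x _; rewrite big_cons.
Qed.

Lemma sph_int_sum I (r : seq I) (c : I -> R) (F : I -> pt -> R) :
  (forall i, sphf (F i)) ->
  sph_int (fun x => \sum_(i <- r) c i * F i x) = \sum_(i <- r) c i * sph_int (F i).
Proof.
move=> hF; elim: r => [|a r IH].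
  rewrite big_nil -[RHS](@sph_int_cst R d); apply: sph_int_ext => x _.
  by rewrite big_nil.
rewrite big_cons -IH -sph_int_lin //; last exact: sphf_sum.
by apply: sph_int_ext => x _; rewrite big_cons.
Qed.

Lemma sph_intZ c f : sphf f -> sph_int (fun x => c * f x) = c * sph_int f.
Proof.
move=> hf; have := sph_int_sum [:: tt] (fun=> c) (F := fun=> f) (fun=> hf).
by rewrite big_seq1 => <-; apply: sph_int_ext => x _; rewrite big_seq1.
Qed.

Definition polar p : R := sph_int (fun x : pt => p.[x ord0 ord0]).

Lemma sph_int_poly y p : sphereS y -> sph_int (fun x => p.[rdot y x]) = polar p.
Proof.
move=> y1; apply: (sph_int_rotate d_gt0 (measurable_horner p)) => // t.
exact: horner_bound.
Qed.

Lemma polarE p : polar p = sph_int (fun x : pt => p.[rdot (ei R ord0) x]).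
Proof. by apply: sph_int_ext => x _; rewrite rdot_ei. Qed.

Lemma sph_int_pow y m : y != 0 ->
  sph_int (fun x => rdot y x ^+ m) = Num.sqrt (rdot y y) ^+ m * polar 'X^m.
Proof.
move=> y0; have y1 := normalize_sphere y0.
have r0 : Num.sqrt (rdot y y) != 0.
  by rewrite sqrtr_eq0 -ltNge lt_neqAle eq_sym rdot_eq0 y0 rdot_ge0.
rewrite -(sph_int_poly 'X^m y1) -sph_intZ; last exact: sphf_poly.
apply: sph_int_ext => x _.
by rewrite hornerXn rdotZl exprMn mulrA -exprMn divff // expr1n mul1r.
Qed.

(** The poles e_0 and - e_0 have the same spherical mean. *)
Lemma polar_odd m : odd m -> polar 'X^m = 0.
Proof.
move=> om; have N0 : - ei R ord0 != 0 :> pt.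
  by rewrite oppr_eq0 -rdot_eq0 (ei_sphere R) oner_neq0.
have := sph_int_pow m N0; rewrite -scaleN1r rdotZl rdotZr mulN1r mulN1r opprK.
rewrite (ei_sphere R) sqrtr1 expr1n mul1r => h.
have : polar 'X^m = - polar 'X^m.
  rewrite -{1}h -[RHS]mulN1r polarE -sph_intZ; last exact/sphf_poly/ei_sphere.
  apply: sph_int_ext => x _.
  by rewrite rdotZl mulN1r exprNn -signr_odd om expr1 hornerXn.
by move=> e; lra.
Qed.

Lemma poly_ext p q : (forall t, p.[t] = q.[t]) -> p = q.
Proof.
move=> pq; apply/eqP; rewrite -subr_eq0; apply/negPn/negP => nz.
have := max_poly_roots nz (rs := [seq (i%:R : R) | i <- iota 0 (size (p - q))]).
rewrite size_map size_iota ltnn => h; suff : false by []; apply: h.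
- by apply/allP => t _; rewrite rootE !hornerE pq subrr.
- by rewrite map_inj_uniq ?iota_uniq // => i j /eqP; rewrite eqr_nat => /eqP.
Qed.

(** With n = 2h + 2, the mean of (x_0 + t x_i)^n is (1 + t^2)^(h+1) times the n-th moment, for all
    real t. Compare the coefficients of t^2: binomial (n, 2) = (h + 1)(2h + 1) against h + 1. *)
Lemma polar_even_aux h (i : 'I_d.+1) : i != ord0 ->
  (h.*2.+1)%:R * sph_int (fun x : pt => x ord0 ord0 ^+ h.*2 * x ord0 i ^+ 2) =
  polar 'X^(h.*2.+2).
Proof.
move=> i0; set n := h.*2.+2.
pose b (k : nat) := sph_int (fun x : pt => x ord0 ord0 ^+ (n - k) * x ord0 i ^+ k).
have bE k : sphf (fun x : pt => x ord0 ord0 ^+ (n - k) * x ord0 i ^+ k).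
  have := sphf_poly2 'X^(n - k) 'X^k (ei_sphere R ord0) (ei_sphere R i).
  by apply: sphf_ext => x _; rewrite !hornerXn !rdot_ei.
pose P : {poly R} := \sum_(k < n.+1) ('C(n, k)%:R * b k) *: 'X^k.
pose Q : {poly R} := polar 'X^n *: (1 + 'X^2) ^+ h.+1.
have PQ : P = Q.
  apply: poly_ext => t.
  have w2 : rdot (ei R ord0 + t *: ei R i : pt) (ei R ord0 + t *: ei R i) = 1 + t ^+ 2.
    rewrite !(rdotDl, rdotDr, rdotZl, rdotZr) !rdot_ei !mxE !eqxx /=.
    by rewrite (negbTE i0) eq_sym (negbTE i0) /=; ring.
  have w0 : ei R ord0 + t *: ei R i != 0 :> pt.
    by rewrite -rdot_eq0 w2 gt_eqF // ltr_wpDr // sqr_ge0.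
  have := sph_int_pow n w0; rewrite w2.
  have -> : Num.sqrt (1 + t ^+ 2) ^+ n = (1 + t ^+ 2) ^+ h.+1.
    have -> : n = (2 * h.+1)%N by rewrite mul2n doubleS.
    by rewrite exprM sqr_sqrtr // addr_ge0 ?sqr_ge0.
  move=> e; rewrite /Q hornerZ horner_exp !hornerE /= mulrC -e.
  rewrite /P horner_sum.
  under eq_bigr do rewrite hornerZ hornerXn.
  transitivity (\sum_(k < n.+1) ('C(n, k)%:R * t ^+ k) * b k).
    by apply: eq_bigr => k _; ring.
  rewrite -sph_int_sum //; apply: sph_int_ext => x _.
  rewrite rdotDl rdotZl !rdot_ei exprDn; apply: eq_bigr => k _.
  by rewrite exprMn -[RHS]mulr_natr; ring.
have := congr1 (fun p => p`_2) PQ.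
rewrite /P coef_sum (bigD1 (Ordinal (isT : (2 < n.+1)%N))) //= big1 => [|k k2]; last first.
  rewrite coefZ coefXn; case: eqP => [e|_]; last by rewrite mulr0.
  by move: k2; rewrite -val_eqE /= -e eqxx.
rewrite coefZ coefXn eqxx mulr1 addr0.
rewrite /Q coefZ.
have -> : ((1 + 'X^2) ^+ h.+1 : {poly R})`_2 = h.+1%:R.
  rewrite exprDn coef_sum (bigD1 (Ordinal (isT : (1 < h.+2)%N))) //= big1 => [|k k1]; last first.
    rewrite expr1n mul1r -exprM coefMn coefXn; case: eqP => [e|_]; last by rewrite mul0rn.
    by move: k1; rewrite -val_eqE /=; case: (nat_of_ord k) e => [|[|[|?]]] //.
  by rewrite expr1n mul1r expr1 coefMn coefXn eqxx bin1 addr0.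
have -> : 'C(n, 2)%:R = h.+1%:R * h.*2.+1%:R :> R.
  by rewrite bin2 -natrM; congr (_%:R); rewrite /n -[h.*2.+2]/(h.+1.*2) -doubleMl doubleK.
rewrite -mulrA [polar _ * _]mulrC => /(mulfI (nS_neq0 R h)) <-.
by congr (_ * _); apply: sph_int_ext => x _; rewrite /n !subSS subn0.
Qed.

Lemma polar_moment : moment_functional d%:R polar.
Proof.
split.
- move=> a p q; rewrite !polarE -sph_int_lin; try exact/sphf_poly/ei_sphere.
  by apply: sph_int_ext => x _; rewrite hornerD hornerZ.
- by rewrite -[RHS](@sph_int_cst R d); apply: sph_int_ext => x _; rewrite hornerC.
- case=> [|m] /=; first by rewrite (@polar_odd 1) // mulr0 mul0r.
  have [om|] := boolP (odd m); first by rewrite !polar_odd ?mulr0 //= negbK.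
  move=> em; have mE : m = m./2.*2 by rewrite -[LHS]odd_double_half (negbTE em).
  set h := m./2 in mE; rewrite mE.
  pose F (i : 'I_d.+1) (x : pt) := x ord0 ord0 ^+ h.*2 * x ord0 i ^+ 2.
  have hF i : sphf (F i).
    have := sphf_poly2 'X^(h.*2) 'X^2 (ei_sphere R ord0) (ei_sphere R i).
    by apply: sphf_ext => x _; rewrite !hornerXn !rdot_ei.
  (* Insert sum_i x_i^2 = 1: the term i = 0 is the moment of degree 2h + 2 and each of the d others
     is that moment divided by 2h + 1. *)
  have e : polar 'X^(h.*2) = \sum_(i < d.+1) 1 * sph_int (F i).
    rewrite -sph_int_sum //; apply: sph_int_ext => x x1.
    rewrite hornerXn /F; under eq_bigr do rewrite mul1r expr2.
    by rewrite -mulr_sumr -/(rdot x x) x1 mulr1.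
  have e0 : sph_int (F ord0) = polar 'X^(h.*2.+2).
    by apply: sph_int_ext => x _; rewrite hornerXn /F -exprD addn2.
  rewrite (bigD1 ord0) //= e0 mul1r in e.
  rewrite mulrDl e mulrDr; congr (_ + _); rewrite mulr_sumr.
  under eq_bigr => i i0 do rewrite mul1r polar_even_aux //.
  rewrite sumr_const mulr_natl; congr (_ *+ _).
  rewrite -[LHS]/(d.+1.-1) -[in LHS](card_ord d.+1) -(cardC1 (ord0 : 'I_d.+1)).
  by apply: eq_card => i; rewrite !inE.
Qed.

End SphereMoments.

(** * Positive definite kernels *)

Lemma quadratic_discr (R : realType) (A B C : R) : 0 <= C ->
  (forall t, 0 <= A + 2 * t * B + t ^+ 2 * C) -> B ^+ 2 <= A * C.
Proof.
rewrite le_eqVlt => /predU1P[<-|C0] h; last first.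
  have := h (- B / C); rewrite -(ler_pM2r C0) mul0r => e.
  rewrite -subr_ge0; apply: le_trans e _; rewrite le_eqVlt; apply/orP; left; apply/eqP.
  by field; rewrite gt_eqF.
have [->|B0] := eqVneq B 0; first by rewrite expr0n mulr0.
(* With C = 0 and B nonzero the affine function of t would take the value -1 here. *)
have := h (- (A + 1) / (2 * B)).
have -> : A + 2 * (- (A + 1) / (2 * B)) * B + (- (A + 1) / (2 * B)) ^+ 2 * 0 = -1.
  by field; rewrite B0.
by rewrite oppr_ge0 ler10.
Qed.

Section PositiveDefinite.
Variables (R : realType) (T : eqType) (S : T -> Prop).
Implicit Types (k : T -> T -> R) (c : seq (R * T)).

Definition qform k c := \sum_(p <- c) \sum_(q <- c) p.1 * q.1 * k p.2 q.2.

Record psd k : Prop := Psd {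
  psd_sym : forall x y, S x -> S y -> k x y = k y x;
  psd_ge0 : forall c, (forall p, p \in c -> S p.2) -> 0 <= qform k c }.

Lemma qform_cons k p c : qform k (p :: c) =
  p.1 * p.1 * k p.2 p.2 + \sum_(q <- c) p.1 * q.1 * k p.2 q.2 +
  \sum_(q <- c) q.1 * p.1 * k q.2 p.2 + qform k c.
Proof.
rewrite /qform !big_cons -!addrA; congr (_ + (_ + _)).
by rewrite -big_split; apply: eq_bigr => q _; rewrite big_cons.
Qed.

Lemma qform_scale k a c : qform k [seq (a * p.1, p.2) | p <- c] = a ^+ 2 * qform k c.
Proof.
rewrite /qform big_map mulr_sumr; apply: eq_bigr => p _.
rewrite big_map mulr_sumr; apply: eq_bigr => q _ /=; ring.
Qed.

Lemma psd_diag_ge0 k x : psd k -> S x -> 0 <= k x x.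
Proof.
move=> kP Sx; have := psd_ge0 kP (c := [:: (1, x)]).
rewrite /qform !big_seq1 /= !mul1r; apply => p.
by rewrite inE => /eqP ->.
Qed.

Lemma psd_cons k t x c : psd k -> S x -> (forall p, p \in c -> S p.2) ->
  0 <= qform k c + 2 * t * (\sum_(p <- c) p.1 * k x p.2) + t ^+ 2 * k x x.
Proof.
move=> kP Sx Sc; have := psd_ge0 kP (c := (t, x) :: c).
rewrite qform_cons /=; set v := \sum_(q <- c) q.1 * k x q.2.
have -> : \sum_(q <- c) t * q.1 * k x q.2 = t * v.
  by rewrite mulr_sumr; apply: eq_bigr => q _; rewrite mulrA.
have -> : \sum_(q <- c) q.1 * t * k q.2 x = t * v.
  rewrite mulr_sumr; apply: eq_big_seq => q qc.
  by rewrite (psd_sym kP (Sc _ qc) Sx); ring.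
move=> h; apply: le_trans (h _) _.
  by move=> p; rewrite inE => /predU1P[->|/Sc].
by rewrite le_eqVlt; apply/orP; left; apply/eqP; ring.
Qed.

Lemma psd_CS k x c : psd k -> S x -> (forall p, p \in c -> S p.2) ->
  (\sum_(p <- c) p.1 * k x p.2) ^+ 2 <= qform k c * k x x.
Proof.
move=> kP Sx Sc; apply: quadratic_discr; first exact: psd_diag_ge0.
by move=> t; exact: psd_cons.
Qed.

Lemma psd_CS1 k x y : psd k -> S x -> S y -> k x y ^+ 2 <= k x x * k y y.
Proof.
move=> kP Sx Sy; have := psd_CS kP Sx (c := [:: (1, y)]).
rewrite /qform !big_seq1 /= !mul1r mulrC; apply => p.
by rewrite inE => /eqP ->.
Qed.

Lemma psd_diag0 k x y : psd k -> S x -> S y -> k x x = 0 -> k x y = 0.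
Proof.
move=> kP Sx Sy x0; have := psd_CS1 kP Sx Sy; rewrite x0 mul0r => h.
by apply/eqP; rewrite -sqrf_eq0 eq_le h sqr_ge0.
Qed.

Lemma psd_schur_complement k z : psd k -> S z ->
  psd (fun x y => k x y - k x z * k z y / k z z).
Proof.
move=> kP Sz; split.
  move=> x y Sx Sy; rewrite (psd_sym kP Sx Sy) (psd_sym kP Sx Sz) (psd_sym kP Sz Sy).
  by rewrite [k z x * _]mulrC.
move=> c Sc; set v := \sum_(p <- c) p.1 * k z p.2.
have -> : qform (fun x y => k x y - k x z * k z y / k z z) c =
   qform k c - v ^+ 2 / k z z.
  rewrite /qform /v expr2 -mulrA mulr_suml -sumrB; apply: eq_big_seq => p pc.
  rewrite mulr_suml mulr_sumr -sumrB; apply: eq_bigr => q _.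
  by rewrite (psd_sym kP (Sc _ pc) Sz); ring.
(* Division by zero gives 0, so in this case the complement is [k] itself. *)
have [z0|z0] := eqVneq (k z z) 0.
  by rewrite z0 invr0 mulr0 subr0; exact: psd_ge0.
have zp : 0 < k z z by rewrite lt_neqAle eq_sym z0 psd_diag_ge0.
by rewrite subr_ge0 ler_pdivrMr //; exact: psd_CS.
Qed.

(** One column per point of [s], by Schur complements: the number of columns becomes the n of the
    final bound. The second clause serves the induction: the complement at [z] vanishes on the
    diagonal at [z], so later columns vanish there and the expansion of [k z y] stops after its
    first term. *)
Lemma psd_cholesky k (s : seq T) : psd k -> (forall x, x \in s -> S x) ->
  exists w : nat -> T -> R,
    (forall x y, x \in s -> y \in s -> k x y = \sum_(i < size s) w i x * w i y) /\
    (forall x i, S x -> k x x = 0 -> w i x = 0).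
Proof.
elim: s k => [|z s IH] k kP Ss.
  by exists (fun _ _ => 0); split.
have Sz : S z by apply: Ss; rewrite mem_head.
have Ss' x : x \in s -> S x by move=> xs; apply: Ss; rewrite inE xs orbT.
have [w [w1 w2]] := IH _ (psd_schur_complement kP Sz) Ss'.
have dg x : S x -> k x x = 0 -> k x z = 0.
  by move=> Sx /(psd_diag0 kP Sx Sz).
exists (fun i x => if i is j.+1 then w j x else k x z / Num.sqrt (k z z)); split.
- have zz0 : k z z - k z z * k z z / k z z = 0.
    have [->|n0] := eqVneq (k z z) 0; first by rewrite !mul0r subrr.
    by rewrite mulfK // subrr.
  have wz i : w i z = 0 by apply: w2.
  have cz : k z z = Num.sqrt (k z z) ^+ 2 by rewrite sqr_sqrtr // psd_diag_ge0.
  have e x y : S x -> S y -> k x z / Num.sqrt (k z z) * (k y z / Num.sqrt (k z z)) =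
      k x z * k z y / k z z.
    move=> Sx Sy; rewrite (psd_sym kP Sy Sz) [in RHS]cz -exprVn.
    by rewrite expr2; ring.
  have z1 y : S y -> k z z * k z y / k z z = k z y.
    move=> Sy; have [h|n0] := eqVneq (k z z) 0; last by rewrite mulrAC mulfV // mul1r.
    by rewrite h !mul0r (psd_diag0 kP Sz Sy h).
  move=> x y; rewrite !inE big_ord_recl /=.
  case/predU1P => [->|xs]; case/predU1P => [->|ys].
  + by rewrite e // z1 // big1 ?addr0 // => i _; rewrite wz mul0r.
  + by rewrite e // ?z1 ?big1 ?addr0 //; [move=> i _; rewrite wz mul0r|exact: Ss'|exact: Ss'].
  + rewrite e // ?big1 ?addr0 //; last 2 first.
    * by move=> i _; rewrite wz mulr0.
    * exact: Ss'.
    have [h|n0] := eqVneq (k z z) 0; last by rewrite mulfK.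
    by rewrite h mulr0 mul0r (psd_sym kP (Ss' _ xs) Sz) (psd_diag0 kP Sz (Ss' _ xs) h).
  + rewrite e; [|exact: Ss'|exact: Ss'].
    by rewrite -w1 // addrC subrK.
- move=> x [|i] Sx x0; first by rewrite dg // mul0r.
  by apply: w2 => //; rewrite x0 dg // !mul0r subr0.
Qed.

Lemma qform_gram c (w : nat -> T -> R) n k2 k :
  (forall p q, p \in c -> q \in c ->
     k p.2 q.2 = \sum_(i < n) w i p.2 * w i q.2) ->
  qform (fun x y => k x y * k2 x y) c =
  \sum_(i < n) qform k2 [seq (p.1 * w i p.2, p.2) | p <- c].
Proof.
move=> kE; rewrite /qform.
under [RHS]eq_bigr do rewrite big_map.
rewrite [RHS]exchange_big /=; apply: eq_big_seq => p pc.
under [RHS]eq_bigr do rewrite big_map /=.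
rewrite [RHS]exchange_big /=; apply: eq_big_seq => q qc.
rewrite kE // mulr_suml mulr_sumr; apply: eq_bigr => i _; ring.
Qed.

Lemma psd_mul k1 k2 : psd k1 -> psd k2 -> psd (fun x y => k1 x y * k2 x y).
Proof.
move=> P1 P2; split.
  by move=> x y Sx Sy; rewrite (psd_sym P1) // (psd_sym P2).
move=> c Sc; have Ss x : x \in [seq p.2 | p <- c] -> S x.
  by case/mapP => p pc ->; exact: Sc.
have [w [w1 _]] := psd_cholesky P1 Ss.
rewrite (@qform_gram c w (size [seq p.2 | p <- c])).
  apply: sumr_ge0 => i _; apply: (psd_ge0 P2) => p /mapP[q qc ->] /=; exact: Sc.
by move=> p q pc qc; apply: w1; apply: map_f.
Qed.

(* Vybiral's strengthening of the Schur product theorem. *)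
Lemma psd_sqr_lower n k (x : 'I_n -> T) (c : 'I_n -> R) A :
  psd k -> (forall i, S (x i)) -> (forall i, k (x i) (x i) = A) ->
  (A * \sum_i c i) ^+ 2 <= n%:R * \sum_i \sum_j c i * c j * k (x i) (x j) ^+ 2.
Proof.
move=> kP Sx kd; pose s := [seq x i | i <- enum 'I_n].
have Ss y : y \in s -> S y by case/mapP => i _ ->.
have xs i : x i \in s by apply: map_f; rewrite mem_enum.
have [w [w1 _]] := psd_cholesky kP Ss.
have sn : size s = n by rewrite size_map -cardE card_ord.
rewrite sn in w1.
pose B (a b : 'I_n) := \sum_i c i * w a (x i) * w b (x i).
have -> : \sum_i \sum_j c i * c j * k (x i) (x j) ^+ 2 =
    \sum_(a < n) \sum_(b < n) B a b ^+ 2.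
  transitivity (\sum_i \sum_j \sum_(a < n) \sum_(b < n)
     (c i * w a (x i) * w b (x i)) * (c j * w a (x j) * w b (x j))).
    apply: eq_bigr => i _; apply: eq_bigr => j _.
    rewrite w1 // expr2 mulr_suml mulr_sumr; apply: eq_bigr => a _.
    rewrite mulr_sumr mulr_sumr; apply: eq_bigr => b _; ring.
  rewrite /B.
  under [RHS]eq_bigr do under eq_bigr do rewrite expr2 mulr_suml.
  under [RHS]eq_bigr do under eq_bigr do under eq_bigr do rewrite mulr_sumr.
  under [RHS]eq_bigr do rewrite exchange_big /=.
  rewrite [RHS]exchange_big /=; apply: eq_bigr => i _.
  under [RHS]eq_bigr do rewrite exchange_big /=.
  by rewrite [RHS]exchange_big.
have tr : A * \sum_i c i = \sum_(a < n) B a a.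
  rewrite mulr_sumr /B exchange_big; apply: eq_bigr => i _ /=.
  rewrite -(kd i) w1 // mulr_suml; apply: eq_bigr => a _; ring.
rewrite tr.
(* Off-diagonal squares are dropped; Cauchy-Schwarz of the diagonal against the all-ones vector
   comes from the squares (B a a + t)^2. *)
apply: (@le_trans _ _ (n%:R * \sum_(a < n) B a a ^+ 2)); last first.
  rewrite ler_wpM2l // ler_sum // => a _.
  by rewrite (bigD1 a) //= lerDl; apply: sumr_ge0 => b _; exact: sqr_ge0.
have -> : n%:R * \sum_(a < n) B a a ^+ 2 = (\sum_(a < n) B a a ^+ 2) * \sum_(a < n) 1.
  by rewrite sumr_const card_ord mulrC.
apply: quadratic_discr => [|t]; first by apply: sumr_ge0.
rewrite [2 * t * _]mulr_sumr [t ^+ 2 * _]mulr_sumr -!big_split /=.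
apply: sumr_ge0 => a _.
have -> : B a a ^+ 2 + 2 * t * B a a + t ^+ 2 * 1 = (B a a + t) ^+ 2 by ring.
exact: sqr_ge0.
Qed.

End PositiveDefinite.

Section PsdClosure.
Variables (R : realType) (T : eqType) (S : T -> Prop).
Implicit Types (k : T -> T -> R).

Lemma psd_cst (a : R) : 0 <= a -> psd S (fun _ _ : T => a).
Proof.
move=> a0; split=> // c _.
have -> : qform (fun _ _ : T => a) c = a * (\sum_(p <- c) p.1) ^+ 2.
  rewrite /qform expr2 mulr_suml mulr_sumr; apply: eq_bigr => p _.
  by rewrite mulrA mulr_sumr; apply: eq_bigr => q _; ring.
by rewrite mulr_ge0 ?sqr_ge0.
Qed.

Lemma psd_lin k1 k2 a : 0 <= a -> psd S k1 -> psd S k2 ->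
  psd S (fun x y => a * k1 x y + k2 x y).
Proof.
move=> a0 P1 P2; split; first by move=> x y Sx Sy; rewrite (psd_sym P1) // (psd_sym P2).
move=> c Sc.
have -> : qform (fun x y => a * k1 x y + k2 x y) c = a * qform k1 c + qform k2 c.
  rewrite /qform mulr_sumr -big_split; apply: eq_bigr => p _ /=.
  by rewrite mulr_sumr -big_split; apply: eq_bigr => q _ /=; ring.
by rewrite addr_ge0 ?mulr_ge0 // (psd_ge0 P1, psd_ge0 P2).
Qed.

Lemma psd_sum (a : nat -> R) (k : nat -> T -> T -> R) n :
  (forall i, 0 <= a i) -> (forall i, psd S (k i)) ->
  psd S (fun x y => \sum_(i < n) a i * k i x y).
Proof.
move=> a0 kP; elim: n => [|n IH].
  have -> : (fun x y => \sum_(i < 0) a i * k i x y) = (fun _ _ => 0).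
    by apply/funext => x; apply/funext => y; rewrite big_ord0.
  exact: psd_cst.
have -> : (fun x y => \sum_(i < n.+1) a i * k i x y) =
    (fun x y => a n * k n x y + \sum_(i < n) a i * k i x y).
  by apply/funext => x; apply/funext => y; rewrite big_ord_recr /= addrC.
exact: psd_lin.
Qed.

Lemma psd_limit k : 
  (forall e, 0 < e -> exists2 k', psd S k' &
     forall x y, S x -> S y -> `|k x y - k' x y| <= e) -> psd S k.
Proof.
move=> h; split.
- move=> x y Sx Sy; apply/eqP; rewrite -subr_eq0 -normr_eq0; apply/eqP.
  apply/le_anti; rewrite normr_ge0 andbT; apply/ler_addgt0Pr => e e0; rewrite add0r.
  have e2 : 0 < e / 2 by rewrite divr_gt0.
  have [k' P' hk] := h _ e2.
  have -> : k x y - k y x = (k x y - k' x y) - (k y x - k' y x).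
    by rewrite (psd_sym P' Sx Sy); ring.
  rewrite (le_trans (ler_normB _ _)) // (le_trans (lerD (hk _ _ Sx Sy) (hk _ _ Sy Sx))) //.
  by rewrite -splitr.
- move=> c Sc; set m := \sum_(p <- c) `|p.1|.
  have m0 : 0 <= m by apply: sumr_ge0.
  rewrite -oppr_le0; apply/ler_addgt0Pr => e e0; rewrite add0r.
  have e2 : 0 < e / (m ^+ 2 + 1) by rewrite divr_gt0 // ltr_wpDl ?sqr_ge0.
  have [k' P' hk] := h _ e2.
  have := psd_ge0 P' Sc => k0.
  have hq : `|qform k c - qform k' c| <= m ^+ 2 * (e / (m ^+ 2 + 1)).
    rewrite /qform -sumrB (le_trans (ler_norm_sum _ _ _)) //.
    rewrite expr2 -mulrA {1}/m mulr_suml big_seq [leRHS]big_seq.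
    apply: ler_sum => p pc; rewrite -sumrB (le_trans (ler_norm_sum _ _ _)) //.
    rewrite /m mulr_suml mulr_sumr big_seq [leRHS]big_seq; apply: ler_sum => q qc.
    rewrite -mulrBr !normrM mulrA ler_wpM2l ?mulr_ge0 //.
    by apply: hk; exact: Sc.
  have : m ^+ 2 * (e / (m ^+ 2 + 1)) <= e.
    rewrite mulrCA ger_pMr // ler_pdivrMr ?ltr_wpDl ?sqr_ge0 //.
    by rewrite mul1r lerDl.
  by move: hq; rewrite ler_norml => /andP[hq _]; lra.
Qed.

End PsdClosure.

(** * Linearization coefficients *)

Section Linearization.
Variables (R : realType) (d : nat).
Hypothesis d_ge2 : (2 <= d)%N.
Local Notation pt := (@pt R d).
Local Open Scope classical_set_scope.
Implicit Types (x y z : pt) (p q : {poly R}) (l s k : nat).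
Local Notation lam := ((d%:R - 1) / 2 : R).
Local Notation sph := (@sphereS R d).

Let d_gt0 : (0 < d)%N. Proof. exact: ltnW. Qed.

Let lam_gt0 : 0 < lam.
Proof. by rewrite divr_gt0 // subr_gt0 ltr1n. Qed.

Definition gn l : {poly R} := gnp lam l.
Definition wp p : R := wavg d (fun t => p.[t]).

Lemma GnormE l t : Gnorm d l t = (gn l).[t].
Proof. by rewrite /Gnorm /gn /gnp hornerZ horner_gegp mulrC. Qed.

Let lamd : 2 * lam + 1 = d%:R. Proof. by rewrite mulrC divfK // subrK. Qed.

Let HJ : moment_functional (2 * lam + 1) wp.
Proof. by rewrite lamd; exact: wavg_moment. Qed.

Lemma polar_wp p : polar d p = wp p.
Proof.
have := polar_moment R d_gt0; rewrite -lamd => HP.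
by apply: (moment_unique _ HP HJ); rewrite lamd ltr0n.
Qed.

Lemma gn_at1 l : (gn l).[1] = 1. Proof. exact: gnp1. Qed.

Lemma gn0 : gn 0 = 1. Proof. exact: gnp0. Qed.

Lemma wp_gn l : wp (gn l) = (l == 0%N)%:R. Proof. exact: moment_gnp. Qed.

Lemma gn_psd l : psd sph (fun x y => (gn l).[rdot x y]).
Proof.
split; first by move=> x y _ _; rewrite rdotC.
move=> c Sc; rewrite /qform.
have nE : d.+1%:R = 2 * lam + 2 :> R by rewrite -natr1; field.
have := gegenbauer_psd lam_gt0 l (s := [seq (u.1, (u.2 : pt) ord0) | u : R * pt <- c]) nE.
rewrite big_map /= => h.
have {}h : 0 <= \sum_(u <- c) \sum_(v <- c)
     u.1 * v.1 * gegenbauer lam l (rdot u.2 v.2).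
  apply: le_trans (h _) _; first by move=> q /mapP[p pc ->] /=; exact: (Sc _ pc).
  rewrite le_eqVlt; apply/orP; left; apply/eqP; apply: eq_bigr => p _.
  by rewrite big_map.
have g0 : 0 < (gegenbauer lam l 1)^-1 by rewrite invr_gt0 gegenbauer1_gt0.
rewrite -(pmulr_rge0 _ g0) in h; apply: le_trans h _.
rewrite le_eqVlt; apply/orP; left; apply/eqP; rewrite mulr_sumr.
apply: eq_bigr => p _; rewrite mulr_sumr; apply: eq_bigr => q _.
by rewrite /gn /gnp hornerZ horner_gegp; ring.
Qed.

(** Cauchy-Schwarz for a positive definite kernel with unit diagonal. *)
Lemma gn_le1 l x y : sph x -> sph y -> `|(gn l).[rdot x y]| <= 1.
Proof.
move=> x1 y1; rewrite -(@ler_pXn2r _ 2) ?nnegrE // expr1n real_normK ?num_real //.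
have := psd_CS1 (gn_psd l) x1 y1; rewrite /= x1 y1 !gn_at1 mulr1 //.
Qed.

(* Kernel herding: each new point is chosen where the sum of the previous
   kernel sections does not exceed its spherical mean by more than 1. *)
Lemma herding (K : pt -> pt -> R) (m C : R) :
  (forall x y, sph x -> sph y -> K x y = K y x) ->
  (forall x, sph x -> K x x <= C) -> (forall x, sph x -> sphf (K x)) ->
  (forall x, sph x -> sph_int (K x) = m) ->
  forall N, exists Y : seq pt, [/\ size Y = N, forall y, y \in Y -> sph y &
    \sum_(x <- Y) \sum_(y <- Y) K x y <= N%:R ^+ 2 * m + N%:R * (C + 2 - m)].
Proof.
move=> Ks KC Kf Km; elim=> [|N [Y [sY SY hY]]].
  by exists [::]; split => //; rewrite big_nil expr0n !mul0r addr0.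
(* The guard makes every summand an admissible integrand, also for indices off the sphere. *)
pose u y := \sum_(x <- Y) 1 * (if x \in Y then K x y else 0).
have hF x : sphf (fun y => if x \in Y then K x y else 0).
  by case xY: (x \in Y); [exact: Kf (SY _ xY)|exact: sphf0].
(* Otherwise [u] would exceed its own mean N m by 1 everywhere. *)
have [y [y1 uy]] : exists y, sph y /\ u y <= N%:R * m + 1.
  apply: contrapT => /forallNP h.
  have hle : N%:R * m + 1 <= sph_int u.
    rewrite -[leLHS](@sph_int_cst R d); apply: sph_int_le.
    - exact: sphf_cst.
    - exact: (sphf_sum _ _ hF).
    - by move=> x x1; have /not_andP[/(_ x1)[]|/negP] := h x; rewrite -ltNge => /ltW.
  move: hle; rewrite /u sph_int_sum // big_seq.
  rewrite (eq_bigr (fun _ => m)) => [|x xY]; last by rewrite mul1r xY (Km _ (SY _ xY)).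
  rewrite -big_seq big_const_seq count_predT sY iter_addr_0.
  by rewrite -[m *+ N]mulr_natl gerDl ler10.
exists (y :: Y); split; first by rewrite /= sY.
  by move=> z; rewrite inE => /predU1P[->|/SY].
have uE : u y = \sum_(x <- Y) K x y.
  by rewrite /u; apply: eq_big_seq => x xY; rewrite xY mul1r.
have -> : \sum_(x <- y :: Y) \sum_(z <- y :: Y) K x z =
   K y y + 2 * u y + \sum_(x <- Y) \sum_(z <- Y) K x z.
  have E : \sum_(x <- Y) \sum_(z <- y :: Y) K x z =
      u y + \sum_(x <- Y) \sum_(z <- Y) K x z.
    by rewrite uE -big_split; apply: eq_bigr => x _; rewrite big_cons.
  have E2 : \sum_(z <- Y) K y z = u y.
    by rewrite uE; apply: eq_big_seq => z zY; rewrite Ks //; exact: SY.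
  by rewrite big_cons E big_cons E2; ring.
(* The new point adds at most C + 2 (N m + 1), while (N + 1)^2 m - N^2 m = 2 N m + m; the excess per
   step is C + 2 - m. *)
have := KC _ y1; rewrite -natr1; move: uy hY; nra.
Qed.

Lemma psd_mean_ge0 p : psd sph (fun x y => p.[rdot x y]) -> 0 <= wp p.
Proof.
move=> pP; rewrite leNgt; apply/negP => m0.
have E0 (E : R) : exists N : nat, E < N%:R.
  by exists (Num.truncn E).+1; exact: truncnS_gt.
(* For such N the negative quadratic term of the herding bound outweighs the linear one. *)
have [N] := E0 ((p.[1] + 2 - wp p) / - wp p).
rewrite ltr_pdivrMr ?oppr_gt0 // => hN.
have [||x x1|x x1|Y [sY SY hY]] := @herding (fun x y => p.[rdot x y]) (wp p) p.[1] _ _ _ _ N.+1.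
- by move=> x y _ _; rewrite rdotC.
- by move=> x x1; rewrite x1.
- exact: sphf_poly.
- by rewrite sph_int_poly // polar_wp.
have := psd_ge0 pP (c := [seq (1, y) | y <- Y]).
rewrite /qform big_map => h.
have {}h : 0 <= \sum_(x <- Y) \sum_(y <- Y) p.[rdot x y].
  apply: le_trans (h _) _; first by move=> q /mapP[y yY ->]; exact: SY.
  rewrite le_eqVlt; apply/orP; left; apply/eqP; apply: eq_bigr => x _.
  by rewrite big_map; apply: eq_bigr => y _; rewrite /= !mul1r.
move: (le_trans h hY); rewrite expr2 -mulrA -mulrDr pmulr_rge0 ?ltr0Sn //.
rewrite leNgt => /negP; apply; rewrite -natr1; nra.
Qed.

Lemma CcoefE l s k : Ccoef R d l s k = wp (gn l * gn s * gn k) / wp (gn k ^+ 2).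
Proof.
rewrite /Ccoef /h2 /wp; congr (wavg d _ / wavg d _).
  by apply/funext => t; rewrite !hornerM !GnormE.
by apply/funext => t; rewrite horner_exp GnormE.
Qed.

Lemma Ccoef_ge0 l s k : 0 <= Ccoef R d l s k :> R.
Proof.
rewrite CcoefE divr_ge0 //; last exact/ltW/(gnp_norm_gt0 lam_gt0 HJ).
apply: psd_mean_ge0.
have := psd_mul (psd_mul (gn_psd l) (gn_psd s)) (gn_psd k).
suff -> : (fun x y : pt => (gn l * gn s * gn k).[rdot x y]) = 
  (fun x y : pt => (gn l).[rdot x y] * (gn s).[rdot x y] * (gn k).[rdot x y]) by [].
by apply/funext => x; apply/funext => y; rewrite !hornerM.
Qed.

Lemma gn_mul l s N : (l + s < N)%N ->
  gn l * gn s = \sum_(k < N) Ccoef R d l s k *: gn k.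
Proof.
move=> lsN; rewrite [LHS](gnp_expansion lam_gt0 HJ (N := N)).
  by apply: eq_bigr => k _; rewrite CcoefE.
rewrite (leq_trans (size_polyMleq _ _)) // /gn !size_gnp //.
by rewrite addSn addnS /= .
Qed.

(** The linearization evaluated at 1; with nonnegativity it bounds every coefficient by 1. *)
Lemma sum_Ccoef l s N : (l + s < N)%N -> \sum_(k < N) Ccoef R d l s k = 1 :> R.
Proof.
move=> lsN; have := congr1 (fun p => p.[1]) (gn_mul lsN).
rewrite hornerM !gn_at1 mulr1 horner_sum => ->.
by apply: eq_bigr => k _; rewrite hornerZ gn_at1 mulr1.
Qed.

End Linearization.

(** * Zonal kernels with summable coefficients *)

Section RSum.
Variable R : realType.
Local Open Scope classical_set_scope.
Implicit Types (a b : nat -> R) (L M : R).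

Definition psum a (n : nat) : R := \sum_(i < n) a i.

Lemma psumS a n : psum a n.+1 = psum a n + a n.
Proof. by rewrite /psum big_ord_recr. Qed.

Lemma psum_nondecreasing a : (forall i, 0 <= a i) -> nondecreasing_seq (psum a).
Proof. by move=> a0; apply/nondecreasing_seqP => n; rewrite psumS lerDl. Qed.

Lemma psum_cvg a M : (forall i, 0 <= a i) -> (forall n, psum a n <= M) -> cvgn (psum a).
Proof.
move=> a0 aM; apply: nondecreasing_is_cvgn; first exact: psum_nondecreasing.
by exists M => _ [n _ <-].
Qed.

Lemma rsum_le a M : (forall i, 0 <= a i) -> (forall n, psum a n <= M) -> rsum a <= M.
Proof.
move=> a0 aM; apply: limr_le; first exact: psum_cvg aM.
exact: nearW.
Qed.

Lemma psum_le_rsum a n : nonneg_l1 a -> psum a n <= rsum a.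
Proof.
by move=> [a0 ca]; apply: nondecreasing_cvgn_le => //; exact: psum_nondecreasing.
Qed.

Lemma psum_bound_l1 a M : (forall i, 0 <= a i) -> (forall n, psum a n <= M) -> nonneg_l1 a.
Proof. by move=> a0 aM; split => //; exact: psum_cvg aM. Qed.

Lemma rsum_tail a e : nonneg_l1 a -> 0 < e -> exists N, rsum a - psum a N < e.
Proof.
move=> al1 e0; have [a0 ca] := al1.
have /cvgrPdist_lt /(_ e e0) [N _ h] := ca.
exists N; have := h N (leqnn N); rewrite ger0_norm //.
by rewrite subr_ge0; exact: psum_le_rsum.
Qed.

Lemma rsum_eqP b L :
  (forall e, 0 < e -> exists N, forall n, (N <= n)%N -> `|L - psum b n| < e) ->
  cvgn (psum b) /\ rsum b = L.
Proof.
move=> h; have c : psum b @ \oo --> L.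
  by apply/cvgrPdist_lt => e /h [N hN]; exists N.
by split; [apply: cvgP c|exact: cvg_lim c].
Qed.

Lemma psum_diff a b n m : (forall i, `|b i| <= a i) -> (n <= m)%N ->
  `|psum b m - psum b n| <= psum a m - psum a n.
Proof.
move=> ba; elim: m => [|m IH]; first by rewrite leqn0 => /eqP ->; rewrite !subrr normr0.
rewrite leq_eqVlt => /predU1P[->|]; first by rewrite !subrr normr0.
rewrite ltnS => /IH h; rewrite !psumS ![_ + _ - _]addrAC.
by rewrite (le_trans (ler_normD _ _)) // lerD.
Qed.

Lemma dominated_cvg a b : nonneg_l1 a -> (forall i, `|b i| <= a i) -> cvgn (psum b).
Proof.
move=> al1 ba; have [a0 ca] := al1.
have c1 : cvgn (psum (fun i => a i + b i)).
  apply: (@psum_cvg _ (rsum a + rsum a)) => [i|n].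
    by rewrite -lerBlDl sub0r; have := ba i; rewrite ler_norml => /andP[].
  rewrite (@le_trans _ _ (psum a n + psum a n)) ?lerD ?psum_le_rsum //.
  rewrite /psum -big_split ler_sum // => i _; rewrite lerD2l.
  exact: le_trans (ler_norm _) (ba i).
have -> : psum b = (fun n => psum (fun i => a i + b i) n - psum a n).
  by apply/funext => n; rewrite /psum big_split /= addrAC subrr add0r.
exact: is_cvgB c1 ca.
Qed.

Lemma dominated_tail a b n : nonneg_l1 a -> (forall i, `|b i| <= a i) ->
  `|rsum b - psum b n| <= rsum a - psum a n.
Proof.
move=> al1 ba; have [a0 ca] := al1; have cb := dominated_cvg al1 ba.
have c : (fun m => `|psum b m - psum b n|) @ \oo --> `|rsum b - psum b n|.
  by apply: cvg_norm; apply: cvgB => //; exact: cvg_cst.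
rewrite -(cvg_lim _ c) //; apply: limr_le; first exact: cvgP c.
exists n => // m nm; rewrite /= (le_trans (psum_diff ba nm)) // lerD2r.
exact: psum_le_rsum.
Qed.

End RSum.

Section ZonalKernel.
Variables (R : realType) (d : nat).
Hypothesis d_ge2 : (2 <= d)%N.
Local Notation pt := (@pt R d).
Local Notation sph := (@sphereS R d).
Local Open Scope classical_set_scope.
Variable a : nat -> R.
Hypothesis al1 : nonneg_l1 a.
Implicit Types (x y : pt).

Let a0 i : 0 <= a i. Proof. by case: al1. Qed.

Let terms x y l := a l * (gn R d l).[rdot x y].

Let termsE x y : zkernel a x y = rsum (terms x y).
Proof.
rewrite /zkernel; congr rsum; apply/funext => l.
by rewrite GnormE.
Qed.

Let terms_le x y l : sph x -> sph y -> `|terms x y l| <= a l.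
Proof.
by move=> x1 y1; rewrite normrM ger0_norm // ler_piMr // gn_le1.
Qed.

Lemma zkernel_tail x y n : sph x -> sph y ->
  `|zkernel a x y - \sum_(l < n) a l * (gn R d l).[rdot x y]| <= rsum a - psum a n.
Proof.
by move=> x1 y1; rewrite termsE; apply: dominated_tail => // l; exact: terms_le.
Qed.

Lemma zkernelC x y : zkernel a x y = zkernel a y x.
Proof. by rewrite /zkernel rdotC. Qed.

Lemma zkernel_diag x : sph x -> zkernel a x x = rsum a.
Proof.
by move=> x1; rewrite termsE; congr rsum; apply/funext => l; rewrite /terms x1 gn_at1 ?mulr1.
Qed.

(** A uniform limit of the partial sums over degrees at least 1. This kernel of mean zero is the one
    to which herding is applied. *)
Lemma zkernel_sub0_psd : psd sph (fun x y => zkernel a x y - a 0%N).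
Proof.
apply: psd_limit => e e0; have [N hN] := rsum_tail al1 e0.
exists (fun x y => \sum_(l < N) a l.+1 * (gn R d l.+1).[rdot x y]).
  apply: (psd_sum (a := fun l => a l.+1) (k := fun l x y => (gn R d l.+1).[rdot x y])) => // i.
  exact: gn_psd.
move=> x y x1 y1; have := zkernel_tail N.+1 x1 y1.
rewrite big_ord_recl /= gn0 // hornerC mulr1 opprD addrA => /le_trans; apply.
by rewrite (le_trans _ (ltW hN)) // lerD2l lerN2 psumS lerDl.
Qed.

Lemma zkernel_psd : psd sph (fun x y => zkernel a x y).
Proof.
have := psd_lin ler01 zkernel_sub0_psd (psd_cst sph (a0 0)).
suff -> : (fun x y => 1 * (zkernel a x y - a 0%N) + a 0%N) = (fun x y => zkernel a x y) by [].
by apply/funext => x; apply/funext => y; rewrite mul1r subrK.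
Qed.

Lemma zkernel_sphf x : sph x -> sphf (zkernel a x).
Proof.
move=> x1.
(* A measurable limit needs convergence at every real t, but [gn] may be large off [-1, 1]; the cut
   leaves the values at inner products of unit vectors unchanged. *)
pose F l (t : R) := if `|(gn R d l).[t]| <= 1 then (gn R d l).[t] else 0.
have F1 l t : `|a l * F l t| <= a l.
  rewrite normrM ger0_norm // ler_piMr // /F.
  by case: ifP => [//|_]; rewrite normr0.
have mg l : measurable_fun setT (fun t : R => (gn R d l).[t]) by exact: measurable_horner.
have mF l : measurable_fun setT (fun t => a l * F l t).
  apply: measurable_funM; first exact: measurable_cst.
  apply: measurable_fun_ifT => //.
  apply: measurable_fun_ler; last exact: measurable_cst.
  exact: (measurableT_comp (f := fun x : R => `|x|)).
pose phi t := rsum (fun l => a l * F l t).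
have mphi : measurable_fun setT phi.
  apply: (@measurable_fun_cvg _ _ R setT (fun n t => psum (fun l => a l * F l t) n)).
  - by move=> n; apply: (@measurable_sum _ _ R setT 'I_n _ (fun i t => a i * F i t)).
  - move=> t _; exact: (dominated_cvg al1 (fun l => F1 l t)).
have h : sphf (fun y => phi (rdot x y)).
  apply: (borel_sphf (C := rsum a) (borel_rdot x mphi)) => y y1.
  have := dominated_tail 0 al1 (fun l => F1 l (rdot x y)).
  by rewrite /psum !big_ord0 !subr0.
apply: sphf_ext h => y y1; rewrite termsE /phi; congr rsum; apply/funext => l.
by rewrite /F gn_le1.
Qed.

Lemma zkernel_mean x : sph x -> sph_int (zkernel a x) = a 0%N.
Proof.
move=> x1; apply/eqP; rewrite -subr_eq0 -normr_eq0; apply/eqP.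
apply/le_anti; rewrite normr_ge0 andbT; apply/ler_addgt0Pr => e e0; rewrite add0r.
have [N hN] := rsum_tail al1 e0.
pose f y := \sum_(l < N.+1) a l * (gn R d l).[rdot x y].
have hf l : sphf (fun y => (gn R d l).[rdot x y]) by exact: sphf_poly.
have sf : sphf f by exact: (sphf_sum _ (fun l : 'I_N.+1 => a l)).
have If : sph_int f = a 0%N.
  rewrite /f (sph_int_sum _ (fun l : 'I_N.+1 => a l)) //.
  rewrite big_ord_recl /= sph_int_poly ?(ltnW d_ge2) // polar_wp // wp_gn // eqxx mulr1.
  rewrite big1 ?addr0 // => i _.
  by rewrite sph_int_poly ?(ltnW d_ge2) // polar_wp // wp_gn //= mulr0.
have eN : rsum a - psum a N.+1 <= e.
  by rewrite (le_trans _ (ltW hN)) // lerD2l lerN2 psumS lerDl.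
have tl y : sph y -> `|zkernel a x y - f y| <= e.
  by move=> y1; apply: le_trans eN; exact: zkernel_tail.
have sz := zkernel_sphf x1.
have bnd c : sphf (fun y => c + f y) /\ sph_int (fun y => c + f y) = c + a 0%N.
  have := sphf_lin 1 (sphf_cst d c) sf; have := sph_int_lin 1 (sphf_cst d c) sf.
  by rewrite If sph_int_cst !mul1r.
have [s1 e1] := bnd e; have [s2 e2] := bnd (- e).
have h1 : sph_int (zkernel a x) <= e + a 0%N.
  rewrite -e1; apply: sph_int_le => // y y1.
  by have := tl y y1; rewrite ler_norml => /andP[_ h]; rewrite -lerBlDr.
have h2 : - e + a 0%N <= sph_int (zkernel a x).
  rewrite -e2; apply: sph_int_le => // y y1.
  by have := tl y y1; rewrite ler_norml => /andP[h _]; rewrite -lerBrDr.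
by rewrite ler_norml lerBrDr h2 lerBlDr h1.
Qed.

End ZonalKernel.

(** * Convolution of coefficient sequences *)

Section DoubleSeries.
Variables (R : realType) (a : nat -> R) (c : nat -> nat -> R).
Hypothesis al1 : nonneg_l1 a.
Hypothesis c_bnd : forall l s, 0 <= c l s <= a l * a s.
Local Notation A := (rsum a).

Let a0 i : 0 <= a i. Proof. by case: al1. Qed.
Let A0 : 0 <= A. Proof. by have := psum_le_rsum 0 al1; rewrite /psum big_ord0. Qed.
Let c0 l s : 0 <= c l s. Proof. by case/andP: (c_bnd l s). Qed.
Let c1 l s : c l s <= a l * a s. Proof. by case/andP: (c_bnd l s). Qed.

Definition square_sum N : R := \sum_(l < N) \sum_(s < N) c l s.

Let row_psum l n : psum (c l) n <= a l * A.
Proof.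
apply: (@le_trans _ _ (a l * psum a n)); last by rewrite ler_wpM2l // psum_le_rsum.
by rewrite /psum mulr_sumr ler_sum.
Qed.

Let row_l1 l : nonneg_l1 (c l).
Proof. exact: (psum_bound_l1 (c0 l) (row_psum l)). Qed.

Let row_ge0 l : 0 <= rsum (c l).
Proof. by have := psum_le_rsum 0 (row_l1 l); rewrite /psum big_ord0. Qed.

Let row_le l : rsum (c l) <= a l * A.
Proof. exact: (rsum_le (c0 l) (row_psum l)). Qed.

Let row_split l N : rsum (c l) <= psum (c l) N + a l * (A - psum a N).
Proof.
have := dominated_tail N (a := fun s => a l * a s) (b := c l).
have e n : psum (fun s => a l * a s) n = a l * psum a n by rewrite /psum mulr_sumr.
have al : nonneg_l1 (fun s => a l * a s).
  apply: (psum_bound_l1 (M := a l * A)) => [s|n]; first by rewrite mulr_ge0.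
  by rewrite e ler_wpM2l // psum_le_rsum.
have rE : rsum (fun s => a l * a s) <= a l * A.
  apply: rsum_le => [s|n]; first by rewrite mulr_ge0.
  by rewrite e ler_wpM2l // psum_le_rsum.
move=> /(_ al) h; have {}h := h (fun s => _); rewrite e in h.
have {}h : `|rsum (c l) - psum (c l) N| <= rsum (fun s => a l * a s) - a l * psum a N.
  by apply: h => s; rewrite ger0_norm.
move: h; rewrite ler_norml => /andP[_ h].
rewrite -lerBlDl (le_trans h) // mulrBr lerD2r //.
Qed.

Let total_psum n : psum (fun l => rsum (c l)) n <= A * A.
Proof.
apply: (@le_trans _ _ (psum a n * A)); last by rewrite ler_wpM2r // psum_le_rsum.
by rewrite /psum mulr_suml ler_sum.
Qed.

Lemma square_sum_le N : square_sum N <= rsum (fun l => rsum (c l)).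
Proof.
apply: (@le_trans _ _ (psum (fun l => rsum (c l)) N)).
  by apply: ler_sum => l _; exact: psum_le_rsum.
exact/psum_le_rsum/(psum_bound_l1 row_ge0 total_psum).
Qed.

(** The error is the mass of a_l a_s outside the N by N square: rows below N lose at most P (A - P),
    later rows weigh at most (A - P) A, where P is [psum a N]. *)
Lemma square_sum_ge N :
  rsum (fun l => rsum (c l)) <= square_sum N + (A ^+ 2 - psum a N ^+ 2).
Proof.
have AN : psum a N <= A by exact: psum_le_rsum.
have hN : psum (fun l => rsum (c l)) N <= square_sum N + psum a N * (A - psum a N).
  rewrite [X in _ + X]mulr_suml -big_split /=.
  by apply: ler_sum => l _; exact: row_split.
apply: rsum_le => // n; have [nN|/ltnW Nn] := leqP n N.
  apply: (le_trans (psum_nondecreasing row_ge0 nN)); apply: (le_trans hN).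
  rewrite lerD2l; have : 0 <= psum a N by apply: sumr_ge0.
  move: AN A0; nra.
suff h : psum (fun l => rsum (c l)) n - psum (fun l => rsum (c l)) N <=
    (psum a n - psum a N) * A.
  have := psum_le_rsum n al1; move: hN h AN A0; nra.
have h := psum_diff (b := fun l => rsum (c l)) (a := fun l => a l * A).
have e m : psum (fun l => a l * A) m = psum a m * A by rewrite /psum mulr_suml.
rewrite mulrBl -!e; apply: le_trans (ler_norm _) _; apply: h => // l.
by rewrite ger0_norm.
Qed.

End DoubleSeries.

Section Convolution.
Variables (R : realType) (d : nat).
Hypothesis d_ge2 : (2 <= d)%N.
Local Notation pt := (@pt R d).
Local Notation sph := (@sphereS R d).
Variable a : nat -> R.
Hypothesis al1 : nonneg_l1 a.
Implicit Types (x y : pt).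
Local Notation A := (rsum a).
Local Notation la := (seqconv d a a).

Let a0 i : 0 <= a i. Proof. by case: al1. Qed.
Let A0 : 0 <= A. Proof. by have := psum_le_rsum 0 al1; rewrite /psum big_ord0. Qed.

Let c k l s := Ccoef R d l s k * a l * a s.

Let Ccoef_le1 l s k : Ccoef R d l s k <= 1.
Proof.
rewrite -(@sum_Ccoef R d d_ge2 l s (l + s + k).+1) ?ltnS ?leq_addr //.
have kN : (k < (l + s + k).+1)%N by rewrite ltnS leq_addl.
rewrite (bigD1 (Ordinal kN)) //= lerDl; apply: sumr_ge0 => i _.
exact: Ccoef_ge0.
Qed.

Let c_bnd k l s : 0 <= c k l s <= a l * a s.
Proof.
have C0 : 0 <= Ccoef R d l s k by exact: Ccoef_ge0.
have aa : 0 <= a l * a s by exact: mulr_ge0.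
by rewrite /c -mulrA mulr_ge0 //= ler_piMl.
Qed.

Local Notation sq k N := (square_sum (c k) N).

Let psum_la_aux K N : psum la K <= \sum_(k < K) sq k N + K%:R * (A ^+ 2 - psum a N ^+ 2).
Proof.
have -> : K%:R * (A ^+ 2 - psum a N ^+ 2) = \sum_(k < K) (A ^+ 2 - psum a N ^+ 2).
  by rewrite sumr_const card_ord mulr_natl.
by rewrite -big_split; apply: ler_sum => k _; exact: (square_sum_ge al1 (c_bnd k) N).
Qed.

(** For l, s < N the product has degree below 2 N, so all its linearization terms lie under K and
    the identity is finite and exact. *)
Let sum_sq_gn K N x y : (2 * N <= K)%N ->
  \sum_(k < K) sq k N * (gn R d k).[rdot x y] =
  (\sum_(l < N) a l * (gn R d l).[rdot x y]) ^+ 2.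
Proof.
move=> NK; rewrite expr2 mulr_suml.
under eq_bigr do rewrite mulr_suml.
rewrite exchange_big /=; apply: eq_bigr => l _.
under eq_bigr do rewrite mulr_suml.
rewrite exchange_big mulr_sumr /=; apply: eq_bigr => s _.
have lsK : (l + s < K)%N.
  apply: leq_trans NK; rewrite mul2n -addnn -addSn leq_add //; exact: ltnW.
transitivity (a l * a s * (gn R d l * gn R d s).[rdot x y]); last first.
  by rewrite hornerM; ring.
rewrite (gn_mul R d_ge2 lsK) horner_sum mulr_sumr; apply: eq_bigr => k _.
by rewrite (hornerZ (Ccoef R d l s k)) /c; ring.
Qed.

Let sum_sq K N : (2 * N <= K)%N -> \sum_(k < K) sq k N = psum a N ^+ 2.
Proof.
move=> NK; have x1 := ei_sphere R (ord0 : 'I_d.+1).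
have := sum_sq_gn (ei R ord0) (ei R ord0) NK; rewrite x1.
under eq_bigr do rewrite gn_at1 // mulr1.
by under [in RHS]eq_bigr do rewrite gn_at1 // mulr1.
Qed.

Let sum_sq_le K N : \sum_(k < K) sq k N <= A ^+ 2.
Proof.
apply: (@le_trans _ _ (\sum_(k < K + 2 * N) sq k N)).
  rewrite big_split_ord /= lerDl; apply: sumr_ge0 => k _.
  by apply: sumr_ge0 => l _; apply: sumr_ge0 => s _; case/andP: (c_bnd (K + k) l s).
rewrite sum_sq ?leq_addl // lerXn2r ?nnegrE //; last exact: psum_le_rsum.
by apply: sumr_ge0.
Qed.

Lemma seqconv_ge0 k : 0 <= la k.
Proof.
by have := square_sum_le al1 (c_bnd k) 0; rewrite /square_sum big_ord0.
Qed.

Let sq_gap N : A ^+ 2 - psum a N ^+ 2 <= 2 * A * (A - psum a N).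
Proof.
have h := psum_le_rsum N al1.
have : 0 <= psum a N by apply: sumr_ge0.
by move: h A0; nra.
Qed.

(** K is fixed while N grows: the K truncation errors of [psum_la_aux] vanish together. *)
Lemma psum_seqconv_le K : psum la K <= A ^+ 2.
Proof.
apply/ler_addgt0Pr => e e0.
have e' : 0 < e / (K%:R * (2 * A) + 1).
  by rewrite divr_gt0 // ltr_wpDl // !mulr_ge0.
have [N hN] := rsum_tail al1 e'.
apply: le_trans (psum_la_aux K N) _; rewrite lerD //.
apply: (@le_trans _ _ (K%:R * (2 * A * (A - psum a N)))).
  by rewrite ler_wpM2l // sq_gap.
rewrite mulrA; apply: (@le_trans _ _ (K%:R * (2 * A) * (e / (K%:R * (2 * A) + 1)))).
  by rewrite ler_wpM2l ?mulr_ge0 // ltW.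
rewrite mulrCA ger_pMr // ler_pdivrMr ?ltr_wpDl ?mulr_ge0 //.
by rewrite mul1r lerDl.
Qed.

(** The three nested series are interchanged through finite squares: the square [B ^+ 2] of a
    truncated kernel is compared with the squared kernel on one side and with the partial sum of the
    convolved series on the other. *)
Lemma seqconv_zkernel x y : sph x -> sph y ->
  cvgn (psum (fun k => la k * (gn R d k).[rdot x y])) /\
  rsum (fun k => la k * (gn R d k).[rdot x y]) = zkernel a x y ^+ 2.
Proof.
move=> x1 y1; apply: rsum_eqP => e e0.
have e' : 0 < e / (4 * A + 1) by rewrite divr_gt0 // ltr_wpDl // mulr_ge0.
have [N hN] := rsum_tail al1 e'; exists (2 * N)%N => K NK.
set B := \sum_(l < N) a l * (gn R d l).[rdot x y].
set M := zkernel a x y.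
have hMB : `|M - B| <= A - psum a N by exact: zkernel_tail.
have hM : `|M| <= A.
  by have := zkernel_tail d_ge2 al1 0 x1 y1; rewrite /psum !big_ord0 !subr0.
have hB : `|B| <= A.
  apply: (@le_trans _ _ (psum a N)); last exact: psum_le_rsum.
  rewrite (le_trans (ler_norm_sum _ _ _)) // ler_sum // => l _.
  by rewrite normrM ger0_norm // ler_piMr // gn_le1.
have h1 : `|M ^+ 2 - B ^+ 2| <= 2 * A * (A - psum a N).
  rewrite subr_sqr normrM mulrC ler_pM //.
  by rewrite (le_trans (ler_normD _ _)) // mulr_natl mulr2n lerD.
have h2 : `|B ^+ 2 - psum (fun k => la k * (gn R d k).[rdot x y]) K| <= 2 * A * (A - psum a N).
  rewrite -(sum_sq_gn x y NK) /psum -sumrB (le_trans (ler_norm_sum _ _ _)) //.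
  (* Each [la k] dominates [sq k N] and each G_k is at most 1, so the error is at most the
     difference of total masses. *)
  apply: (@le_trans _ _ (\sum_(k < K) (la k - sq k N))).
    apply: ler_sum => k _.
    have hk : 0 <= la k - sq k N by rewrite subr_ge0 (square_sum_le al1 (c_bnd k) N).
    by rewrite -mulrBl normrM distrC (ger0_norm hk) ler_piMr // gn_le1.
  rewrite sumrB sum_sq // (le_trans _ (sq_gap N)) // lerD2r.
  exact: psum_seqconv_le.
have -> : M ^+ 2 - psum (fun k => la k * (gn R d k).[rdot x y]) K =
  (M ^+ 2 - B ^+ 2) + (B ^+ 2 - psum (fun k => la k * (gn R d k).[rdot x y]) K) by ring.
apply: (le_lt_trans (ler_normD _ _)); apply: (le_lt_trans (lerD h1 h2)).
have -> : 2 * A * (A - psum a N) + 2 * A * (A - psum a N) = 4 * A * (A - psum a N) by ring.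
have [->|An] := eqVneq A 0; first by rewrite mulr0 mul0r.
have Ap : 0 < 4 * A by rewrite mulr_gt0 // lt_neqAle eq_sym An.
apply: (@lt_trans _ _ (4 * A * (e / (4 * A + 1)))); first by rewrite ltr_pM2l.
by rewrite mulrCA gtr_pMr // ltr_pdivrMr ?addr_gt0 // mul1r ltrDl.
Qed.

End Convolution.

(** * Lower bound for the worst-case error *)

Section WorstCase.
Variables (R : realType) (d : nat).
Hypothesis d_ge2 : (2 <= d)%N.
Local Notation pt := (@pt R d).
Local Notation sph := (@sphereS R d).
Local Open Scope classical_set_scope.
Variable a : nat -> R.
Hypothesis al1 : nonneg_l1 a.
Implicit Types (x y : pt) (g : seq (R * pt)).

Let a0 i : 0 <= a i. Proof. by case: al1. Qed.

Definition on_sphere g := forall p, p \in g -> sph p.2.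

Lemma kcomb_mean g : on_sphere g ->
  sphf (kcomb a g) /\ sph_int (kcomb a g) = a 0%N * \sum_(p <- g) p.1.
Proof.
elim: g => [_|p g IH Sg].
  have e x : 0 = kcomb a [::] x by rewrite /kcomb big_nil.
  split; first by apply: sphf_ext (sphf0 R d) => x _.
  by rewrite big_nil mulr0 -[RHS](@sph_int_cst R d); apply: sph_int_ext => x _; rewrite -e.
have [|sg Ig] := IH; first by move=> q qg; apply: Sg; rewrite inE qg orbT.
have Sp : sph p.2 by apply: Sg; rewrite mem_head.
have e x : p.1 * zkernel a p.2 x + kcomb a g x = kcomb a (p :: g) x.
  by rewrite /kcomb big_cons.
have sz := zkernel_sphf d_ge2 al1 Sp; split.
  by apply: sphf_ext (sphf_lin p.1 sz sg) => x _.
rewrite big_cons mulrDr -Ig [a 0%N * _]mulrC -(zkernel_mean d_ge2 al1 Sp).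
by rewrite -(sph_int_lin _ sz sg); apply: sph_int_ext => x _; rewrite -e.
Qed.

Lemma kcomb_ball g : on_sphere g -> knorm2 a g <= 1 -> rkhs_ball a (kcomb a g).
Proof.
move=> Sg g1; exists (fun=> g); split; first by move=> _ p; exact: Sg.
split; first by move=> x _; exact: cvg_cst.
split; last by rewrite lim_cst.
move=> e e0; exists 0%N => m n _ _.
rewrite (_ : knorm2 a _ = 0) // /knorm2 big1 // => p _.
rewrite /csub big_cat /= big_map /= -big_split big1 // => q _ /=.
by rewrite mulrN mulNr subrr.
Qed.

Definition scale_comb (t : R) g := [seq (t * p.1, p.2) | p <- g].

Lemma kcomb_scale t g x : kcomb a (scale_comb t g) x = t * kcomb a g x.
Proof. by rewrite /kcomb big_map mulr_sumr; apply: eq_bigr => p _; rewrite mulrA. Qed.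

Lemma on_sphere_scale t g : on_sphere g -> on_sphere (scale_comb t g).
Proof. by move=> Sg q /mapP[p pg ->]; exact: Sg pg. Qed.

Variables (n : nat) (c : 'I_n -> R) (x : 'I_n -> pt).
Hypothesis Sx : forall j, sph (x j).

Definition quad_err (f : pt -> R) : R := sph_int f - \sum_(j < n) c j * f (x j).

Lemma quad_err_scale t g : on_sphere g ->
  quad_err (kcomb a (scale_comb t g)) = t * quad_err (kcomb a g).
Proof.
move=> Sg; rewrite /quad_err mulrBr; congr (_ - _).
  rewrite !(kcomb_mean _).2 //; last exact: on_sphere_scale.
  by rewrite big_map -mulr_sumr; ring.
by rewrite mulr_sumr; apply: eq_bigr => j _; rewrite kcomb_scale; ring.
Qed.

Lemma wce_ge0 : (0 <= wce a c x)%E.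
Proof.
apply: (@le_trans _ _ (`|quad_err (kcomb a [::])|)%:E); first by rewrite lee_fin.
apply: ereal_sup_ubound; exists (kcomb a [::]) => //; apply: kcomb_ball => //.
by rewrite /knorm2 big_nil.
Qed.

(** Scaling by p^(-1/2) puts the combination in the unit ball. A positive upper bound [p] of the
    squared norm allows the division and suits a norm known only approximately. *)
Lemma quad_err_le w g p : (wce a c x <= w%:E)%E -> on_sphere g ->
  0 < p -> knorm2 a g <= p -> quad_err (kcomb a g) ^+ 2 <= w ^+ 2 * p.
Proof.
move=> hw Sg p0 gp; set t := (Num.sqrt p)^-1.
have t0 : 0 < t by rewrite invr_gt0 sqrtr_gt0.
have t2 : t ^+ 2 * p = 1 by rewrite exprVn sqr_sqrtr ?mulVf ?gt_eqF // ltW.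
have kb : rkhs_ball a (kcomb a (scale_comb t g)).
  apply: kcomb_ball; first exact: on_sphere_scale.
  have -> : knorm2 a (scale_comb t g) = t ^+ 2 * knorm2 a g.
    exact: (qform_scale (fun x y : pt => zkernel a x y)).
  by rewrite -t2 ler_wpM2l // sqr_ge0.
have : (`|quad_err (kcomb a (scale_comb t g))|%:E <= w%:E)%E.
  by apply: le_trans hw; apply: ereal_sup_ubound; exists (kcomb a (scale_comb t g)).
rewrite lee_fin quad_err_scale // normrM (gtr0_norm t0) => h.
have h2 : (t * `|quad_err (kcomb a g)|) ^+ 2 <= w ^+ 2.
  have th0 : 0 <= t * `|quad_err (kcomb a g)| by rewrite mulr_ge0 // ltW.
  by apply: lerXn2r => //; rewrite nnegrE // (le_trans th0).
have := ler_wpM2r (ltW p0) h2.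
by rewrite exprMn mulrAC t2 mul1r real_normK ?num_real.
Qed.

Let s := \sum_j c j.
Let Q := \sum_i \sum_j c i * c j * zkernel a (x i) (x j).
Let E := a 0%N - 2 * a 0%N * s + Q.
Let K' y z := zkernel a y z - a 0%N.

Let K'P : psd sph K'. Proof. exact: zkernel_sub0_psd. Qed.

(* Approximation of the representer of [f |-> quad_err f]: the mean is replaced by
   the equal-weight rule on herded points [Y]. *)
Let comb (Y : seq pt) : seq (R * pt) :=
  [seq ((size Y)%:R^-1, y) | y <- Y] ++ [seq (- c j, x j) | j <- index_enum 'I_n].
Let cross (Y : seq pt) : R :=
  - \sum_j c j * \sum_(y <- Y) (size Y)%:R^-1 * K' (x j) y.
Let self (Y : seq pt) : R := qform K' [seq ((size Y)%:R^-1, y) | y <- Y].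

Let comb_sum Y : (0 < size Y)%N -> \sum_(p <- comb Y) p.1 = 1 - s.
Proof.
move=> Y0; rewrite big_cat !big_map /= /= sumrN; congr (_ - _).
rewrite big_const_seq count_predT iter_addr_0 -[LHS]mulr_natr mulVf //.
by rewrite pnatr_eq0 -lt0n.
Qed.

Let comb_sphere Y : (forall y, y \in Y -> sph y) -> on_sphere (comb Y).
Proof.
move=> SY p; rewrite mem_cat => /orP[/mapP[y yY ->]|/mapP[j _ ->]]; first exact: SY.
exact: Sx.
Qed.

Let Q'E : \sum_i \sum_j c i * c j * K' (x i) (x j) = Q - a 0%N * s ^+ 2.
Proof.
rewrite /Q /s expr2 mulr_suml mulr_sumr -sumrB; apply: eq_bigr => i _.
rewrite mulr_sumr mulr_sumr -sumrB; apply: eq_bigr => j _.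
by rewrite /K'; ring.
Qed.

Let comb_norm Y : (0 < size Y)%N -> (forall y, y \in Y -> sph y) ->
  knorm2 a (comb Y) = E + self Y + 2 * cross Y.
Proof.
move=> Y0 SY.
have -> : knorm2 a (comb Y) = qform K' (comb Y) + a 0%N * (\sum_(p <- comb Y) p.1) ^+ 2.
  rewrite /knorm2 /qform expr2 mulr_suml mulr_sumr -big_split; apply: eq_bigr => p _ /=.
  rewrite mulr_sumr mulr_sumr -big_split; apply: eq_bigr => q _ /=.
  by rewrite /K'; ring.
rewrite comb_sum // /qform /comb big_cat /=.
have cr : \sum_(p <- [seq ((size Y)%:R^-1, y) | y <- Y])
   \sum_(q <- [seq (- c j, x j) | j <- index_enum 'I_n]) p.1 * q.1 * K' p.2 q.2 = cross Y.
  rewrite /cross big_map.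
  under eq_bigr do rewrite big_map /=.
  rewrite exchange_big -sumrN; apply: eq_bigr => j _ /=.
  rewrite mulr_sumr -sumrN; apply: eq_big_seq => y yY.
  by rewrite (psd_sym K'P (SY _ yY) (Sx j)); ring.
have cr' : \sum_(q <- [seq (- c j, x j) | j <- index_enum 'I_n])
   \sum_(p <- [seq ((size Y)%:R^-1, y) | y <- Y]) q.1 * p.1 * K' q.2 p.2 = cross Y.
  rewrite /cross big_map /= -sumrN; apply: eq_bigr => j _.
  rewrite big_map mulr_sumr -sumrN; apply: eq_bigr => y _ /=; ring.
have qq : \sum_(p <- [seq (- c j, x j) | j <- index_enum 'I_n])
   \sum_(q <- [seq (- c j, x j) | j <- index_enum 'I_n]) p.1 * q.1 * K' p.2 q.2 =
   Q - a 0%N * s ^+ 2.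
  rewrite -Q'E big_map /=; apply: eq_bigr => i _.
  by rewrite big_map /=; apply: eq_bigr => j _; rewrite mulrNN.
have sp u (w1 w2 : seq (R * pt)) : \sum_(p <- w1) \sum_(q <- w2 ++ u) p.1 * q.1 * K' p.2 q.2 =
   \sum_(p <- w1) \sum_(q <- w2) p.1 * q.1 * K' p.2 q.2 +
   \sum_(p <- w1) \sum_(q <- u) p.1 * q.1 * K' p.2 q.2.
  by rewrite -big_split; apply: eq_bigr => p _; rewrite big_cat.
by rewrite !sp cr cr' qq /self /qform /E; ring.
Qed.

(** As for the exact representer, the error on [comb Y] and its squared norm agree, both being [E],
    up to [self] and [cross]. *)
Let comb_err Y : (0 < size Y)%N -> (forall y, y \in Y -> sph y) ->
  quad_err (kcomb a (comb Y)) = E + cross Y.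
Proof.
move=> Y0 SY; rewrite /quad_err (kcomb_mean (comb_sphere SY)).2 comb_sum //.
have -> : \sum_(j < n) c j * kcomb a (comb Y) (x j) =
   a 0%N * (1 - s) * s - cross Y - (Q - a 0%N * s ^+ 2).
  have e j : kcomb a (comb Y) (x j) = a 0%N * (1 - s) +
     \sum_(y <- Y) (size Y)%:R^-1 * K' (x j) y - \sum_i c i * K' (x i) (x j).
    rewrite -(comb_sum Y0) mulr_sumr /kcomb !big_cat /= !big_map /=.
    have -> : \sum_(j0 <- Y) (size Y)%:R^-1 * zkernel a j0 (x j) =
      \sum_(y <- Y) a 0%N * (size Y)%:R^-1 + \sum_(y <- Y) (size Y)%:R^-1 * K' (x j) y.
      rewrite -big_split; apply: eq_bigr => y _ /=.
      by rewrite /K' zkernelC; ring.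
    have -> : \sum_i - c i * zkernel a (x i) (x j) =
      \sum_i a 0%N * - c i - \sum_i c i * K' (x i) (x j).
      by rewrite -sumrB; apply: eq_bigr => i _; rewrite /K'; ring.
    ring.
  under eq_bigr do rewrite e mulrBr mulrDr.
  rewrite sumrB big_split /= -mulr_suml -Q'E /cross opprK [s * _]mulrC.
  congr (_ - _); rewrite exchange_big; apply: eq_bigr => j _ /=.
  by rewrite mulr_sumr; apply: eq_bigr => i _; ring.
by rewrite /E; ring.
Qed.

Let C := rsum a - a 0%N.

Let C0 : 0 <= C.
Proof.
by rewrite subr_ge0; have := psum_le_rsum 1 al1; rewrite /psum big_ord1.
Qed.

Let K'_sphf y : sph y -> sphf (K' y) /\ sph_int (K' y) = 0.
Proof.
move=> y1; have sz := zkernel_sphf d_ge2 al1 y1.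
have := sphf_lin 1 sz (sphf_cst d (- a 0%N)).
have := sph_int_lin 1 sz (sphf_cst d (- a 0%N)).
rewrite sph_int_cst (zkernel_mean d_ge2 al1 y1) mul1r subrr => h1 h2; split.
  by apply: sphf_ext h2 => z _; rewrite mul1r.
by rewrite -[RHS]h1; apply: sph_int_ext => z _; rewrite mul1r.
Qed.

Let herded e : 0 < e -> exists Y : seq pt,
  [/\ (0 < size Y)%N, forall y, y \in Y -> sph y, self Y <= e & `|cross Y| <= e].
Proof.
move=> e0; set m1 := \sum_j `|c j|.
have m0 : 0 <= m1 by exact: sumr_ge0.
pose r := e / (m1 + 1).
have r0 : 0 < r by rewrite divr_gt0 // ltr_wpDl.
(* The first term gives [self Y] <= (C + 2) / N <= e. The second bounds the inner sum of [cross] at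
   each node by r, through Cauchy-Schwarz; weighted by the |c_j| these add up to at most m1 r <=
   e. *)
pose B := (C + 2) / e + (C + 2) ^+ 2 / r ^+ 2.
have C2 : 0 < C + 2 by rewrite ltr_wpDl.
pose N := (Num.truncn B).+1.
have hN : B < N%:R by exact: truncnS_gt.
have Np : 0 < N%:R :> R by rewrite ltr0n.
have B1 : (C + 2) / e <= N%:R.
  by rewrite (le_trans _ (ltW hN)) // lerDl divr_ge0 ?sqr_ge0.
have B2 : (C + 2) ^+ 2 / r ^+ 2 <= N%:R.
  by rewrite (le_trans _ (ltW hN)) // lerDr divr_ge0 // ltW.
have KC y : sph y -> K' y y <= C by move=> y1; rewrite /K' (zkernel_diag d_ge2).
have [Y [sY SY hY]] := herding (psd_sym K'P) KC (fun y h => (K'_sphf h).1)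
  (fun y h => (K'_sphf h).2) N.
have selfE : self Y <= (C + 2) / N%:R.
  rewrite mulr0 add0r subr0 in hY.
  have -> : self Y = N%:R ^- 2 * \sum_(y <- Y) \sum_(z <- Y) K' y z.
    rewrite /self /qform sY big_map mulr_sumr; apply: eq_bigr => y _.
    by rewrite big_map mulr_sumr; apply: eq_bigr => z _ /=; rewrite -exprVn expr2.
  rewrite mulrC ler_pdivrMr ?exprn_gt0 // (le_trans hY) //.
  by rewrite expr2 mulrA divfK ?gt_eqF // mulrC.
exists Y; split=> //; first by rewrite sY.
  rewrite (le_trans selfE) // ler_pdivrMr // mulrC -ler_pdivrMr //.
have tj j : `|\sum_(y <- Y) (size Y)%:R^-1 * K' (x j) y| <= r.
  have := psd_CS K'P (Sx j) (c := [seq ((size Y)%:R^-1, y) | y <- Y]).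
  rewrite big_map /= => h; have {}h := h _.
  rewrite -(@ler_pXn2r _ 2) ?nnegrE // ?(ltW r0) // real_normK ?num_real //.
  apply: le_trans (h _) _; first by move=> p /mapP[y yY ->]; exact: SY.
  apply: (@le_trans _ _ ((C + 2) / N%:R * (C + 2))).
    rewrite ler_pM //; [|exact: psd_diag_ge0 K'P (Sx j)|].
      by apply: (psd_ge0 K'P) => p /mapP[y yY ->]; exact: SY.
    by rewrite (le_trans (KC _ (Sx j))) // lerDl.
  by rewrite mulrAC -expr2 ler_pdivrMr // [r ^+ 2 * _]mulrC -ler_pdivrMr // exprn_gt0.
rewrite normrN (le_trans (ler_norm_sum _ _ _)) //.
apply: (@le_trans _ _ (m1 * r)).
  rewrite mulr_suml ler_sum // => j _; rewrite normrM ler_wpM2l //.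
by rewrite mulrCA ger_pMr // ler_pdivrMr ?ltr_wpDl // mul1r lerDl.
Qed.

(** At the exact representer error and squared norm would both be E, giving E^2 <= w^2 E; this is
    reached up to every e. *)
Lemma wce_sqr_ge w : 0 < E -> 0 <= w -> (wce a c x <= w%:E)%E -> E <= w ^+ 2.
Proof.
move=> E0 w0 hw; rewrite -(ler_pM2r E0) -expr2.
apply/ler_addgt0Pr => e e0.
(* From E^2 - 2 E h <= (E + cross)^2 <= w^2 (E + 3 h) the total loss is (2 E + 3 w^2) h, at most
   e. *)
pose h := e / (2 * E + 3 * w ^+ 2 + 1).
have D0 : 0 <= 2 * E + 3 * w ^+ 2 by rewrite addr_ge0 // mulr_ge0 ?sqr_ge0 // ltW.
have h0 : 0 < h by rewrite divr_gt0 // ltr_wpDl.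
have [Y [Y0 SY hs hc]] := herded h0.
have hn : knorm2 a (comb Y) <= E + 3 * h.
  rewrite comb_norm //; move: hc; rewrite ler_norml => /andP[_ hc].
  by move: hs hc; lra.
have p0 : 0 < E + 3 * h by rewrite addr_gt0 // mulr_gt0.
have := quad_err_le hw (comb_sphere SY) p0 hn; rewrite comb_err // => q.
have hc2 : E ^+ 2 - 2 * E * h <= (E + cross Y) ^+ 2.
  move: hc; rewrite ler_norml => /andP[hc _]; have := sqr_ge0 (cross Y).
  have hch : 0 <= cross Y + h by rewrite -lerBlDr sub0r.
  have := mulr_ge0 (ltW E0) hch.
  by nra.
have he : (2 * E + 3 * w ^+ 2) * h <= e.
  by rewrite mulrCA ger_pMr // ler_pdivrMr ?ltr_wpDl // mul1r lerDl.
by move: (le_trans hc2 q) he; lra.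
Qed.

End WorstCase.

(** * Kernels that are sums of two squares, and the final bound *)

Section SumOfSquares.
Variables (R : realType) (d : nat).
Hypothesis d_ge2 : (2 <= d)%N.
Local Notation sph := (@sphereS R d).
Local Open Scope classical_set_scope.
Variables mu nu : nat -> R.
Hypotheses (mul1 : nonneg_l1 mu) (nul1 : nonneg_l1 nu).

Definition sqlam k := seqconv d mu mu k + seqconv d nu nu k.

Lemma sqlam_l1 : nonneg_l1 sqlam.
Proof.
apply: (psum_bound_l1 (M := rsum mu ^+ 2 + rsum nu ^+ 2)) => [k|K].
  by rewrite addr_ge0 // seqconv_ge0.
by rewrite /psum big_split lerD //; exact: psum_seqconv_le.
Qed.

Lemma sqlam_zkernel x y : sph x -> sph y ->
  zkernel sqlam x y = zkernel mu x y ^+ 2 + zkernel nu x y ^+ 2.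
Proof.
move=> x1 y1; have [c1 <-] := seqconv_zkernel d_ge2 mul1 x1 y1.
have [c2 <-] := seqconv_zkernel d_ge2 nul1 x1 y1.
apply: (etrans _ (limD c1 c2)); congr (limn _); apply/funext => n /=.
rewrite /GRing.add /= -[RHS]big_split; apply: eq_bigr => k _ /=.
by rewrite /sqlam mulrDl GnormE.
Qed.

Lemma rsum_sqlam : rsum sqlam = rsum mu ^+ 2 + rsum nu ^+ 2.
Proof.
have e1 := ei_sphere R (ord0 : 'I_d.+1).
rewrite -(zkernel_diag d_ge2 sqlam e1) sqlam_zkernel //.
by rewrite !(zkernel_diag d_ge2 _ e1).
Qed.

(** Vybiral's inequality for the two kernels separately, with diagonals [rsum mu] and [rsum nu];
    their squares add up to [rsum sqlam]. *)
Lemma sqlam_quadratic n (c : 'I_n -> R) (x : 'I_n -> pt R d) :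
  (forall j, sph (x j)) ->
  rsum sqlam * (\sum_i c i) ^+ 2 <=
    n%:R * \sum_i \sum_j c i * c j * zkernel sqlam (x i) (x j).
Proof.
move=> Sx.
have h (a : nat -> R) (al1 : nonneg_l1 a) : (rsum a * \sum_i c i) ^+ 2 <=
    n%:R * \sum_i \sum_j c i * c j * zkernel a (x i) (x j) ^+ 2.
  by apply: (psd_sqr_lower c (zkernel_psd d_ge2 al1) Sx) => i; exact: zkernel_diag.
rewrite rsum_sqlam mulrDl -!exprMn (le_trans (lerD (h _ mul1) (h _ nul1))) //.
rewrite -mulrDr ler_wpM2l // -big_split ler_sum // => i _ /=.
rewrite -big_split ler_sum // => j _ /=.
by rewrite sqlam_zkernel // mulrDr.
Qed.

End SumOfSquares.

Theorem theorem4p2 (R : realType) (d : nat) (mu nu : nat -> R) :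
  (2 <= d)%N -> nonneg_l1 mu -> nonneg_l1 nu ->
  let lam : nat -> R := fun k => seqconv d mu mu k + seqconv d nu nu k in
  0 < rsum lam ->
  forall n : nat, (0 < n)%N ->
  ((lam 0%N * (1 - n%:R * lam 0%N / rsum lam))%:E
     <= e_opt d n lam * e_opt d n lam)%E.
Proof.
move=> d2 mu1 nu1 lam L0 n n0; set T := lam 0%N * _.
have lam1 : nonneg_l1 lam by exact: sqlam_l1.
have np : 0 < n%:R :> R by rewrite ltr0n.
(* Bounding the infimum by a root before squaring treats an infinite infimum uniformly; for T <= 0
   the root is 0. *)
have key : ((Num.sqrt T)%:E <= e_opt d n lam)%E.
  apply: le_ereal_inf_tmp => _ [c _ [x Sx <-]].
  have w0 : (0 <= wce lam c x)%E by exact: wce_ge0.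
  have [T0|T0] := leP T 0; first by rewrite ler0_sqrtr.
  pose s := \sum_j c j.
  pose Q := \sum_i \sum_j c i * c j * zkernel lam (x i) (x j).
  pose E := lam 0%N - 2 * lam 0%N * s + Q.
  have hQ : rsum lam * s ^+ 2 <= n%:R * Q := sqlam_quadratic d2 mu1 nu1 c Sx.
  have TE : T <= E.
    rewrite -(ler_pM2l np) -(ler_pM2l L0) -subr_ge0.
    (* Completing the square in [s], whose optimum is n l0 / L, turns E - T into the excess in [hQ]
       plus a square. *)
    have -> : rsum lam * (n%:R * E) - rsum lam * (n%:R * T) =
      rsum lam * (n%:R * Q - rsum lam * s ^+ 2) + (rsum lam * s - n%:R * lam 0%N) ^+ 2.
      by rewrite /E /T; field; rewrite gt_eqF.
    by rewrite addr_ge0 ?sqr_ge0 // mulr_ge0 ?subr_ge0 // ltW.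
  have E0 : 0 < E by exact: lt_le_trans TE.
  case wE : (wce lam c x) w0 => [w||] // w0; last by rewrite leey.
  rewrite lee_fin in w0; rewrite lee_fin.
  have wle : (wce lam c x <= w%:E)%E by rewrite wE.
  have := wce_sqr_ge d2 lam1 Sx E0 w0 wle => h.
  rewrite -(@ler_pXn2r _ 2) ?nnegrE ?sqrtr_ge0 // sqr_sqrtr ?(ltW T0) //.
  exact: le_trans TE h.
have s0 : (0 <= (Num.sqrt T)%:E)%E by rewrite lee_fin sqrtr_ge0.
apply: le_trans (lee_pmul s0 s0 key key); rewrite -EFinM lee_fin -expr2.
have [T0|T0] := leP T 0; first by rewrite (le_trans T0) // sqr_ge0.
by rewrite sqr_sqrtr // ltW.
Qed.
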